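(* Let $n,p\ge1$. Let the group $\prod_{j=1}^p \mathrm{S}_n$ act on $\bigoplus_{j=1}^p\mathbb{R}^n=\mathbb{R}^{pn}$, the $j$-th factor permuting the coordinates of the $j$-th summand. Let $\sigma=(\sigma_1,\ldots,\sigma_n):\mathbb{R}^n\to\mathbb{R}^n$ where $\sigma_i(x)=\sum_{1\le j_1<\cdots<j_i\le n}x_{j_1}\cdots x_{j_i}$, and let $\theta:\mathbb{R}^{pn}\to\mathbb{R}^{pn}$, $\theta(x^1,\ldots,x^p)=(\sigma(x^1),\ldots,\sigma(x^p))$. Let $M=(M_k)$ and $N=(N_k)$ be increasing (i.e. $M_{k+1}\ge M_k$, $N_{k+1}\ge N_k$) logarithmically convex sequences of positive reals with $M_0=N_0=1$. Then the following are equivalent: (i) for every $\prod_{j=1}^p\mathrm{S}_n$-invariant $f\in C^M(\mathbb{R}^{pn})$ there exists $F\in C^N(\theta(\mathbb{R}^{pn}))$ with $f=F\circ\theta$; (ii) $\sup_{k\in\mathbb{N}_{>0}}\big(M_{kn}/N_k\big)^{1/k}<\infty$.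
   Context: A sequence $(M_k)$ of positive reals is logarithmically convex if $M_k^2\le M_{k-1}M_{k+1}$ for all $k\ge1$. For $U\subseteq\mathbb{R}^q$ open, $C^M(U)$ is the set of $f\in C^\infty(U)$ such that for each compact $K\subseteq U$ there are $C,\varrho>0$ with $|\partial^\alpha f(x)|\le C\varrho^{|\alpha|}|\alpha|!\,M_{|\alpha|}$ for all $\alpha$ and $x\in K$. For the closed set $A=\theta(\mathbb{R}^{pn})$ (which is the closure of its interior), $C^N(A)$ denotes the set of functions $F:A\to\mathbb{R}$ which are $C^\infty$ in the interior of $A$, all of whose partial derivatives extend continuously to $A$, and such that for each compact $K\subseteq A$ there are $C,\varrho>0$ with $|\partial^\alpha F(y)|\le C\varrho^{|\alpha|}|\alpha|!\,N_{|\alpha|}$ for all $\alpha$ and $y\in K$. *)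

(* Defs.v *)
(* R : realType, R^{pn} is represented as 'M[R]_(p,n),
   row j being the j-th summand x^j in R^n. *)
From HB Require Import structures.
From mathcomp Require Import all_boot all_order all_algebra fingroup perm.
From mathcomp Require Import all_classical all_reals all_analysis.
Set Implicit Arguments. Unset Strict Implicit. Unset Printing Implicit Defensive.
Import Order.TTheory GRing.Theory Num.Theory.
Import numFieldNormedType.Exports.
Local Open Scope classical_set_scope.
Local Open Scope ring_scope.

Section Defs.
Variables (R : realType) (p n : nat).
Notation V := 'M[R]_(p, n).
Notation I := ('I_p * 'I_n)%type.

Definition dir (ij : I) : V := delta_mx ij.1 ij.2.

Definition pd (ij : I) (f : V -> R) : V -> R := 'D_(dir ij) f.

Definition pds (s : seq I) (f : V -> R) : V -> R := foldr pd f s.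

Definition mindex := {ffun I -> nat}.
Definition mabs (a : mindex) : nat := (\sum_(ij : I) a ij)%N.
Definition pdm (a : mindex) (f : V -> R) : V -> R :=
  foldr (fun ij g => iter (a ij) (pd ij) g) f (index_enum I).

Definition smooth_on (U : set V) (f : V -> R) : Prop :=
  forall s : seq I, forall x, U x ->
    (forall ij, derivable (pds s f) x (dir ij)) /\ {for x, continuous (pds s f)}.

Definition dc_bound (M : nat -> R) (K : set V) (g : mindex -> V -> R) : Prop :=
  exists C rho : R, 0 < C /\ 0 < rho /\
    forall (a : mindex) x, K x ->
      `|g a x| <= C * rho ^+ mabs a * (mabs a)`!%:R * M (mabs a).

Definition CM (M : nat -> R) (U : set V) (f : V -> R) : Prop :=
  smooth_on U f /\
  forall K : set V, compact K -> K `<=` U -> dc_bound M K (fun a => pdm a f).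

(* C^N(A) for a closed set A that is the closure of its interior:
   smooth in the interior, every partial derivative extends continuously to A
   (extension G a), and the extensions satisfy the estimate on compacts of A *)
Definition CN_closed (N : nat -> R) (A : set V) (F : V -> R) : Prop :=
  smooth_on (A°) F /\
  exists G : mindex -> V -> R,
    (forall a y, A° y -> G a y = pdm a F y) /\
    (forall a, {within A, continuous (G a)}) /\
    (forall K : set V, compact K -> K `<=` A -> dc_bound N K G).

Definition sym_invariant (f : V -> R) : Prop :=
  forall (s : {ffun 'I_p -> 'S_n}) (x : V),
    f (\matrix_(j, i) x j (s j i)) = f x.

Definition esym (x : 'I_n -> R) (k : nat) : R :=
  \sum_(S : {set 'I_n} | #|S| == k) \prod_(j in S) x j.

Definition thetamap (x : V) : V := \matrix_(j, i) esym (fun l => x j l) i.+1.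
End Defs.

Definition logconvex (R : realType) (M : nat -> R) : Prop :=
  (forall k, 0 < M k) /\ (forall k, (0 < k)%N -> M k ^+ 2 <= M k.-1 * M k.+1).

Definition nondecr_seq (R : realType) (M : nat -> R) : Prop :=
  forall k, M k <= M k.+1.

(* Main.v *)
(* For a polynomial p and the elementary symmetric functions y of x_1, .., x_n,
   every y-derivative of the power sum y |-> sum_i p(x_i) of order k is, up to
   sign and a factorial, a divided difference of p^`() * 'X^e at the nodes x_1,
   .., x_n, each repeated k times; hence it is bounded by k! times derivatives
   of p of order at most n k (and of order exactly n k at the origin).  An
   invariant smooth f is approximated, with its derivatives, by sums of products
   of one-variable (Bernstein) polynomials.  Eliminating the variables one by
   one, the symmetrisation of such a product becomes a combination of products
   of power sums, so the y-derivatives of order k of the approximations are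
   controlled by the x-derivatives of f of order at most n k, and they converge
   uniformly on compacts: their limits are the derivatives of F.
   Conversely, apply (i) to f(x) = sum_i phi(x^1_i) with phi Bang's
   characteristic function of the class C^M, |phi^(j)(0)| >= j! M_j.  The k-th
   derivative of F at 0 along the last coordinate of the first block is
   (k-1)! n k phi^(n k)(0) / (n k)! up to sign, so that its absolute value is at
   least k! M_(n k), which compared with the N-estimate gives (ii). *)
Require Import Defs.
From HB Require Import structures.
From mathcomp Require Import all_boot all_order all_algebra fingroup perm.
From mathcomp Require Import all_classical all_reals all_analysis.
From mathcomp Require Import ring lra zify.
From mathcomp Require Import polyrcf.
Set Implicit Arguments. Unset Strict Implicit. Unset Printing Implicit Defensive.
Import Order.TTheory GRing.Theory Num.Theory.
Import numFieldNormedType.Exports.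
Local Open Scope classical_set_scope.
Local Open Scope ring_scope.

(** * Divided differences *)

Section PolyTaylor.
Variable R : realType.
Implicit Types (p q : {poly R}) (x u : R).

(** The estimates must hold up to the boundary of the image of [thetamap], where roots collide.
    Divided differences defined by polynomial division make sense for repeated nodes, so the
    formulas hold at every [thetamap x] and no passage from simple to multiple roots is required.
    This is what polynomial tensors provide: explicit y-derivatives of all orders, defined
    everywhere. The terms of an approximating tensor may be large and cancel, so nothing can be
    estimated term by term: each elimination step is a linear functional in one variable, applied to
    the whole tensor with the other variables frozen, and only mixed derivatives of the whole sum
    enter ([tensor_le]). Every step costs a factor geometric in the order, harmless in a class where
    rho is free. Applied to differences of approximants, the same estimate gives the uniform
    convergence of all derivatives on the image. For the converse, derivatives are read off at 0,
    which is not an interior point of the image when n is at least 2; interior points accumulating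
    at 0 transfer the identity. *)

Definition tayl (i : nat) u p : R := p^`N(i).[u].

(** Translation by [u] turns Taylor coefficients into coefficients, so the Leibniz rule [taylM],
    free of binomials, is just multiplication of polynomials. *)
Lemma coef_comp_polyXaddC p u i : (p \Po ('X + u%:P))`_i = tayl i u p.
Proof.
have -> : p \Po ('X + u%:P) = \sum_(j < size p) tayl j u p *: 'X^j.
  rewrite /comp_poly addrC nderiv_taylor; last exact: mulrC.
  rewrite size_map_poly; apply: eq_bigr => j _.
  by rewrite nderivn_map horner_map mul_polyC.
rewrite coef_sumMXn /=.
have [ip|ip] := ltnP i (size p); last first.
  rewrite big1 => [|j /eqP ji]; last by move: (ltn_ord j); rewrite ji ltnNge ip.
  rewrite /tayl [p^`N(i)](_ : _ = 0) ?horner0//.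
  apply/polyP => j; rewrite coef_nderivn coef0 nth_default ?mul0rn//.
  by rewrite (leq_trans ip)// leq_addr.
by rewrite (big_pred1 (Ordinal ip)).
Qed.

Lemma taylM i u p q :
  tayl i u (p * q) = \sum_(j < i.+1) tayl j u p * tayl (i - j) u q.
Proof.
rewrite -coef_comp_polyXaddC rmorphM/= coefM; apply: eq_bigr => j _.
by rewrite !coef_comp_polyXaddC.
Qed.

Lemma tayl0 u p : tayl 0 u p = p.[u].
Proof. by rewrite /tayl nderivn0. Qed.

Lemma tayl_linear i u : linear (tayl i u).
Proof. by move=> a p q; rewrite /tayl linearP hornerD hornerZ. Qed.

HB.instance Definition _ i u :=
  GRing.isLinear.Build R {poly R} R _ (tayl i u) (tayl_linear i u).

Lemma taylC i u c : tayl i u c%:P = c *+ (i == 0%N).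
Proof. by rewrite -coef_comp_polyXaddC comp_polyC coefC; case: eqP. Qed.

Lemma tayl1 i u : tayl i u 1 = (i == 0%N)%:R.
Proof.
by rewrite -coef_comp_polyXaddC rmorph1 coef1.
Qed.

Lemma taylXn i u m : tayl i u 'X^m = u ^+ (m - i) *+ 'C(m, i).
Proof. by rewrite /tayl nderivnXn hornerMn hornerXn. Qed.

Lemma taylXsubC i u x :
  tayl i u ('X - x%:P) = (u - x) *+ (i == 0%N) + (i == 1%N)%:R.
Proof.
rewrite linearB/= taylC -['X]expr1 taylXn.
case: i => [|[|i]].
- by rewrite bin0 !mulr1n expr1 addr0.
- by rewrite binn mulr1n subnn expr0 !mulr0n subr0 add0r.
- by rewrite bin_small// !mulr0n subr0 addr0.
Qed.

Lemma tayl_deriv i u p : tayl i u p^`() = tayl i.+1 u p *+ i.+1.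
Proof.
rewrite /tayl -hornerMn; congr (_.[u]); apply/polyP => j.
rewrite coefMn !coef_nderivn coef_deriv -!mulrnA; rewrite addSn; congr (_ *+ _).
by rewrite [RHS]mulnC -mul_bin_diag.
Qed.

Lemma deriv_nderivn m p : p^`N(m)^`() = p^`N(m.+1) *+ m.+1.
Proof.
apply/polyP => j; rewrite coef_deriv coefMn !coef_nderivn -!mulrnA.
rewrite addnS addSn; congr (_ *+ _).
by rewrite [RHS]mulnC mul_bin_left mulnC -addnS addKn.
Qed.

End PolyTaylor.

Section DividedDifferences.
Variable R : realType.
Implicit Types (p q : {poly R}) (x u : R) (s : seq R).

(** The quotient by ['X - x%:P] is [(p - p(x)) / (X - x)], so repeated nodes need no limit. The
    value 0 on the empty list makes [divdiff_mulX] hold for a single node too. *)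
Fixpoint divdiff s p : R :=
  if s is x :: s' then
    if s' is [::] then p.[x] else divdiff s' (p %/ ('X - x%:P))
  else 0.

Lemma divdiff_cons x y s p : divdiff [:: x, y & s] p = divdiff (y :: s) (p %/ ('X - x%:P)).
Proof. by []. Qed.

Lemma divdiff_linear s : linear (divdiff s).
Proof.
case: s => [|x s] a p q; first by rewrite /= scaler0 addr0.
elim: s x p q => [|y s IH] x p q; first by rewrite /= hornerD hornerZ.
by rewrite !divdiff_cons divpD divpZl IH.
Qed.

HB.instance Definition _ s :=
  GRing.isLinear.Build R {poly R} R _ (divdiff s) (divdiff_linear s).

Lemma divdiffD s p q : divdiff s (p + q) = divdiff s p + divdiff s q.
Proof. exact: linearD. Qed.

Lemma divdiffZ s a p : divdiff s (a *: p) = a * divdiff s p.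
Proof. exact: linearZ. Qed.

Lemma divdiff_mulX x s p : divdiff (x :: s) (p * ('X - x%:P)) = divdiff s p.
Proof.
case: s => [|y s]; first by rewrite /= hornerM hornerXsubC subrr mulr0.
by rewrite divdiff_cons mulpK // polyXsubC_eq0.
Qed.

Lemma divdiff_mulprod xs s p :
  divdiff (xs ++ s) (p * \prod_(x <- xs) ('X - x%:P)) = divdiff s p.
Proof.
elim: xs p => [|x xs IH] p; first by rewrite big_nil mulr1.
by rewrite big_cons mulrA mulrAC divdiff_mulX IH.
Qed.

Lemma divdiff_small s p : (size p < size s)%N -> divdiff s p = 0.
Proof.
case: s => [//|x s]; elim: s x p => [|y s IH] x p.
  by rewrite /= ltnS leqn0 size_poly_eq0 => /eqP ->; rewrite horner0.
move=> ps; rewrite divdiff_cons IH//.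
rewrite size_divp ?polyXsubC_eq0// size_XsubC/= subn1.
by case: (size p) ps.
Qed.

Lemma divdiff_monic s p : p \is monic -> size p = size s -> divdiff s p = 1.
Proof.
case: s => [|x s]; first by move=> /monic_neq0 + /eqP; rewrite /= size_poly_eq0 => /negPf ->.
elim: s x p => [|y s IH] x p pm ps.
  move/eqP: ps pm => /size_poly1P[c c0 ->].
  by rewrite monicE lead_coefC => /eqP ->; rewrite /= hornerC.
have sq : size (p %/ ('X - x%:P)) = (size s).+1.
  by rewrite size_divp ?polyXsubC_eq0// size_XsubC/= ps subn1.
rewrite divdiff_cons IH// monicE.
have := divp_eq p ('X - x%:P); rewrite modp_XsubC => pE.
move: pm; rewrite monicE {1}pE lead_coefDl ?lead_coefM ?lead_coefXsubC ?mulr1//.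
rewrite size_Mmonic ?monicXsubC -?size_poly_eq0 ?sq// size_XsubC.
by rewrite (leq_ltn_trans (size_polyC_leq1 _))// addn2.
Qed.

(** For distinct nodes this is Lagrange's formula: the divided difference of f is the sum of the
    [f(x) / Q'(x)], here with f = p Q' and Q the product. Induction on the nodes covers multiple
    roots. *)
Lemma divdiff_deriv_prod xs p :
  divdiff xs (p * (\prod_(x <- xs) ('X - x%:P))^`()) = \sum_(x <- xs) p.[x].
Proof.
elim: xs p => [|x xs IH] p; first by rewrite !big_nil.
rewrite !big_cons derivM derivXsubC mul1r mulrDr divdiffD.
rewrite [p * (_ * _)]mulrCA [('X - _) * _]mulrC divdiff_mulX IH; congr (_ + _).
rewrite [in LHS](divp_eq p ('X - x%:P)) modp_XsubC mulrDl divdiffD.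
rewrite mulrAC divdiff_mulX.
have -> : divdiff xs (p %/ ('X - x%:P) * \prod_(x <- xs) ('X - x%:P)) = 0.
  by have := divdiff_mulprod xs [::] (p %/ ('X - x%:P)); rewrite cats0.
rewrite add0r mul_polyC divdiffZ divdiff_monic ?mulr1//.
  exact: monic_prod_XsubC.
by rewrite size_prod_XsubC.
Qed.

(* With [p = (X - x) q + p(x)], the mean value theorem applied to
   [(z - x)^(m+1) (q^(m)(z) - B)] writes [q^(m)(u) / m!] as a weighted mean of
   values of [p^(m+1) / (m+1)!]. *)
Lemma tayl_divp_XsubC_le m (r x u B : R) p :
  `|x| <= r -> `|u| <= r ->
  (forall z, `|z| <= r -> tayl m.+1 z p <= B) ->
  tayl m u (p %/ ('X - x%:P)) <= B.
Proof.
move=> xr ur pB; set q := p %/ _.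
have pE z : tayl m.+1 z p = (z - x) * tayl m.+1 z q + tayl m z q.
  rewrite [p in LHS](divp_eq p ('X - x%:P)) modp_XsubC linearD/= -/q.
  rewrite taylC mulr0n addr0 taylM !big_ord_recr/= subnn subSnn.
  rewrite !taylXsubC/= big1 => [|i _]; first by rewrite !mulr0n !addr0; ring.
  rewrite taylXsubC -[(m.+1 - i)%N]prednK ?subn_gt0 ?ltnS ?(ltnW (ltn_ord i))//.
  have := ltn_ord i; rewrite -subn_gt0 subSn ?(ltnW (ltn_ord i))//=.
  by case: (m - i)%N => // k _; rewrite /= mulr0n addr0 mulr0.
have [->|ux] := eqVneq u x.
  by have := pB x xr; rewrite pE subrr mul0r add0r.
pose H : {poly R} := ('X - x%:P) ^+ m.+1 * (q^`N(m) - B%:P).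
have H'E z : H^`().[z] = (z - x) ^+ m *+ m.+1 * (tayl m.+1 z p - B).
  rewrite /H derivM derivB derivC subr0 deriv_nderivn deriv_exp derivXsubC mul1r.
  rewrite !(hornerE, hornerMn) -/(tayl _ _ _) -/(tayl _ _ _) pE exprS.
  rewrite /= !mulrnAl !mulrnAr -mulrnDl; congr (_ *+ _).
  by move: (tayl m z q) (tayl m.+1 z q) (_ ^+ m) => a b c; ring.
have [t /andP[t0 t1] HE] : exists2 t : R, 0 < t < 1 &
    H.[u] - H.[x] = H^`().[x + t * (u - x)] * (u - x).
  have ux0 : u - x != 0 by rewrite subr_eq0.
  have [z zu ->] : exists2 z : R, 0 < (z - x) / (u - x) < 1 &
      H.[u] - H.[x] = H^`().[z] * (u - x).
    move: ux; rewrite neq_lt => /orP[ux|xu].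
      have [z] := poly_mvt H ux; rewrite in_itv/= => /andP[z1 z2] Hz; exists z.
        by rewrite -mulrNN -invrN !opprB divr_gt0 ?ltr_pdivrMr ?mul1r ?subr_gt0//; lra.
      by rewrite -opprB Hz; ring.
    have [z] := poly_mvt H xu; rewrite in_itv/= => /andP[z1 z2] Hz; exists z => //.
    by rewrite divr_gt0 ?ltr_pdivrMr ?mul1r ?subr_gt0//; lra.
  by exists ((z - x) / (u - x)) => //; rewrite divfK// addrCA subrr addr0.
move: HE; rewrite H'E {1 2}/H !hornerM !horner_exp !hornerXsubC subrr expr0n/=.
rewrite mul0r subr0 !hornerD hornerN hornerC addrAC subrr add0r exprMn.
rewrite -subr_le0 => HE; have {HE}-> : tayl m u q - B =
    (t ^+ m * (tayl m.+1 (x + t * (u - x)) p - B)) *+ m.+1.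
  have ux0 : (u - x) ^+ m.+1 != 0 by rewrite expf_neq0// subr_eq0.
  apply: (mulfI ux0); rewrite HE !mulrnAl !mulrnAr; congr (_ *+ _).
  by rewrite exprS; move: (tayl _ _ _ - B) (t ^+ m) (_ ^+ m) => a b c; ring.
rewrite mulrn_wle0// mulr_ge0_le0 ?exprn_ge0 ?(ltW t0)// subr_le0 pB//.
have -> : x + t * (u - x) = (1 - t) * x + t * u by ring.
rewrite (le_trans (ler_normD _ _))// !normrM (gtr0_norm t0) (@gtr0_norm _ (1 - t)) ?subr_gt0//.
have -> : r = (1 - t) * r + t * r by ring.
by rewrite lerD// ler_wpM2l// ?subr_ge0 ltW.
Qed.

(** Each node removed trades one normalised derivative, with no loss of constant. The bound is
    one-sided because the mean value argument is; absolute values follow by applying it to [- p] as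
    well. *)
Lemma divdiff_le s (r B : R) p : s != [::] ->
  (forall x, x \in s -> `|x| <= r) ->
  (forall z, `|z| <= r -> tayl (size s).-1 z p <= B) ->
  divdiff s p <= B.
Proof.
case: s => [//|x s] _; elim: s x p => [|y s IH] x p sr pB.
  by rewrite /= -tayl0 pB// sr// inE.
rewrite divdiff_cons IH// => [z zs|z zr]; first by rewrite sr// inE zs orbT.
by apply: tayl_divp_XsubC_le pB => //; rewrite sr// inE eqxx.
Qed.

Lemma normr_divdiff_le s (r B : R) p : s != [::] ->
  (forall x, x \in s -> `|x| <= r) ->
  (forall z, `|z| <= r -> `|tayl (size s).-1 z p| <= B) ->
  `|divdiff s p| <= B.
Proof.
move=> s0 sr pB; rewrite ler_norml -[- B <= _]lerN2 opprK -mulN1r -divdiffZ.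
apply/andP; split; apply: (@divdiff_le s r) => // z zr.
  by rewrite scaleN1r linearN/= (le_trans (ler_norm _))// normrN pB.
by rewrite (le_trans (ler_norm _))// pB.
Qed.

End DividedDifferences.

(** * Derivatives of sums over the roots *)

Section RowFunctionals.
Variables (R : realType) (n : nat).
Implicit Types (y : 'I_n -> R) (p : {poly R}) (t : seq 'I_n).

(** If [y j] is the (j+1)-st elementary symmetric function of the roots, then [1 - wpoly y] is the
    product of the 1 - x_i X; its inverse generates the complete symmetric functions, its logarithm
    the power sums. *)
Definition wpoly y : {poly R} := \sum_(j < n) ((-1) ^+ j * y j) *: 'X^(j.+1).

(* [1 - wpoly y] is the reversal of the monic polynomial with coefficients
   [y]; [ginv y k m] is the coefficient of [X^m] in [(1 - wpoly y)^-(k + 1)]. *)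
Definition ginvp y k N : {poly R} := \sum_(l < N) wpoly y ^+ l *+ 'C(k + l, l).

Definition ginv y k m : R := (ginvp y k m.+1)`_m.

(** For positive m, m times the coefficient of X^m in - log (1 - w), with w = [wpoly y]: the m-th
    power sum of the roots. *)
Definition pwsum y m : R :=
  n%:R *+ (m == 0%N) + \sum_(l < m) m%:R / l.+1%:R * (wpoly y ^+ l.+1)`_m.

Definition wt t : nat := \sum_(u <- t) u.+1.

(** Differentiating - log (1 - w) along k indices gives, up to sign, (k-1)! X^(wt t) (1 - w)^(-k);
    the factor m is the one in [pwsum]. *)
Definition rowL_mon y t m : R :=
  if t is [::] then pwsum y m else
  (-1) ^+ (\sum_(u <- t) u)%N * ((size t).-1)`!%:R * m%:R *
  (if (wt t <= m)%N then ginv y (size t).-1 (m - wt t) else 0).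

(* When [y] lists the elementary symmetric functions of [xs], this is the
   derivative along [t] of the sum of the values of [p] on [xs]. *)
Definition rowL y t p : R := \sum_(m < size p) p`_m * rowL_mon y t m.

Lemma wpolyX y : wpoly y = 'X * \sum_(j < n) ((-1) ^+ j * y j) *: 'X^j.
Proof. by rewrite mulr_sumr; apply: eq_bigr => j _; rewrite -scalerAr exprS. Qed.

Lemma coef_wpoly_exp y l m : (m < l)%N -> (wpoly y ^+ l)`_m = 0.
Proof. by move=> ml; rewrite wpolyX exprMn coefXnM ml. Qed.

Lemma coef_wpolyM y p m : (wpoly y * p)`_m =
  \sum_(j < n | (j < m)%N) (-1) ^+ j * y j * p`_(m - j.+1).
Proof.
rewrite mulr_suml coef_sum [RHS]big_mkcond/=; apply: eq_bigr => j _.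
by rewrite -scalerAl coefZ coefXnM ltnS leqNgt; case: ltnP => //=; rewrite mulr0.
Qed.

(** Since [wpoly y] is divisible by X, truncating the geometric series at N does not affect the
    coefficients below N. *)
Lemma coef_ginvp y k N m : (m < N)%N -> (ginvp y k N)`_m = ginv y k m.
Proof.
move=> mN; rewrite /ginv /ginvp -(subnKC mN) big_split_ord/= coefD.
rewrite [X in _ + X]coef_sum [X in _ + X]big1 ?addr0// => i _.
by rewrite coefMn coef_wpoly_exp ?mul0rn// addSn ltnS leq_addr.
Qed.

Lemma ginvp0S y N : ginvp y 0 N.+1 = 1 + wpoly y * ginvp y 0 N.
Proof.
rewrite /ginvp big_ord_recl/= bin0 expr0 mulr1n; congr (_ + _).
rewrite mulr_sumr; apply: eq_bigr => i _.
by rewrite !add0n /bump/= !binn !mulr1n exprS.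
Qed.

(** Pascal's rule; this is the truncated form of (1 - w)^-(k+2) = (1 - w)^-(k+1) + w (1 -
    w)^-(k+2). *)
Lemma ginvpSS y k N : ginvp y k.+1 N.+1 = ginvp y k N.+1 + wpoly y * ginvp y k.+1 N.
Proof.
rewrite /ginvp !big_ord_recl/= !bin0 !expr0 !mulr1n -addrA; congr (_ + _).
rewrite mulr_sumr -big_split/=; apply: eq_bigr => i _.
rewrite mulrnAr -exprS /bump !add1n -mulrnDr.
by congr (_ *+ _); rewrite addSn binS addnS.
Qed.

Lemma ginv0 y k : ginv y k 0 = 1.
Proof. by rewrite /ginv /ginvp big_ord1 bin0 expr0 coefC. Qed.

Lemma ginv0S y m : ginv y 0 m.+1 =
  \sum_(j < n | (j < m.+1)%N) (-1) ^+ j * y j * ginv y 0 (m - j).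
Proof.
rewrite /ginv ginvp0S coefD coef1 add0r coef_wpolyM; apply: eq_bigr => j jm.
by rewrite subSS coef_ginvp// ltnS leq_subr.
Qed.

Lemma ginvSS y k m : ginv y k.+1 m.+1 = ginv y k m.+1 +
  \sum_(j < n | (j < m.+1)%N) (-1) ^+ j * y j * ginv y k.+1 (m - j).
Proof.
rewrite /ginv ginvpSS coefD coef_wpolyM; congr (_ + _); apply: eq_bigr => j jm.
by rewrite subSS coef_ginvp// ltnS leq_subr.
Qed.

Lemma pwsumS y m : pwsum y m.+1 =
  \sum_(j < n | (j < m.+1)%N) (-1) ^+ j * y j *+ j.+1 * ginv y 0 (m - j).
Proof.
rewrite /pwsum mulr0n add0r.
(* The operator X d/dX, which multiplies the coefficient of X^m by m, turns - log (1 - w) into X w'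
   / (1 - w). *)
transitivity (('X * ((wpoly y)^`() * ginvp y 0 m.+1))`_m.+1).
  rewrite coefXM/= mulr_sumr coef_sum; apply: eq_bigr => l _.
  rewrite add0n binn mulr1n.
  have := congr1 (fun p : {poly R} => p`_m) (deriv_exp (wpoly y) l.+1).
  rewrite /= coef_deriv coefMn -[_ *+ m.+1]mulr_natr -[_ *+ l.+1]mulr_natr => E.
  have l0 : l.+1%:R != 0 :> R by rewrite pnatr_eq0.
  by apply: (mulfI l0); rewrite mulrA mulrCA mulfV// mulr1 mulrC E mulrC.
have -> : (wpoly y)^`() = \sum_(j < n) ((-1) ^+ j * y j) *: ('X^j *+ j.+1).
  by rewrite [LHS]linear_sum/=; apply: eq_bigr => j _; rewrite derivZ derivXn.
rewrite mulrA mulrC mulrA mulr_sumr coef_sum [RHS]big_mkcond/=.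
apply: eq_bigr => j _; rewrite -scalerAr coefZ mulrnAr -[_ * 'X * _]mulrA -exprS.
rewrite coefMn coefMXn ltnS leqNgt; case: ltnP => //=; last by rewrite mul0rn mulr0.
by move=> jm; rewrite subSS coef_ginvp ?ltnS ?leq_subr// mulrnAr mulrnAl.
Qed.

Lemma rowL_linear y t : linear (rowL y t).
Proof.
move=> a p q.
have wid N (f : {poly R}) : (size f <= N)%N -> rowL y t f = \sum_(m < N) f`_m * rowL_mon y t m.
  move=> fN; rewrite /rowL (big_ord_widen N (fun m => f`_m * rowL_mon y t m))//.
  rewrite big_mkcond/=; apply: eq_bigr => m _; case: ltnP => // fm.
  by rewrite nth_default// mul0r.
pose N := maxn (size (a *: p + q)) (maxn (size p) (size q)).
rewrite !(wid N) ?leq_max ?leqnn ?orbT// scaler_sumr -big_split/=.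
by apply: eq_bigr => m _; rewrite coefD coefZ mulrDl -mulrA.
Qed.

End RowFunctionals.

(** * Row functionals evaluated at the roots *)

Section RowAtRoots.
Variables (R : realType) (n : nat) (y : 'I_n -> R) (xs : seq R).
Hypothesis xsn : size xs = n.
Hypothesis n_gt0 : (0 < n)%N.
Hypothesis xsE : \prod_(x <- xs) ('X - x%:P) =
  'X^n - \sum_(j < n) ((-1) ^+ j * y j) *: 'X^(n - j.+1).

Let xk k := flatten (nseq k xs).

Let size_xk k : size (xk k) = (k * n)%N.
Proof. by elim: k => //= k IH; rewrite size_cat xsn IH mulSn. Qed.

(** Divided differences of monomials are complete symmetric functions of the nodes; with every root
    repeated k+1 times these are the coefficients of (1 - w)^-(k+1). The exponent exceeds the
    critical degree, number of nodes minus one, by m. *)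
Lemma divdiff_ginv k m : divdiff (xk k.+1) 'X^((m + k.+1 * n).-1) = ginv y k m.
Proof.
have low a k' : (a < (k'.+1 * n).-1)%N -> divdiff (xk k'.+1) 'X^a = 0.
  by move=> ha; rewrite divdiff_small// size_polyXn size_xk; move: ha; rewrite mulSn; lia.
elim/ltn_ind: m k => -[_ k|m IH k].
  rewrite ginv0 divdiff_monic ?monicXn// size_polyXn size_xk add0n prednK//.
  by rewrite muln_gt0.
(* Trade X^n for the product of the X - x, which uses up one copy of [xs], plus lower powers, which
   are covered by the induction on m or vanish by [low]. *)
have step k' : divdiff (xk k'.+1) 'X^((m.+1 + k'.+1 * n).-1) = divdiff (xk k') 'X^(m + k' * n) +
    \sum_(j < n | (j < m.+1)%N) (-1) ^+ j * y j * ginv y k' (m - j).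
  clear k; rename k' into k.
have -> : 'X^((m.+1 + k.+1 * n).-1) = 'X^(m + k * n) * \prod_(x <- xs) ('X - x%:P) +
    \sum_(j < n) ((-1) ^+ j * y j) *: 'X^(m + k * n + (n - j.+1)) :> {poly R}.
  rewrite xsE mulrBr mulr_sumr -exprD addSn/= mulSn.
  rewrite [X in _ - X + _](eq_bigr (fun j : 'I_n => ((-1) ^+ j * y j) *: 'X^(m + k * n + (n - j.+1)))).
    by rewrite subrK; congr ('X^ _); lia.
  by move=> j _; rewrite -scalerAr -exprD.
rewrite divdiffD divdiff_mulprod [divdiff _ (\sum_(_ < _) _)]linear_sum/=.
have -> : \sum_(i < n) divdiff (xk k.+1) (((-1) ^+ i * y i) *: 'X^(m + k * n + (n - i.+1))) =
    \sum_(j < n | (j < m.+1)%N) (-1) ^+ j * y j * ginv y k (m - j).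
  rewrite [RHS]big_mkcond/=; apply: eq_bigr => j _; rewrite divdiffZ.
  have jn := ltn_ord j; case: ltnP => [jm|mj].
    by rewrite -IH; [do 3 f_equal; rewrite mulSn; lia | lia].
  by rewrite low ?mulr0// mulSn; lia.
by [].
elim: k => [|k IHk]; first by rewrite step add0r ginv0S.
by rewrite step ginvSS -IHk.
Qed.

(** Apply [divdiff_deriv_prod] to X^m and expand Q' by [xsE]: every term is a divided difference of
    a monomial, and the recurrence [ginv0S] turns the result into Newton's identities. *)
Lemma sum_rootsX m : \sum_(x <- xs) x ^+ m = pwsum y m.
Proof.
have low a : (a < n.-1)%N -> divdiff xs 'X^a = 0.
  by move=> ha; rewrite divdiff_small// size_polyXn xsn; lia.
have xk1 : xk 1 = xs by rewrite /xk /= cats0.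
have divdiff_n a : divdiff xs 'X^((a + n).-1) = ginv y 0 a.
  by rewrite -xk1 -[X in (_ + X)%N]mul1n divdiff_ginv.
have -> : \sum_(x <- xs) x ^+ m = \sum_(x <- xs) ('X^m : {poly R}).[x].
  by apply: eq_bigr => x _; rewrite hornerXn.
rewrite -divdiff_deriv_prod xsE derivB derivXn.
have -> : (\sum_(j < n) ((-1) ^+ j * y j) *: 'X^(n - j.+1))^`() =
   \sum_(j < n) ((-1) ^+ j * y j) *: ('X^((n - j.+1).-1) *+ (n - j.+1)) :> {poly R}.
  by rewrite [LHS]linear_sum/=; apply: eq_bigr => j _; rewrite derivZ derivXn.
rewrite mulrBr mulrnAr -exprD mulr_sumr.
rewrite (_ : 'X^(m + n.-1) *+ n = n%:R *: 'X^((m + n).-1)); last first.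
  by rewrite scaler_nat; congr ('X^ _ *+ _); lia.
rewrite -scaleN1r divdiffD !divdiffZ divdiff_n [divdiff _ (\sum_(_ < _) _)]linear_sum/=.
have -> : \sum_(i < n) divdiff xs ('X^m * (((-1) ^+ i * y i) *: ('X^((n - i.+1).-1) *+ (n - i.+1)))) =
    \sum_(j < n | (j < m)%N) (-1) ^+ j * y j * (n - j.+1)%:R * ginv y 0 (m - j.+1).
  rewrite [RHS]big_mkcond/=; apply: eq_bigr => j _.
  rewrite -scalerAr divdiffZ ['X^m * _]mulrnAr -exprD -scaler_nat divdiffZ mulrA.
  have jn := ltn_ord j; have [->|nj] := eqVneq (n - j.+1)%N 0%N.
    by rewrite mulr0 !mul0r; case: ifP.
  case: ltnP => [jm|mj].
    by rewrite -divdiff_n; congr (_ * divdiff _ 'X^ _); lia.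
  by rewrite low ?mulr0//; lia.
case: m => [|m].
  rewrite ginv0 mulr1 big_pred0// mulr0 addr0 /pwsum big_ord0 addr0.
  by rewrite eqxx mulr1n.
rewrite ginv0S pwsumS mulr_sumr mulN1r -sumrB; apply: eq_bigr => j jm.
have jn := ltn_ord j; rewrite subSS natrB// -[X in _ = X * _]mulr_natr.
move: (ginv _ _ _) (_ ^+ _) (y j) (n%:R) (j.+1%:R) => a b c d e; ring.
Qed.

Lemma rowL_nil p : rowL y [::] p = \sum_(x <- xs) p.[x].
Proof.
under [RHS]eq_bigr do rewrite horner_coef.
by rewrite exchange_big/=; apply: eq_bigr => m _; rewrite -mulr_sumr sum_rootsX.
Qed.

Definition colwt (t : seq 'I_n) := (\sum_(u <- t) (n - u.+1))%N.

Lemma wt_colwt t : (wt t + colwt t = size t * n)%N.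
Proof.
rewrite /wt /colwt -big_split/= (eq_bigr (fun=> n)) => [|u _]; last by rewrite subnKC.
by rewrite big_const_seq count_predT iter_addn_0 mulnC.
Qed.

(** By linearity only monomials matter. Since [wt + colwt] is the number of nodes, X^(m-1+colwt)
    lies m - wt above the critical degree; for m < wt it lies below, and both sides vanish. *)
Lemma rowL_cons u t p : rowL y (u :: t) p =
  (-1) ^+ (\sum_(v <- u :: t) v)%N * (size t)`!%:R *
  divdiff (xk (size t).+1) (p^`() * 'X^(colwt (u :: t))).
Proof.
rewrite -[in RHS](coefK p) poly_def [_^`()]linear_sum mulr_suml [divdiff _ _]linear_sum/=.
rewrite mulr_sumr; apply: eq_bigr => m _.
rewrite derivZ -[X in divdiff _ X]scalerAl divdiffZ [in RHS]mulrCA; congr (_ * _).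
rewrite /rowL_mon -mulrA; congr (_ * _).
rewrite derivXn [_ * 'X^_]mulrnAl -exprD -[X in divdiff _ X]scaler_nat divdiffZ; case: m => -[|m] mp /=.
  by rewrite !mul0r.
have := wt_colwt (u :: t); rewrite mulSn /= => wE.
congr (_ * _); case: leqP => [wm|mw].
  rewrite -divdiff_ginv; congr (divdiff _ 'X^_); rewrite mulSn -wE; lia.
rewrite divdiff_small// size_polyXn [size _]size_xk mulSn -wE; lia.
Qed.

(** K nodes call for the Taylor coefficient of order K-1 of p' X^e, hence for derivatives of p up to
    order K = n k. The constant is 8 = 2 * 2 * 2: the number K of Leibniz terms, the factor j+1
    coming from p', and the binomial coefficient coming from X^e are each at most 2^K. *)
Lemma rowL_bound (r rho A : R) t p : 1 <= r -> 1 <= rho -> 0 <= A ->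
  (forall x, x \in xs -> `|x| <= r) ->
  (forall z l, `|z| <= r -> (l <= n * size t)%N -> `|tayl l z p| <= A * rho ^+ l) ->
  `|rowL y t p| <= n%:R * (size t)`!%:R * A * (8 * r * rho) ^+ (n * size t).
Proof.
move=> r1 rho1 A0 xr pA; have r0 := le_trans ler01 r1; have rho0 := le_trans ler01 rho1.
case: t pA => [|u t] pA.
  rewrite rowL_nil muln0 expr0 fact0 !mulr1 (le_trans (ler_norm_sum _ _ _))//.
  rewrite -[X in X%:R * A]xsn -(sum1_size xs) natr_sum mulr_suml.
  rewrite big_seq [leRHS]big_seq; apply: ler_sum => x xin.
  by rewrite mul1r -tayl0; have := pA x 0%N (xr x xin) (leq0n _); rewrite expr0 mulr1.
rewrite rowL_cons 2!normrM normr_sign mul1r normr_nat.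
set K := (n * size (u :: t))%N in pA *; set e := colwt (u :: t).
have eK : (e <= K)%N by have := wt_colwt (u :: t); rewrite /K mulnC => <-; rewrite leq_addl.
have K0 : (0 < K)%N by rewrite muln_gt0 n_gt0.
have sK : size (xk (size t).+1) = K by rewrite size_xk mulnC.
have divdiff_bd : `|divdiff (xk (size t).+1) (p^`() * 'X^e)| <= A * (8 * r * rho) ^+ K.
  apply: (@normr_divdiff_le _ _ r); first by rewrite -size_eq0 sK -lt0n.
    by move=> x /flattenP[s /nseqP[-> _]]; exact: xr.
  move=> z zr; rewrite sK taylM prednK//.
  have -> : A * (8 * r * rho) ^+ K = \sum_(j < K) A * (8 * r * rho) ^+ K / K%:R.
    rewrite sumr_const card_ord -[RHS]mulr_natr divfK//.
    by rewrite pnatr_eq0 -lt0n.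
  apply: (le_trans (ler_norm_sum _ _ _)); apply: ler_sum => j _.
  have jK := ltn_ord j; rewrite normrM tayl_deriv taylXn !normrMn normrX.
  have -> : (8 * r * rho) ^+ K = 2 ^+ K * 2 ^+ K * (r ^+ K * 2 ^+ K) * rho ^+ K :> R.
    by rewrite -!exprMn; congr (_ ^+ _); ring.
  rewrite ler_pdivlMr ?ltr0n//.
  have h1 : `|tayl j.+1 z p| <= A * rho ^+ K.
    rewrite (le_trans (pA z j.+1 zr jK))// ler_wpM2l//.
    by rewrite ler_weXn2l.
  have h2 : `|z| ^+ (e - (K.-1 - j)) *+ 'C(e, K.-1 - j) <= r ^+ K * 2 ^+ K.
    rewrite -[leLHS]mulr_natr ler_pM ?exprn_ge0//.
      rewrite (@le_trans _ _ (r ^+ (e - (K.-1 - j))))//; first exact: lerXn2r.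
      by rewrite ler_weXn2l// (leq_trans (leq_subr _ _)).
    rewrite -natrX ler_nat (@leq_trans (2 ^ e)%N) ?leq_exp2l//.
    have [ej|je] := ltnP e (K.-1 - j); first by rewrite bin_small.
    rewrite -[X in (X ^ _)%N]/(1 + 1)%N expnDn (bigD1 (Ordinal (je : (_ < e.+1)%N)))//=.
    by rewrite !exp1n !muln1 leq_addr.
  have h3 : (j.+1%:R : R) <= 2 ^+ K.
    by rewrite -natrX ler_nat (leq_trans jK)// ltnW// ltn_expl.
  have h4 : (K%:R : R) <= 2 ^+ K.
    by rewrite -natrX ler_nat ltnW// ltn_expl.
  rewrite -[_ *+ j.+1]mulr_natr.
  have -> : A * (2 ^+ K * 2 ^+ K * (r ^+ K * 2 ^+ K) * rho ^+ K) =
     (A * rho ^+ K) * 2 ^+ K * (r ^+ K * 2 ^+ K) * 2 ^+ K.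
    by move: (_ ^+ _) (_ ^+ _) (_ ^+ _) => a b c; ring.
  by rewrite !ler_pM ?mulr_ge0 ?exprn_ge0 ?mulrn_wge0.
rewrite -[leRHS]mulrA ler_pM// -natrM ler_nat /= factS.
by rewrite -[X in (X <= _)%N]mul1n mulnA leq_mul// muln_gt0 n_gt0.
Qed.

End RowAtRoots.

(** * Elimination of the variables of a product *)

Section Theta.
Variables (R : realType) (p n : nat).
Notation V := 'M[R]_(p, n).
Notation I := ('I_p * 'I_n)%type.

Definition rowroots (x : V) (r : 'I_p) : seq R := [seq x r i | i <- enum 'I_n].

Lemma size_rowroots x r : size (rowroots x r) = n.
Proof. by rewrite size_map size_enum_ord. Qed.

Lemma prod_esym (z : 'I_n -> R) : \prod_i ('X - (z i)%:P) =
  'X^n - \sum_(j < n) ((-1) ^+ j * Defs.esym z j.+1) *: 'X^(n - j.+1).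
Proof.
under eq_bigr do rewrite addrC.
rewrite bigA_distr.
rewrite (partition_big (fun J : {set 'I_n} => inord #|J| : 'I_n.+1) xpredT)//=.
have E (k : 'I_n.+1) : \sum_(J : {set 'I_n} | inord #|J| == k)
    \prod_i (if i \in J then - (z i)%:P else 'X) =
    ((-1) ^+ k * Defs.esym z k) *: 'X^(n - k).
  rewrite /Defs.esym mulr_sumr scaler_suml; apply: eq_big => J.
    by rewrite -val_eqE /= inordK// ltnS -[X in (_ <= X)%N]card_ord max_card.
  move=> /eqP/(congr1 val)/=; rewrite inordK => [Jk|]; last first.
    by rewrite ltnS -[X in (_ <= X)%N]card_ord max_card.
  rewrite (bigID [in J])/=.
  under eq_bigr => i iJ do rewrite iJ -[- _]mulN1r.
  under [X in _ * X]eq_bigr => i iJ do rewrite (negPf iJ).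
  rewrite big_split/= !prodr_const -rmorph_prod Jk.
  have -> : #|[pred i | i \notin J]| = (n - k)%N.
    have := cardC [in J]; have := card_ord n; rewrite Jk.
    by move: #|'I_n| #|_| (nat_of_ord k) => a b c ->; lia.
  by rewrite -scalerA -mul_polyC -[in RHS]mul_polyC rmorphXn rmorphN1 mulrA.
rewrite (eq_bigr _ (fun k _ => E k)) big_ord_recl/= subn0 expr0 mul1r.
have -> : Defs.esym z 0 = 1.
  rewrite /Defs.esym (big_pred1 finset.set0) => [|J]; first by rewrite finset.big_set0.
  by rewrite cards_eq0.
rewrite scale1r -sumrN; congr (_ + _); apply: eq_bigr => j _.
by rewrite /bump/= add1n exprS mulN1r mulNr scaleNr.
Qed.

Lemma prod_rowroots x r : \prod_(z <- rowroots x r) ('X - z%:P) =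
  'X^n - \sum_(j < n) ((-1) ^+ j * thetamap x r j) *: 'X^(n - j.+1).
Proof.
rewrite /rowroots big_map big_enum/= prod_esym; congr (_ - _).
by apply: eq_bigr => j _; rewrite mxE.
Qed.

Definition rowfun (y : V) (r : 'I_p) (j : 'I_n) : R := y r j.

Definition upd (T : Type) (phi : I -> T) (b : I) (q : T) : I -> T :=
  fun i => if i == b then q else phi i.

(** The terms of the Leibniz rule for a product of two factors differentiated along [t]. *)
Fixpoint splits (T : Type) (t : seq T) : seq (seq T * seq T) :=
  if t is u :: t' then
    [seq (u :: s.1, s.2) | s <- splits t'] ++ [seq (s.1, u :: s.2) | s <- splits t']
  else [:: ([::], [::])].

Lemma size_splits (T : Type) (t : seq T) : size (splits t) = (2 ^ size t)%N.
Proof. by elim: t => //= u t IH; rewrite size_cat !size_map IH addnn -mul2n expnS. Qed.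

Lemma splits_size (T : eqType) (t : seq T) s : s \in splits t ->
  (size s.1 + size s.2 = size t)%N.
Proof.
elim: t s => [|u t IH] s /=; first by rewrite inE => /eqP ->.
rewrite mem_cat => /orP[] /mapP[s' s'in ->] /=; rewrite -(IH s' s'in) //.
by rewrite addnS.
Qed.

(** A sum over the roots of row r depends on row r of y only, so one derivative along another row
    kills it. *)
Definition blockL (y : V) (r : 'I_p) (t : seq I) (q : {poly R}) : R :=
  if all (fun u => u.1 == r) t then rowL (rowfun y r) (map snd t) q else 0.

Definition merge (phi : I -> {poly R}) (a b : I) : I -> {poly R} :=
  upd (upd phi a (phi a * phi b)) b 1.

(* At [y = thetamap x], the derivative along [t] of the sum of
   [prod_i (phi i).[x i.1 (q i)]] over the assignments [q] that are injective on
   every row: the variable [b] is summed freely, and the terms where it takes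
   the value of an earlier variable [a] of its row are subtracted. *)
Fixpoint elimv (y : V) (bs : seq I) (t : seq I) (phi : I -> {poly R}) : R :=
  if bs is b :: bs' then
    \sum_(s <- splits t) blockL y b.1 s.1 (phi b) * elimv y bs' s.2 (upd phi b 1)
    - \sum_(a < n | (a < b.2)%N) elimv y bs' t (merge phi (b.1, a) b)
  else (t == [::])%:R * \prod_i (phi i).[0].

(** Admissible orders of elimination: when b is eliminated, every earlier variable of its row is
    still present, so that [merge] always has a target. *)
Fixpoint wfvars (bs : seq I) : Prop :=
  if bs is b :: bs' then
    [/\ b \notin bs', forall a : 'I_n, (a < b.2)%N -> (b.1, a) \in bs' & wfvars bs']
  else True.

Definition usedv (q : {ffun I -> 'I_n}) (b : I) : {set 'I_n} :=
  [set q (b.1, a) | a in [pred a : 'I_n | (a < b.2)%N]].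

Definition updf (q : {ffun I -> 'I_n}) (b : I) v : {ffun I -> 'I_n} :=
  [ffun i => if i == b then v else q i].

(** Built along the same list as [elimv], so that both unfold together; the base assignment is
    overwritten at every variable of [bs]. *)
Fixpoint assigns (bs : seq I) : seq {ffun I -> 'I_n} :=
  if bs is b :: bs' then
    [seq updf q b v | q <- assigns bs', v <- enum [pred v | v \notin usedv q b]]
  else [:: [ffun i => i.2]].

Lemma wfvars_closed bs (r : 'I_p) (a a' : 'I_n) : wfvars bs ->
  (r, a') \in bs -> (a < a')%N -> (r, a) \in bs.
Proof.
elim: bs => [//|b bs IH] [bbs bl wf]; rewrite !inE => /orP[/eqP eb|ha'] aa'.
  by have := bl a; rewrite -eb /= => -> //; rewrite orbT.
by rewrite (IH wf ha' aa') orbT.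
Qed.

Lemma assigns_inj bs q (r : 'I_p) (a a' : 'I_n) : wfvars bs -> q \in assigns bs ->
  (r, a) \in bs -> (r, a') \in bs -> q (r, a) = q (r, a') -> a = a'.
Proof.
elim: bs q a a' => [//|b bs IH] q a a' [bbs bl wf] /allpairsPdep[q' [v [q'in]]].
rewrite mem_enum inE => vu -> .
wlog ab : a a' / (r, a) = b \/ (r, a) <> b /\ (r, a') <> b.
  move=> W ha ha'; have [eb|nb] := eqVneq (r, a) b; first by apply: W => //; left.
  have [eb'|nb'] := eqVneq (r, a') b; last by apply: W => //; right; split; apply/eqP.
  by move/esym => E; apply/esym; apply: W => //; left.
rewrite !inE !ffunE; case: ab => [eb|[/eqP nb /eqP nb']]; last first.
  by rewrite (negPf nb) (negPf nb')/= => ha ha'; apply: IH.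
rewrite eb eqxx/=; have [eb'|nb'] := eqVneq (r, a') b.
  by move=> _ _ _; move: eb'; rewrite -eb => -[].
move=> _ /= ha' E; case/negP: vu; rewrite E.
have [la|la] := ltnP a' b.2.
  by apply/imsetP; exists a'; rewrite ?inE// -eb.
(* If the other variable came later in the row than b, [wfvars_closed] would place b itself in
   [bs]. *)
have aa' : (a < a')%N.
  rewrite -eb/= leq_eqVlt in la; case/orP: la => [/eqP/val_inj aa'|//].
  by rewrite -eb aa' eqxx in nb'.
by case/negP: bbs; rewrite -eb (wfvars_closed wf ha').
Qed.

(** Guarantees that there is at least one assignment, so that one may average over them. *)
Lemma assigns_id bs : exists2 q, q \in assigns bs & forall i, q i = i.2.
Proof.
elim: bs => [|b bs [q qin qid]].
  by exists [ffun i => i.2] => [|i]; rewrite ?inE ?ffunE.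
exists (updf q b b.2) => [|i]; last by rewrite ffunE; case: eqP => [->|].
apply/allpairsPdep; exists q, b.2; split => //.
rewrite mem_enum inE; apply/imsetP => -[a]; rewrite inE qid /= => ab E.
by rewrite E ltnn in ab.
Qed.

(** The free sum over the values of b contains the forbidden ones, those taken by earlier variables
    of the row. The merged terms remove each of them exactly once, because the earlier values are
    distinct by [assigns_inj]. *)
Lemma elimv_nil x bs phi : (0 < n)%N -> wfvars bs ->
  (forall i, i \notin bs -> phi i = 1) ->
  elimv (thetamap x) bs [::] phi =
  \sum_(q <- assigns bs) \prod_i (phi i).[x i.1 (q i)].
Proof.
move=> n0; elim: bs phi => [|b bs IH] phi wf phi1.
  rewrite /= big_seq1 mul1r; apply: eq_bigr => i _.
  by rewrite phi1// !hornerC.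
have [bbs bl wf'] := wf.
have ph1 i : i \notin bs -> upd phi b 1 i = 1.
  by rewrite /upd; case: eqP => // /eqP ib ibs; rewrite phi1// inE negb_or ib.
pose P (q : {ffun I -> 'I_n}) := \prod_i (upd phi b 1 i).[x i.1 (q i)].
rewrite [LHS]/= big_seq1/= IH// -/P.
have -> : blockL (thetamap x) b.1 [::] (phi b) = \sum_v (phi b).[x b.1 v].
  rewrite /blockL/= (rowL_nil (size_rowroots x b.1) n0 (prod_rowroots x b.1)).
  by rewrite big_map big_enum.
have mE (a : 'I_n) : (a < b.2)%N -> elimv (thetamap x) bs [::] (merge phi (b.1, a) b) =
    \sum_(q <- assigns bs) P q * (phi b).[x b.1 (q (b.1, a))].
  move=> ab; have ain := bl a ab.
  have ab0 : (b.1, a) != b by apply: contraNneq bbs => <-.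
  rewrite IH// => [|i ibs]; last first.
    rewrite /merge {1}/upd; case: eqP => // /eqP ib; rewrite /upd.
    by rewrite ifN ?phi1 ?inE ?negb_or ?ib//; apply: contraNneq ibs => ->.
  apply: eq_bigr => q _; rewrite /P (bigD1 (b.1, a))//= [in RHS](bigD1 (b.1, a))//=.
  rewrite /merge /upd (negPf ab0) eqxx hornerM -!mulrA; congr (_ * _).
  rewrite mulrC; congr (_ * _); apply: eq_bigr => i /negPf ia.
  by case: eqP => //; rewrite ia.
rewrite (eq_bigr _ mE) exchange_big/= mulr_sumr -sumrB.
rewrite big_allpairs_dep/= big_seq [RHS]big_seq; apply: eq_bigr => q qin.
rewrite big_enum/= -mulr_sumr.
have -> : \sum_(i < n | (i < b.2)%N) (phi b).[x b.1 (q (b.1, i))] =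
    \sum_(v in usedv q b) (phi b).[x b.1 v].
  rewrite big_imset// => a a'; rewrite !inE => ha ha' E.
  by apply: (assigns_inj wf' qin (bl a ha) (bl a' ha')).
rewrite mulrC -mulrBr (bigID [in usedv q b])/= addrAC subrr add0r mulr_sumr.
apply: eq_big => v; first by rewrite inE.
move=> _; rewrite /P (bigD1 b)//= [in RHS](bigD1 b)//= /upd eqxx hornerC mul1r.
rewrite ffunE eqxx mulrC; congr (_ * _); apply: eq_bigr => i /negPf ib.
by rewrite ib ffunE ib.
Qed.

End Theta.

(** * Estimates for the elimination *)

Section ElimBound.
Variables (R : realType) (p n : nat).
Notation V := 'M[R]_(p, n).
Notation I := ('I_p * 'I_n)%type.
Notation tensor := (seq (R * (I -> {poly R}))).
Hypothesis n_gt0 : (0 < n)%N.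

Lemma blockL_linear (y : V) r t : linear (blockL y r t).
Proof.
move=> a f g; rewrite /blockL; case: ifP => _; first exact: rowL_linear.
by rewrite scaler0 addr0.
Qed.

HB.instance Definition _ (y : V) r t :=
  GRing.isLinear.Build R {poly R} R _ (blockL y r t) (blockL_linear y r t).

Lemma blockLZ (y : V) r t a q : blockL y r t (a *: q) = a * blockL y r t q.
Proof. exact: linearZ. Qed.

Lemma blockL_bound (x : V) r (rad rho A : R) t q : 1 <= rad -> 1 <= rho -> 0 <= A ->
  (forall i j, `|x i j| <= rad) ->
  (forall z l, `|z| <= rad -> (l <= n * size t)%N -> `|tayl l z q| <= A * rho ^+ l) ->
  `|blockL (thetamap x) r t q| <=
    n%:R * (size t)`!%:R * A * (8 * rad * rho) ^+ (n * size t).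
Proof.
move=> rad1 rho1 A0 xr qA; rewrite /blockL; case: ifP => _; last first.
  have rho0 := le_trans ler01 rho1; have rad0 := le_trans ler01 rad1.
  by rewrite normr0 !mulr_ge0 ?exprn_ge0 ?mulr_ge0.
rewrite -(size_map snd t).
apply: (rowL_bound (size_rowroots x r) n_gt0 (prod_rowroots x r)) => //.
  by move=> z /mapP[i _ ->].
by rewrite size_map.
Qed.

(** The normalised mixed derivative of order [beta] at [u] of the function that the tensor
    represents. *)
Definition tev (T : tensor) (beta : I -> nat) (u : I -> R) : R :=
  \sum_(c <- T) c.1 * \prod_i tayl (beta i) (u i) (c.2 i).

(** Only the whole sum is bounded, so cancellation between its terms is kept; the order is limited
    to K because an approximant is controlled only up to a given order. *)
Definition tensor_le (T : tensor) (rad A rho : R) (K : nat) : Prop :=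
  forall beta u, (forall i, `|u i| <= rad) -> (\sum_i beta i <= K)%N ->
  `|tev T beta u| <= A * rho ^+ (\sum_i beta i).

Definition elimT (y : V) bs t (T : tensor) : R := \sum_(c <- T) c.1 * elimv y bs t c.2.

Lemma prod_upd (T : Type) (F : I -> T -> R) (phi : I -> T) b q :
  \prod_i F i (upd phi b q i) = F b q * \prod_(i | i != b) F i (phi i).
Proof.
rewrite (bigD1 b)//= /upd eqxx; congr (_ * _); apply: eq_bigr => i /negPf ib.
by rewrite ib.
Qed.

(** [blockL] is linear in the polynomial: freezing the derivatives in the other variables leaves one
    polynomial in the variable b, whose derivatives are again mixed derivatives of T. Of the
    available orders, [n * size t] are spent on b. *)
Lemma tensor_le_block (x : V) b t T (rad A rho : R) K :
  1 <= rad -> 1 <= rho -> 0 <= A -> (forall i j, `|x i j| <= rad) ->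
  tensor_le T rad A rho (K + n * size t) ->
  tensor_le [seq (c.1 * blockL (thetamap x) b.1 t (c.2 b), upd c.2 b 1) | c <- T] rad
    (n%:R * (size t)`!%:R * A * (8 * rad * rho) ^+ (n * size t)) rho K.
Proof.
move=> rad1 rho1 A0 xr TA beta u ur bK; rewrite /tev big_map/=.
have rho0 := le_trans ler01 rho1; have rad0 := le_trans ler01 rad1.
have -> : \sum_(c <- T) c.1 * blockL (thetamap x) b.1 t (c.2 b) *
     \prod_i tayl (beta i) (u i) (upd c.2 b 1 i) =
   (beta b == 0%N)%:R * blockL (thetamap x) b.1 t
     (\sum_(c <- T) (c.1 * \prod_(i | i != b) tayl (beta i) (u i) (c.2 i)) *: c.2 b).
  rewrite linear_sum mulr_sumr/=; apply: eq_bigr => c _; rewrite blockLZ.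
  rewrite (prod_upd (fun i => tayl (beta i) (u i))) tayl1.
  by move: (blockL _ _ _ _) (\prod_(_ | _) _) => a d; ring.
case: eqP => [b0|_]; last first.
  by rewrite mul0r normr0 !mulr_ge0 ?exprn_ge0 ?mulr_ge0.
rewrite mul1r [leRHS]mulrAC -[n%:R * _ * A * _]mulrA.
apply: blockL_bound => //; first by rewrite mulr_ge0 ?exprn_ge0.
move=> z l zr ln; rewrite linear_sum/=.
pose beta' i := if i == b then l else beta i.
pose u' i := if i == b then z else u i.
have b'E : (\sum_i beta' i = \sum_i beta i + l)%N.
  rewrite (bigD1 b)//= [in RHS](bigD1 b)//= b0 add0n /beta' eqxx addnC.
  by congr (_ + _)%N; apply: eq_bigr => i /negPf ->.
rewrite -[A * _ * _]mulrA -exprD -b'E [X in `|X|](_ : _ = tev T beta' u'); last first.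
  apply: eq_bigr => c _; rewrite linearZ/= [in RHS](bigD1 b)//= /beta' /u' eqxx.
  rewrite -[LHS]mulrA [X in _ * X = _]mulrC; congr (_ * (_ * _)).
  by apply: eq_bigr => i /negPf ->.
apply: TA; first by move=> i; rewrite /u'; case: eqP.
by rewrite b'E leq_add.
Qed.

(** Differentiating the merged factor [beta a] times gives [beta a + 1] Leibniz terms; their number
    is at most 2^(beta a), which the doubled rho absorbs. *)
Lemma tensor_le_merge (a b : I) T (rad A rho : R) K : a != b -> 0 <= A -> 1 <= rho ->
  tensor_le T rad A rho K ->
  tensor_le [seq (c.1, merge c.2 a b) | c <- T] rad A (2 * rho) K.
Proof.
move=> ab A0 rho1 TA beta u ur bK; rewrite /tev big_map/=.
have rho0 := le_trans ler01 rho1.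
(* In the j-th Leibniz term a receives j derivatives and b the others, both at the point [u a]. *)
pose beta' (j : nat) i := if i == b then (beta a - j)%N else if i == a then j else beta i.
pose u' i := if i == b then u a else u i.
have -> : \sum_(c <- T) c.1 * \prod_i tayl (beta i) (u i) (merge c.2 a b i) =
   (beta b == 0%N)%:R * \sum_(j < (beta a).+1) tev T (beta' j) u'.
  rewrite exchange_big mulr_sumr/=; apply: eq_bigr => c _.
  rewrite /merge (prod_upd (fun i => tayl (beta i) (u i))) tayl1.
  rewrite mulrCA; congr (_ * _).
  rewrite (bigD1 a)//= /upd eqxx taylM -mulr_sumr; congr (_ * _).
  rewrite mulr_suml; apply: eq_bigr => j _.
  rewrite [RHS](bigD1 b)//= [X in _ = _ * X](bigD1 a)//= /beta' /u' eqxx (negPf ab) eqxx.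
  rewrite [RHS]mulrA; congr (_ * _); first by rewrite mulrC.
  by apply: eq_bigr => i /andP[/negPf ib /negPf ia]; rewrite ia ib.
have [b0|b0] := eqVneq (beta b) 0%N; last first.
  by rewrite mul0r normr0 !mulr_ge0 ?exprn_ge0 ?mulr_ge0.
rewrite mul1r (le_trans (ler_norm_sum _ _ _))//.
apply: (@le_trans _ _ (\sum_(j < (beta a).+1) A * rho ^+ (\sum_i beta i))).
  apply: ler_sum => j _.
  have bE : (\sum_i beta' j i = \sum_i beta i)%N.
    rewrite [LHS](bigD1 b)//= [X in (_ + X)%N = _](bigD1 a)//= [RHS](bigD1 b)//=.
    rewrite [X in _ = (_ + X)%N](bigD1 a)//= b0 add0n addnA /beta' eqxx (negPf ab) eqxx subnK; last by have := ltn_ord j.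
    by congr (_ + _)%N; apply: eq_bigr => i /andP[/negPf -> /negPf ->].
  by rewrite -bE TA ?bE// => i; rewrite /u'; case: eqP.
rewrite sumr_const card_ord exprMn -[leLHS]mulr_natl mulrCA.
apply: ler_wpM2l => //; apply: ler_wpM2r; first by rewrite exprn_ge0.
have ba : (beta a <= \sum_i beta i)%N by rewrite (bigD1 a)//= leq_addr.
apply: (@le_trans _ _ (2 ^+ beta a)); last by rewrite ler_eXn2l// ltr1n.
by rewrite -(natrX R 2) ler_nat ltn_expl.
Qed.

Lemma sumr_le_size (T : eqType) (s : seq T) (F : T -> R) B :
  (forall i, i \in s -> F i <= B) -> \sum_(i <- s) F i <= (size s)%:R * B.
Proof.
elim: s => [|a s IH] FB; first by rewrite big_nil mul0r.
rewrite big_cons /= -addn1 addnC natrD mulrDl mul1r lerD ?FB ?mem_head//.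
by apply: IH => i si; rewrite FB// inE si orbT.
Qed.

(** Each variable costs 2n in front: n for the power sum and at most n merges. It costs 16 * rad in
    the rate: 8 * rad from [blockL_bound] and 2 for the number of splittings. *)
Lemma elimT_le (x : V) (rad : R) bs t T A rho K : wfvars bs ->
  1 <= rad -> 1 <= rho -> 0 <= A -> (forall i j, `|x i j| <= rad) ->
  tensor_le T rad A rho K -> (n * size t <= K)%N ->
  `|elimT (thetamap x) bs t T| <= A * (2 * n)%:R ^+ size bs *
     ((16 * rad) ^+ size bs * rho) ^+ (n * size t) * (size t)`!%:R.
Proof.
move=> + rad1 + + xr; have rad0 := le_trans ler01 rad1.
have r16 : 1 <= 16 * rad by rewrite (@le_trans _ _ rad)// ler_peMl// ler1n.
elim: bs t T A rho K => [|b bs IH] t T A rho K wf rho1 A0 TA tK.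
  have rho0 := le_trans ler01 rho1.
  rewrite /elimT /= !expr0 mulr1 mul1r; case: t tK => [|u t] tK.
    have := TA (fun=> 0%N) (fun=> 0); rewrite big1// muln0 expr0 fact0 !mulr1.
    rewrite (_ : tev _ _ _ = \sum_(c <- T) c.1 * (true%:R * \prod_i (c.2 i).[0])).
      by apply=> // i; rewrite normr0.
    apply: eq_bigr => c _; rewrite mul1r; congr (_ * _).
    by apply: eq_bigr => i _; rewrite tayl0.
  rewrite big1 => [|c _]; last by rewrite mul0r mulr0.
  by rewrite normr0 !mulr_ge0 ?exprn_ge0.
have rho0 := le_trans ler01 rho1; have [bbs bl wf'] := wf.
set D := (16 * rad) ^+ size bs in IH *; set C := (2 * n)%:R ^+ size bs in IH *.
have D1 : 1 <= D by rewrite exprn_ege1.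
have C0 : 0 <= C by rewrite exprn_ge0.
set k := size t in tK *.
(* Half of the claimed bound: one half serves the Leibniz terms, the other the merged ones. *)
pose B := n%:R * A * C * (16 * rad * D * rho) ^+ (n * k) * k`!%:R.
have -> : elimT (thetamap x) (b :: bs) t T =
    \sum_(s <- splits t) elimT (thetamap x) bs s.2
      [seq (c.1 * blockL (thetamap x) b.1 s.1 (c.2 b), upd c.2 b 1) | c <- T]
    - \sum_(a < n | (a < b.2)%N) elimT (thetamap x) bs t
      [seq (c.1, merge c.2 (b.1, a) b) | c <- T].
  rewrite /elimT /=.
  under [X in _ = X - _]eq_bigr do rewrite big_map.
  under [X in _ = _ - X]eq_bigr do rewrite big_map.
  rewrite exchange_big/= [X in _ = _ - X]exchange_big/= -sumrB; apply: eq_bigr => c _.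
  rewrite mulrBr !mulr_sumr; congr (_ - _).
  by apply: eq_bigr => s _; rewrite mulrA.
have -> : A * (2 * n)%:R ^+ size (b :: bs) *
    ((16 * rad) ^+ size (b :: bs) * rho) ^+ (n * k) * k`!%:R = B + B.
  rewrite /= !exprS -/D -/C natrM /B -mulr2n -mulr_natl.
  move: (_ ^+ (n * k)) k`!%:R => E F; ring.
rewrite (le_trans (ler_normB _ _))//; apply: lerD.
  rewrite (le_trans (ler_norm_sum _ _ _))//.
  (* Each of the 2^k splittings gets an equal share; k1! k2! <= (k1 + k2)! and the spare factor 2 in
     the rate pay for it. *)
  have -> : B = (size (splits t))%:R * (B / (2 ^ k)%:R).
    by rewrite size_splits mulrC divfK// pnatr_eq0 expn_eq0.
  apply: sumr_le_size => -[t1 t2] /splits_size /= tE.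
  have TA' : tensor_le T rad A rho (n * size t2 + n * size t1).
    by move=> beta u ur bK; apply: TA => //; rewrite (leq_trans bK)// -mulnDr addnC tE.
  have A1 : 0 <= n%:R * (size t1)`!%:R * A * (8 * rad * rho) ^+ (n * size t1).
    by rewrite !mulr_ge0 ?exprn_ge0 ?mulr_ge0.
  have := IH t2 _ _ _ _ wf' rho1 A1 (tensor_le_block b rad1 rho1 A0 xr TA') (leqnn _).
  move=> /le_trans; apply.
  rewrite ler_pdivlMr ?ltr0n ?expn_gt0// /B /k -tE.
  move: (size t1) (size t2) => k1 k2.
  have f1 : ((k1`! * k2`!)%:R : R) <= (k1 + k2)`!%:R.
    have /(bin_fact) := leq_addr k2 k1; rewrite addKn => <-.
    by rewrite ler_nat leq_pmull// bin_gt0 leq_addr.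
  have f2 : ((2 ^ (k1 + k2))%:R : R) <= 2 ^+ (n * k1) * 2 ^+ (n * k2).
    by rewrite -exprD -mulnDr -(natrX R 2) ler_nat leq_exp2l// leq_pmull.
  have D0 := le_trans ler01 D1.
  have f3 : (8 * rad * rho) ^+ (n * k1) * 2 ^+ (n * k1) <= (16 * rad * D * rho) ^+ (n * k1).
    rewrite -exprMn lerXn2r ?nnegrE ?mulr_ge0// (_ : _ * 2 = 16 * rad * rho); last by ring.
    by rewrite ler_wpM2r// ler_peMr// (le_trans ler01).
  have f4 : (D * rho) ^+ (n * k2) * 2 ^+ (n * k2) <= (16 * rad * D * rho) ^+ (n * k2).
    rewrite -exprMn lerXn2r ?nnegrE ?mulr_ge0// mulrC mulrA ler_wpM2r// ler_wpM2r//.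
    by rewrite (@le_trans _ _ 16) ?ler_nat// ler_peMr.
  rewrite mulnDr exprD.
  apply: (@le_trans _ _ ((n%:R * A * C) * (((8 * rad * rho) ^+ (n * k1) * 2 ^+ (n * k1)) *
      ((D * rho) ^+ (n * k2) * 2 ^+ (n * k2)) * (k1`! * k2`!)%:R))); last first.
    rewrite -[leRHS]mulrA; apply: ler_wpM2l; first by rewrite !mulr_ge0.
    by apply: ler_pM => //; rewrite ?mulr_ge0 ?exprn_ge0 ?mulr_ge0//; apply: ler_pM;
      rewrite ?mulr_ge0 ?exprn_ge0 ?mulr_ge0.
  rewrite [leRHS](_ : _ = n%:R * k1`!%:R * A * (8 * rad * rho) ^+ (n * k1) * C *
      (D * rho) ^+ (n * k2) * k2`!%:R * (2 ^+ (n * k1) * 2 ^+ (n * k2))); last first.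
    rewrite natrM; move: (_ ^+ _) (_ ^+ _) (_ ^+ _) (_ ^+ _) (_`!%:R) (_`!%:R) => a1 a2 a3 a4 a5 a6.
    ring.
  by apply: ler_wpM2l => //; rewrite !mulr_ge0 ?exprn_ge0 ?mulr_ge0.
(* At most n variables precede b in its row, and the doubled rho of a merge fits into 16 * rad *
   rho. *)
apply: (@le_trans _ _ (n%:R * (A * C * (16 * rad * D * rho) ^+ (n * k) * k`!%:R))); last first.
  by rewrite /B -!mulrA.
apply: (le_trans (ler_norm_sum _ _ _)); rewrite big_mkcond/= -[X in X%:R * _]card_ord mulr_natl -sumr_const.
apply: ler_sum => a _; case: ifP => [ab|_]; last by rewrite !mulr_ge0 ?exprn_ge0 ?mulr_ge0 ?(le_trans ler01 D1).
have rho2 : 1 <= 2 * rho by rewrite (@le_trans _ _ rho)// ler_peMl// ler1n.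
have ba : (b.1, a) != b by apply: contraNneq bbs => <-; exact: bl.
apply: (le_trans (IH t _ A (2 * rho) K wf' rho2 A0 (tensor_le_merge ba A0 rho1 TA) tK)).
rewrite ler_wpM2r// ler_wpM2l ?mulr_ge0// lerXn2r// ?nnegrE ?mulr_ge0 ?(le_trans ler01 D1)//.
rewrite mulrA ler_wpM2r// mulrC ler_wpM2r ?(le_trans ler01 D1)//.
by rewrite (@le_trans _ _ 16) ?ler_nat// ler_peMr.
Qed.

End ElimBound.

(** * Differentiation of the eliminated expressions *)

Section ElimDeriv.
Variables (R : realType) (p n : nat).
Notation V := 'M[R]_(p, n).
Notation I := ('I_p * 'I_n)%type.

(** Continuity is carried along because in several variables it does not follow from the existence
    of directional derivatives. *)
Definition cder (y : V) (u : I) (f : V -> R) (d : R) : Prop :=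
  {for y, continuous f} /\ is_derive y (dir R u) f d.

Lemma cder_cst y u (c : R) : cder y u (fun=> c) 0.
Proof. by split; [exact: cst_continuous | exact: is_derive_cst]. Qed.

Lemma cderD y u f g df dg : cder y u f df -> cder y u g dg ->
  cder y u (fun z => f z + g z) (df + dg).
Proof.
move=> [cf df'] [cg dg']; split; first exact: continuousD.
exact: is_deriveD.
Qed.

Lemma cderM y u f g df dg : cder y u f df -> cder y u g dg ->
  cder y u (fun z => f z * g z) (f y * dg + g y * df).
Proof.
move=> [cf df'] [cg dg']; split; first exact: continuousM.
exact: is_deriveM.
Qed.

Lemma cderZ y u (c : R) f df : cder y u f df -> cder y u (fun z => c * f z) (c * df).
Proof.
move=> fd; have := cderM (cder_cst y u c) fd.
by rewrite mulr0 addr0.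
Qed.

Lemma cderN y u f df : cder y u f df -> cder y u (fun z => - f z) (- df).
Proof.
by move=> [cf df']; split; [exact: continuousN | exact: is_deriveN].
Qed.

Lemma cder_sum (T : Type) (s : seq T) (P : pred T) y u (f : T -> V -> R) (d : T -> R) :
  (forall i, P i -> cder y u (f i) (d i)) ->
  cder y u (fun z => \sum_(i <- s | P i) f i z) (\sum_(i <- s | P i) d i).
Proof.
move=> fd; elim: s => [|i s IH].
  under eq_fun do rewrite big_nil.
  by rewrite big_nil; exact: cder_cst.
under eq_fun do rewrite big_cons.
by rewrite big_cons; case: ifP => // Pi; apply: cderD => //; exact: fd.
Qed.

Lemma cder_sum0 (T : Type) (s : seq T) (P : pred T) y u (f : T -> V -> R) :
  (forall i, P i -> cder y u (f i) 0) ->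
  cder y u (fun z => \sum_(i <- s | P i) f i z) 0.
Proof. by move=> fd; have := cder_sum s fd; rewrite big1. Qed.

Lemma cderZ0 y u (c : R) f : cder y u f 0 -> cder y u (fun z => c * f z) 0.
Proof. by move=> fd; have := cderZ c fd; rewrite mulr0. Qed.

Lemma cder_coord y u i j : cder y u (fun z : V => z i j) ((u == (i, j))%:R).
Proof.
split; first exact: coord_continuous.
have H : (fun h : R => h^-1 *: (((fun z : V => z i j) \o shift y) (h *: dir R u) - y i j)) @ 0^'
    --> ((u == (i, j))%:R : R).
  apply: cvg_near_cst; near=> h.
  rewrite /= !mxE addrK [h^-1 *: _]mulrA mulVf ?mul1r; last by near: h; exact: nbhs_dnbhs_neq.
  by rewrite [u in RHS]surjective_pairing xpair_eqE eq_sym [j == _]eq_sym.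
split; first exact: cvgP H.
exact: cvg_lim H.
Unshelve. all: by end_near.
Qed.

Definition pcder (y : V) (u : I) (A : V -> {poly R}) (D : {poly R}) : Prop :=
  forall m, cder y u (fun z => (A z)`_m) D`_m.

Lemma pcderM y u A B DA DB : pcder y u A DA -> pcder y u B DB ->
  pcder y u (fun z => A z * B z) (A y * DB + B y * DA).
Proof.
move=> dA dB m; under eq_fun do rewrite coefM.
rewrite coefD !coefM.
have -> : \sum_(j < m.+1) (B y)`_j * DA`_(m - j) = \sum_(j < m.+1) (B y)`_(m - j) * DA`_j.
  rewrite (reindex_inj rev_ord_inj)/=; apply: eq_bigr => j _.
  by rewrite subSS subKn// -ltnS.
by rewrite -big_split/=; apply: cder_sum => j _; apply: cderM.
Qed.

Lemma pcderX y u A D l : pcder y u A D -> pcder y u (fun z => A z ^+ l) (A y ^+ l.-1 * D *+ l).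
Proof.
move=> dA; elim: l => [|l IH].
  move=> m; under eq_fun do rewrite expr0.
  by rewrite mulr0n coef0; exact: cder_cst.
have := pcderM dA IH; under eq_fun do rewrite -exprS.
case: l {IH} => [|l]; first by rewrite mulr0n mulr0 add0r expr0.
by rewrite mulrnAr mulrA -exprS -mulrSr.
Qed.

Lemma cder_wpoly y (u : I) r : pcder y u (fun z : V => wpoly (rowfun z r))
  (if u.1 == r then (-1) ^+ u.2 *: 'X^(u.2.+1) else 0).
Proof.
move=> m; rewrite /wpoly; under eq_fun do rewrite coef_sum.
have -> : (if u.1 == r then (-1) ^+ u.2 *: 'X^(u.2.+1) else 0 : {poly R})`_m =
    \sum_(j < n) ((-1) ^+ j * ('X^(j.+1) : {poly R})`_m) * (u == (r, j))%:R.
  case: u => a b /=; under eq_bigr do rewrite xpair_eqE.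
  case: eqP => _; last by rewrite big1 ?coef0// => j _; rewrite mulr0.
  rewrite (bigD1 b)//= eqxx mulr1 coefZ big1 ?addr0// => j /negPf jb.
  by rewrite eq_sym jb mulr0.
apply: cder_sum => j _; under eq_fun do rewrite coefZ mulrAC.
by apply: cderZ; exact: cder_coord.
Qed.

Lemma pcderX_wpoly y (u : I) l m : cder y u (fun z => (wpoly (rowfun z u.1) ^+ l)`_m)
  ((-1) ^+ u.2 * (if (u.2 < m)%N then (wpoly (rowfun y u.1) ^+ l.-1)`_(m - u.2.+1) else 0) *+ l).
Proof.
have := pcderX l (cder_wpoly y u u.1) m; rewrite eqxx coefMn -scalerAr coefZ coefMXn.
by rewrite ltnS leqNgt; case: ltnP.
Qed.

Lemma cder_ginv y (u : I) k m : cder y u (fun z => ginv (rowfun z u.1) k m)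
  ((-1) ^+ u.2 * k.+1%:R *
   (if (u.2 < m)%N then ginv (rowfun y u.1) k.+1 (m - u.2.+1) else 0)).
Proof.
rewrite /ginv /ginvp; under eq_fun do rewrite coef_sum.
have -> : (-1) ^+ u.2 * k.+1%:R * (if (u.2 < m)%N then
      (\sum_(l < (m - u.2.+1).+1) wpoly (rowfun y u.1) ^+ l *+ 'C(k.+1 + l, l))`_(m - u.2.+1)
    else 0) =
  \sum_(l < m.+1) 'C(k + l, l)%:R * ((-1) ^+ u.2 *
     (if (u.2 < m)%N then (wpoly (rowfun y u.1) ^+ l.-1)`_(m - u.2.+1) else 0) *+ l).
  case: ltnP => [um|_]; last by rewrite mulr0 big1// => l _; rewrite mulr0 mul0rn mulr0.
  rewrite -[X in _ * X]/(ginv _ _ _) -(@coef_ginvp _ _ _ _ m); last by lia.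
  rewrite big_ord_recl/= mulr0n mulr0 add0r /ginvp coef_sum mulr_sumr.
  apply: eq_bigr => l _; rewrite coefMn add0n /bump add1n.
  rewrite -[_ *+ l.+1]mulr_natr -[_ *+ 'C(_, _)]mulr_natr.
  (* This identity is the derivative rule for (1 - w)^-(k+1), read on the binomial coefficients of
     its series. *)
  have E : (k.+1 * 'C(k.+1 + l, l) = l.+1 * 'C(k + l.+1, l.+1))%N.
    by rewrite -mul_bin_diag addnS /= addSn mul_bin_down subSn ?leq_addl// addnK.
  have {}E : k.+1%:R * 'C(k.+1 + l, l)%:R = l.+1%:R * 'C(k + l.+1, l.+1)%:R :> R.
    by rewrite -!natrM E.
  move: (_ `_ _) ((-1) ^+ _) => a b.
  transitivity (b * a * (k.+1%:R * 'C(k.+1 + l, l)%:R)); first by ring.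
  by rewrite E; ring.
apply: cder_sum => l _; under eq_fun do rewrite coefMn -mulr_natl.
exact/cderZ/pcderX_wpoly.
Qed.

Lemma cder_pwsum y (u : I) m : cder y u (fun z => pwsum (rowfun z u.1) m)
  ((-1) ^+ u.2 * m%:R *
   (if (u.2 < m)%N then ginv (rowfun y u.1) 0 (m - u.2.+1) else 0)).
Proof.
have -> : (-1) ^+ u.2 * m%:R *
   (if (u.2 < m)%N then ginv (rowfun y u.1) 0 (m - u.2.+1) else 0) = 0 +
  \sum_(l < m) m%:R / l.+1%:R * ((-1) ^+ u.2 *
     (if (u.2 < m)%N then (wpoly (rowfun y u.1) ^+ l)`_(m - u.2.+1) else 0) *+ l.+1).
  case: ltnP => [um|_]; last first.
    by rewrite mulr0 big1 ?addr0// => l _; rewrite mulr0 mul0rn mulr0.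
  rewrite add0r -(@coef_ginvp _ _ _ _ m); last by lia.
  rewrite /ginvp coef_sum mulr_sumr; apply: eq_bigr => l _.
  rewrite add0n binn mulr1n -[_ *+ l.+1]mulr_natr.
  have l0 : l.+1%:R != 0 :> R by rewrite pnatr_eq0.
  by move: (_ `_ _) => a; field.
apply: cderD; first exact: cder_cst.
by apply: cder_sum => l _; exact/cderZ/pcderX_wpoly.
Qed.

(** The first derivative turns the logarithm into (1 - w)^-1, each further one raises the exponent;
    hence the separate case of the empty list. *)
Lemma cder_rowL_mon y (u : I) t m :
  cder y u (fun z => rowL_mon (rowfun z u.1) t m) (rowL_mon (rowfun y u.1) (u.2 :: t) m).
Proof.
case: t => [|v t]; rewrite /rowL_mon.
  have := cder_pwsum y u m.
  by rewrite /wt !big_seq1 /= fact0 mulr1.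
have E a b : wt (a :: b) = (a.+1 + wt b)%N :> nat by rewrite /wt big_cons.
have E' (a : 'I_n) b : (\sum_(w <- a :: b) w = a + \sum_(w <- b) w)%N.
  by rewrite big_cons.
rewrite [wt (u.2 :: _)]E [(\sum_(_ <- [:: u.2, v & t]) _)%N]E'.
set s := \sum_(_ <- _) _; set W := wt _; rewrite /=.
have [Wm|mW] := leqP W m; last first.
  rewrite ifN; last by rewrite -ltnNge (leq_trans mW)// leq_addl.
  by rewrite !mulr0; exact: cder_cst.
have -> : (-1) ^+ (u.2 + s) * (size t).+1`!%:R * m%:R *
     (if (u.2.+1 + W <= m)%N then ginv (rowfun y u.1) (size t).+1 (m - (u.2.+1 + W)) else 0) =
   (-1) ^+ s * (size t)`!%:R * m%:R * ((-1) ^+ u.2 * (size t).+1%:R *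
     (if (u.2 < m - W)%N then ginv (rowfun y u.1) (size t).+1 (m - W - u.2.+1) else 0)).
  rewrite exprD factS natrM ltn_subRL -subnDA [(u.2.+1 + W)%N]addnC !addnS.
  by move: (if _ then _ else _) => a; ring.
by apply: cderZ; exact: cder_ginv.
Qed.

Lemma cder_rowL y (u : I) t q :
  cder y u (fun z => rowL (rowfun z u.1) t q) (rowL (rowfun y u.1) (u.2 :: t) q).
Proof. by apply: cder_sum => m _; exact/cderZ/cder_rowL_mon. Qed.

Lemma cder_rowL_neq y (u : I) r t q : u.1 != r ->
  cder y u (fun z => rowL (rowfun z r) t q) 0.
Proof.
move=> ur.
have dw l m : cder y u (fun z => (wpoly (rowfun z r) ^+ l)`_m) 0.
  have := pcderX l (cder_wpoly y u r) m; rewrite (negPf ur) mulr0 mul0rn coef0.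
  by [].
have dg k m : cder y u (fun z => ginv (rowfun z r) k m) 0.
  rewrite /ginv /ginvp; under eq_fun do rewrite coef_sum.
  apply: cder_sum0 => l _; under eq_fun do rewrite coefMn -mulr_natl.
  exact: cderZ0.
apply: cder_sum0 => m _; apply: cderZ0; rewrite /rowL_mon; case: t => [|v t].
  rewrite -[0]addr0; apply: cderD; first exact: cder_cst.
  by apply: cder_sum0 => l _; exact: cderZ0.
by apply: cderZ0; case: (wt _ <= m)%N; [exact: dg | exact: cder_cst].
Qed.

Lemma cder_blockL y (u : I) r t q :
  cder y u (fun z => blockL z r t q) (blockL y r (u :: t) q).
Proof.
rewrite /blockL /=; case: (all _ t); last by rewrite andbF; exact: cder_cst.
rewrite andbT; case: eqP => [<-|/eqP ur]; first exact: cder_rowL.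
exact: cder_rowL_neq.
Qed.

(** The splittings of [u :: t] are those of t with u given to either factor, which is the product
    rule; the recursion therefore commutes with differentiation. *)
Lemma cder_elimv y (u : I) bs t phi :
  cder y u (fun z => elimv z bs t phi) (elimv y bs (u :: t) phi).
Proof.
elim: bs t phi => [|b bs IH] t phi /=; first by rewrite mul0r; exact: cder_cst.
apply: cderD; last first.
  by apply: cderN; apply: cder_sum => a _; exact: IH.
rewrite big_cat !big_map/= -big_split/=; apply: cder_sum => s _.
rewrite addrC [X in _ + X]mulrC; apply: cderM; [exact: cder_blockL | exact: IH].
Qed.

Lemma cder_elimT y (u : I) bs t T :
  cder y u (fun z => elimT z bs t T) (elimT y bs (u :: t) T).
Proof. by apply: cder_sum => c _; exact/cderZ/cder_elimv. Qed.

End ElimDeriv.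

(** * Limits on the image of theta *)

Section Limits.
Variable R : realType.

Lemma line_is_derive (U : normedModType R) (f : U -> R) (x v : U) (d : R) :
  is_derive x v f d <-> is_derive (0 : R) (1 : R) (fun h => f (h *: v + x)) d.
Proof.
have E : (fun h : R => h^-1 *: ((f \o shift x) (h *: v) - f x)) =
   (fun h : R => h^-1 *: (((fun h => f (h *: v + x)) \o shift 0) (h *: (1 : R)) -
     f (0 *: v + x))).
  by apply/funext => h; rewrite /= [h *: 1]mulr1 addr0 scale0r add0r.
split=> -[fd fv]; split.
- by move: fd; rewrite /derivable E.
- by move: fv; rewrite /derive E.
- by rewrite /derivable E.
- by rewrite /derive E.
Qed.

Lemma line_is_derive_at (U : normedModType R) (f : U -> R) (x v : U) (h d : R) :
  is_derive (h *: v + x) v f d <-> is_derive (h : R) (1 : R) (fun h => f (h *: v + x)) d.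
Proof.
rewrite line_is_derive [X in _ <-> X]line_is_derive.
suff -> : (fun k => f (k *: v + (h *: v + x))) = (fun k : R => f ((k *: (1 : R) + h) *: v + x)) by [].
by apply/funext => k; rewrite [k *: 1]mulr1 scalerDl addrA.
Qed.

Lemma mvt_itv (f df : R -> R) (u v : R) : u <= v ->
  (forall x, u <= x <= v -> is_derive x 1 f (df x)) ->
  exists2 c, u <= c <= v & f v - f u = df c * (v - u).
Proof.
move=> uv gd; have [||c] := @MVT_segment R f df u v uv.
- by move=> x /=; rewrite in_itv/= => /andP[h1 h2]; apply: gd; rewrite !ltW.
- apply: derivable_within_continuous => x; rewrite in_itv/= => hx.
  by have [] := gd x hx.
- by rewrite in_itv/= => hc E; exists c.
Qed.

Lemma mvt_dist (f df : R -> R) (a h : R) :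
  (forall x, `|x - a| <= `|h| -> is_derive x 1 f (df x)) ->
  exists2 c, `|c - a| <= `|h| & f (a + h) - f a = df c * h.
Proof.
move=> fd; have W (u v : R) uv := @mvt_itv f df u v uv.
have [h0|h0] := leP 0 h.
  have [|x hx|c hc E] := W a (a + h); first by rewrite lerDl.
    by apply: fd; rewrite ger0_norm ?subr_ge0 ?lerBlDl ?(ger0_norm h0); case/andP: hx.
  exists c; last by rewrite E addrAC subrr add0r.
  by rewrite ger0_norm ?subr_ge0 ?lerBlDl ?(ger0_norm h0); case/andP: hc.
have [|x hx|c hc E] := W (a + h) a; first by rewrite gerDl ltW.
  apply: fd; rewrite distrC (ltr0_norm h0) ger0_norm ?subr_ge0 ?lerBlDl; case/andP: hx => //.
  by rewrite lerBrDr.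
exists c; last by rewrite -opprB E; ring.
rewrite distrC (ltr0_norm h0) ger0_norm ?subr_ge0 ?lerBlDl; case/andP: hc => //.
by rewrite lerBrDr.
Qed.

Lemma lim_is_derive (g g' : nat -> R -> R) (G G' : R -> R) (a d : R) : 0 < d ->
  (forall k h, `|h - a| <= d -> is_derive h 1 (g k) (g' k h)) ->
  (forall e, 0 < e -> exists K, forall k h, (K <= k)%N -> `|h - a| <= d -> `|g k h - G h| <= e) ->
  (forall e, 0 < e -> exists K, forall k h, (K <= k)%N -> `|h - a| <= d -> `|g' k h - G' h| <= e) ->
  {for a, continuous G'} -> is_derive a 1 G (G' a).
Proof.
move=> d0 gd gG gG' cG'.
suff H : h^-1 *: ((G \o shift a) (h *: (1 : R)) - G a) @[h --> 0^'] --> G' a.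
  by split; [exact: cvgP H | exact: cvg_lim H].
apply/cvgrPdist_le => e e0; have e4 : 0 < e / 4 by rewrite divr_gt0.
have /cvgrPdist_le/(_ _ e4) /nbhs_ballP[r r0 Hr] := cG'.
near=> h.
have h0 : h != 0 by near: h; exact: nbhs_dnbhs_neq.
have hd : `|h| <= d.
  by near: h; apply: dnbhs0_le.
have hr : `|h| < r.
  by near: h; apply: dnbhs0_lt.
have hp : 0 < `|h| by rewrite normr_gt0.
have eh : 0 < e / 4 * `|h| by rewrite mulr_gt0.
have [K1 HK1] := gG _ eh; have [K2 HK2] := gG' _ e4.
(* The index depends on h: the functions have to be within (e/4) |h| of their limit, since the
   increment is going to be divided by h. *)
pose k := maxn K1 K2.
have [c ca E] : exists2 c, `|c - a| <= `|h| & g k (a + h) - g k a = g' k c * h.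
  by apply: mvt_dist => x hx; apply: gd; rewrite (le_trans hx).
rewrite /= [h *: 1]mulr1 [h + a]addrC.
have G1 := HK1 k (a + h) (leq_maxl _ _); have G2 := HK1 k a (leq_maxl _ _).
have {}G1 : `|g k (a + h) - G (a + h)| <= e / 4 * `|h| by apply: G1; rewrite addrAC subrr add0r.
have {}G2 : `|g k a - G a| <= e / 4 * `|h| by apply: G2; rewrite subrr normr0 ltW.
have G3 : `|g' k c - G' c| <= e / 4 by apply: HK2; rewrite ?leq_maxr// (le_trans ca).
have G4 : `|G' a - G' c| <= e / 4.
  by apply: Hr; rewrite -ball_normE /ball_/= distrC (le_lt_trans ca).
rewrite [h^-1 *: _]mulrC -(ler_pM2r hp) -normrM mulrBl divfK//.
have -> : G' a * h - (G (a + h) - G a) = (G' a - G' c) * h - (g' k c - G' c) * h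
   + (g k (a + h) - G (a + h)) - (g k a - G a).
  by rewrite [(g' k c - _) * h]mulrBl -E; ring.
have G5 : `|(G' a - G' c) * h| <= e / 4 * `|h| by rewrite normrM ler_wpM2r.
have G6 : `|(g' k c - G' c) * h| <= e / 4 * `|h| by rewrite normrM ler_wpM2r.
move: G1 G2 G5 G6; rewrite !ler_norml => /andP[? ?] /andP[? ?] /andP[? ?] /andP[? ?].
have eE : e * `|h| = 4 * (e / 4 * `|h|) by field.
rewrite eE; apply/andP; split; lra.
Unshelve. all: by end_near.
Qed.

End Limits.

Section ThetaLimits.
Variables (R : realType) (p n : nat).
Notation V := 'M[R]_(p, n).
Notation I := ('I_p * 'I_n)%type.
Notation A := (range (@thetamap R p n)).

Lemma mx_coord_le (x : V) i j : `|x i j| <= `|x|.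
Proof.
rewrite [leRHS]/Num.Def.normr /= mx_normrE.
exact: (@le_bigmax _ _ _ 0 (fun ij : I => `|x ij.1 ij.2|) (i, j)).
Qed.

Lemma mx_norm_dir (u : I) : `|dir R u| <= 1.
Proof.
rewrite [leLHS]/Num.Def.normr /= mx_normrE; apply/bigmax_leP; split => // ij _.
by rewrite mxE; case: (_ && _); rewrite ?normr1 ?normr0.
Qed.

(** Cauchy's bound on the roots of a monic polynomial. It makes [thetamap] proper, so convergence on
    boxes in x becomes convergence on bounded parts of its image. *)
Lemma root_le (x : V) (B : R) : 0 <= B -> (forall i j, `|thetamap x i j| <= B) ->
  forall i j, `|x i j| <= 1 + n%:R * B.
Proof.
move=> B0 xB i j; set z := x i j.
have [z1|z1] := leP `|z| 1; first by rewrite (le_trans z1)// lerDl mulr_ge0.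
have z0 : 0 < `|z| by rewrite (lt_trans ltr01).
have n0 : (0 < n)%N by case: (n) j {z z1 z0} => // -[].
have zE : z ^+ n = \sum_(k < n) ((-1) ^+ k * thetamap x i k) * z ^+ (n - k.+1).
  have := congr1 (fun q : {poly R} => q.[z]) (prod_esym (x i)).
  rewrite /= horner_prod (bigD1 j)//= hornerXsubC subrr mul0r => /esym/eqP.
  rewrite hornerD hornerN hornerXn subr_eq0 => /eqP ->.
  rewrite horner_sum; apply: eq_bigr => k _.
  by rewrite hornerZ hornerXn mxE.
have : `|z| ^+ n <= n%:R * B * `|z| ^+ n.-1.
  rewrite -normrX zE (le_trans (ler_norm_sum _ _ _))// -mulrA mulr_natl.
  rewrite -[X in _ *+ X]card_ord -sumr_const; apply: ler_sum => k _.
  rewrite !normrM normr_sign mul1r normrX ler_pM// ler_weXn2l ?ltW//; lia.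
rewrite -[in leLHS](prednK n0) exprS ler_pM2r ?exprn_gt0// => h.
by rewrite (le_trans h)// lerDr.
Qed.

Variables (P : nat -> seq I -> V -> R) (L : seq I -> V -> R).
Hypothesis dP : forall k t y u, cder y u (P k t) (P k (u :: t) y).
Hypothesis cP : forall k t, continuous (P k t).
Hypothesis cvP : forall t (rad e : R), 0 < e -> exists K, forall k (x : V), (K <= k)%N ->
  (forall i j, `|x i j| <= rad) -> `|P k t (thetamap x) - L t (thetamap x)| <= e.

Lemma cvP_bounded t (r e : R) : 0 < e -> exists K, forall k y, (K <= k)%N ->
  A y -> `|y| <= r -> `|P k t y - L t y| <= e.
Proof.
move=> e0; have [K HK] := cvP t (1 + n%:R * r) e0.
exists K => k y Kk [x _ <-] xr; apply: HK => //; apply: root_le.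
  by rewrite (le_trans _ xr).
by move=> i j; rewrite (le_trans (mx_coord_le _ _ _)).
Qed.

Lemma L_within_continuous t : {within A, continuous (L t)}.
Proof.
apply/subspace_continuousP => y Ay; apply/cvgrPdist_le => e e0.
have e3 : 0 < e / 3 by rewrite divr_gt0.
have [K HK] := cvP_bounded t (`|y| + 1) e3.
have /cvgrPdist_le/(_ _ e3) Hc := @cP K t y.
rewrite near_withinE; near=> z => Az; change (`|L t y - L t z| <= e).
have z1 : `|z| <= `|y| + 1.
  have : `|y - z| <= 1.
    near: z; apply/nbhs_ballP; exists 1 => //= w.
    by rewrite -ball_normE /ball_/= => /ltW.
  rewrite distrC -lerBlDl; apply: le_trans; exact: lerB_dist.
have h1 : `|P K t y - P K t z| <= e / 3 by near: z.
have h2 := HK K y (leqnn _) Ay _; have h3 := HK K z (leqnn _) Az z1.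
have {}h2 : `|P K t y - L t y| <= e / 3 by rewrite h2// lerDl.
rewrite (_ : L t y - L t z = - (P K t y - L t y) + (P K t y - P K t z) + (P K t z - L t z)); last by ring.
have -> : e = e / 3 + e / 3 + e / 3 by field.
rewrite (le_trans (ler_normD _ _))// lerD// (le_trans (ler_normD _ _))// lerD//.
by rewrite normrN.
Unshelve. all: by end_near.
Qed.

Lemma L_interior_continuous t y : A° y -> {for y, continuous (L t)}.
Proof.
move=> Ay; have /subspace_continuousP/(_ y (interior_subset Ay)) := @L_within_continuous t.
by rewrite within_interior.
Qed.

Lemma L_is_derive t y u : A° y -> is_derive y (dir R u) (L t) (L (u :: t) y).
Proof.
move=> Ay; apply/line_is_derive.
(* Convergence is known on the image only; a short segment through an interior point stays inside
   it. *)
have [d d0 Hd] : exists2 d, 0 < d & forall h : R, `|h| <= d -> A (h *: dir R u + y).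
  have /nbhs_ballP[r r0 Hr] : nbhs y A by [].
  exists (r / 2) => [|h hr]; first by rewrite divr_gt0.
  apply: Hr; rewrite -ball_normE /ball_/= opprD addrCA subrr addr0 normrN normrZ.
  rewrite (le_lt_trans (ler_piMr _ (mx_norm_dir u)))// (le_lt_trans hr)//.
  by rewrite ltr_pdivrMr// ltr_pMr// ltr1n.
pose r := `|y| + d.
have hr h : `|h| <= d -> `|h *: dir R u + y| <= r.
  move=> hd; rewrite (le_trans (ler_normD _ _))// addrC lerD// normrZ.
  by rewrite (le_trans (ler_piMr _ (mx_norm_dir u))).
rewrite (_ : L (u :: t) y = L (u :: t) (0 *: dir R u + y)); last by rewrite scale0r add0r.
apply: (@lim_is_derive _ (fun k h => P k t (h *: dir R u + y))
  (fun k h => P k (u :: t) (h *: dir R u + y)) _ (fun h => L (u :: t) (h *: dir R u + y)) 0 d d0).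
- move=> k h _.
  exact: ((line_is_derive_at (P k t) y (dir R u) h _).1 (dP k t (h *: dir R u + y) u).2).
- move=> e e0; have [K HK] := cvP_bounded t r e0; exists K => k h Kk; rewrite subr0 => hd.
  by apply: HK => //; [exact: Hd | exact: hr].
- move=> e e0; have [K HK] := cvP_bounded (u :: t) r e0; exists K => k h Kk; rewrite subr0 => hd.
  by apply: HK => //; [exact: Hd | exact: hr].
apply: (@continuous_comp _ _ _ (fun h : R => h *: dir R u + y) (L (u :: t))).
  apply: (@continuousD _ _ _ (fun h : R => h *: dir R u) (fun=> y)); last exact: cst_continuous.
  exact: scalel_continuous.
rewrite /= scale0r add0r; exact: L_interior_continuous.
Qed.

Lemma pds_lim (F : V -> R) : (forall y, A y -> F y = L [::] y) ->
  forall s y, A° y -> pds s F y = L s y.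
Proof.
move=> FL; elim=> [|u s IH] y Ay; first by apply: FL; exact: interior_subset Ay.
rewrite /= /pd; have [_ <-] := L_is_derive s u Ay.
have h : nbhs y A° by apply: nbhs_interior.
by apply: near_eq_derive; near=> z; apply: IH; near: z.
Unshelve. all: by end_near.
Qed.

Lemma smooth_on_lim (F : V -> R) : (forall y, A y -> F y = L [::] y) ->
  smooth_on A° F.
Proof.
move=> FL s y Ay.
have near_pds : \forall z \near y, L s z = pds s F z.
  have h : nbhs y A° by apply: nbhs_interior.
  by near=> z; rewrite pds_lim//; near: z.
split=> [u|].
  have := L_is_derive s u Ay => -[+ _]; apply: near_eq_derivable.
  exact: near_pds.
have c : L s z @[z --> y] --> L s y := L_interior_continuous (t := s) Ay.
suff : pds s F z @[z --> y] --> pds s F y by [].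
by rewrite (pds_lim FL)//; apply: cvg_trans c; exact: near_eq_cvg near_pds.
Unshelve. all: by end_near.
Qed.

End ThetaLimits.

(** * Simultaneous approximation by Bernstein polynomials *)

Section Bernstein.
Variables (R : realType) (r : R).
Hypothesis r_gt0 : 0 < r.

(** The affine map sending [-r, r] onto [0, 1]. *)
Definition bmap : {poly R} := (2 * r)^-1 *: ('X + r%:P).

Definition bernstein_basis (N l : nat) : {poly R} := (bmap ^+ l * (1 - bmap) ^+ (N - l)) *+ 'C(N, l).

Definition bernstein N (c : nat -> R) : {poly R} := \sum_(l < N.+1) c l *: bernstein_basis N l.

Definition fdiff (c : nat -> R) (l : nat) : R := c l.+1 - c l.

Lemma deriv_bmap : bmap^`() = ((2 * r)^-1)%:P.
Proof. by rewrite /bmap derivZ derivD derivX derivC addr0 alg_polyC. Qed.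

Lemma deriv_bernstein_basis0 N : (bernstein_basis N.+1 0)^`() = - (((2 * r)^-1 * N.+1%:R) *: bernstein_basis N 0).
Proof.
rewrite /bernstein_basis !bin0 !mulr1n !expr0 !mul1r !subn0 deriv_exp derivB derivC sub0r deriv_bmap /=.
by rewrite mulNr mul_polyC mulNrn -scaler_nat scalerA mulrC.
Qed.

Lemma deriv_bernstein_basisS N l : (l <= N)%N -> (bernstein_basis N.+1 l.+1)^`() =
  ((2 * r)^-1 * N.+1%:R) *: (bernstein_basis N l - bernstein_basis N l.+1).
Proof.
move=> lN; rewrite /bernstein_basis derivMn derivM !deriv_exp derivB derivC sub0r deriv_bmap /= subSS.
have E1 : ('C(N.+1, l.+1) * l.+1 = N.+1 * 'C(N, l))%N by rewrite mulnC -mul_bin_diag.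
have E2 : ('C(N.+1, l.+1) * (N - l) = N.+1 * 'C(N, l.+1))%N.
  by rewrite mulnC mul_bin_down subSS mulnC.
have {}E1 : 'C(N.+1, l.+1)%:R * l.+1%:R = N.+1%:R * 'C(N, l)%:R :> {poly R}.
  by rewrite -!natrM E1.
have {}E2 : 'C(N.+1, l.+1)%:R * (N - l)%:R = N.+1%:R * 'C(N, l.+1)%:R :> {poly R}.
  by rewrite -!natrM E2.
set k := (2 * r)^-1; set u := bmap; set v := 1 - u.
rewrite -scalerA scalerBr -!mul_polyC rmorph_nat.
transitivity ((k%:P * u ^+ l * v ^+ (N - l)) * ('C(N.+1, l.+1)%:R * l.+1%:R) -
    (k%:P * u ^+ l.+1 * v ^+ (N - l.+1)) * ('C(N.+1, l.+1)%:R * (N - l)%:R)).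
  rewrite -(mulr_natr (_ + _) 'C(N.+1, l.+1)) -(mulr_natr (_ * _) l.+1) subnS.
  rewrite -(mulr_natr (_ * _) (N - l)); move: ('C(_, _)%:R) (l.+1%:R) ((N - l)%:R) => a b c.
  by ring.
rewrite E1 E2 -(mulr_natr (_ * _) 'C(N, l)) -(mulr_natr (_ * _) 'C(N, l.+1)).
by move: ('C(_, _)%:R) ('C(_, _)%:R) (N.+1%:R) => a b c; ring.
Qed.

Lemma deriv_bernstein N c : (bernstein N.+1 c)^`() =
  ((2 * r)^-1 * N.+1%:R) *: bernstein N (fdiff c).
Proof.
set k := _ * _; rewrite /bernstein [LHS]linear_sum/= big_ord_recl derivZ deriv_bernstein_basis0 -/k.
rewrite (eq_bigr (fun l : 'I_N.+1 => k *: (c l.+1 *: bernstein_basis N l) - k *: (c l.+1 *: bernstein_basis N l.+1))).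
  rewrite sumrB -!scaler_sumr.
  have -> : \sum_(l < N.+1) c l.+1 *: bernstein_basis N l.+1 =
      \sum_(l < N.+1) c l *: bernstein_basis N l - c 0%N *: bernstein_basis N 0.
    rewrite big_ord_recr/= [in RHS]big_ord_recl/= [bernstein_basis N N.+1]/bernstein_basis bin_small// mulr0n.
    by rewrite scaler0 addr0 addrAC subrr add0r.
  rewrite scalerN scalerA mulrC -scalerA -!scalerBr -scalerN -scalerDr; congr (_ *: _).
  rewrite opprB addrCA addrA; under [RHS]eq_bigr do rewrite /fdiff scalerBl.
  by rewrite sumrB; ring.
move=> l _; rewrite lift0 derivZ (deriv_bernstein_basisS (leq_ord l)) -/k.
by rewrite scalerBr scalerBr !scalerA ![c _ * k]mulrC.
Qed.

(** Differentiating a Bernstein polynomial replaces its coefficients by their differences, by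
    summation by parts; hence all derivatives are approximated at once. *)
Lemma tayl_bernstein m N c x : tayl m x (bernstein (N + m) c) *+ m`! =
  (2 * r)^-1 ^+ m * ((N + m) ^_ m)%:R * (bernstein N (iter m fdiff c)).[x].
Proof.
rewrite /tayl -hornerMn -nderivn_def.
elim: m N c => [|m IH] N c; first by rewrite addn0 expr0 ffactn0 !mul1r.
rewrite derivSn addnS deriv_bernstein derivnZ hornerZ IH iterSr ffactnS -pred_Sn natrM exprS.
rewrite -!mulrA; congr (_ * _); rewrite mulrCA; congr (_ * _); by rewrite mulrA.
Qed.

Definition bwt N a l : R := a ^+ l * (1 - a) ^+ (N - l) *+ 'C(N, l).

Lemma bwt_ge0 N a l : 0 <= a <= 1 -> 0 <= bwt N a l.
Proof. by move=> /andP[a0 a1]; rewrite mulrn_wge0// mulr_ge0// exprn_ge0// subr_ge0. Qed.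

Lemma horner_bernstein N c x : (bernstein N c).[x] = \sum_(l < N.+1) c l * bwt N ((x + r) / (2 * r)) l.
Proof.
rewrite horner_sum; apply: eq_bigr => l _; rewrite hornerZ /bernstein_basis hornerMn hornerM.
rewrite !horner_exp hornerD hornerN hornerC /bmap hornerZ hornerD hornerX hornerC.
by rewrite [_^-1 * _]mulrC.
Qed.

Lemma sum_bwt N a : \sum_(l < N.+1) bwt N a l = 1.
Proof.
rewrite -[RHS](expr1n _ N) -[in RHS](subrK a 1) exprDn.
by apply: eq_bigr => l _; rewrite /bwt mulrC.
Qed.

Lemma sum_bwtM N a (f : nat -> R) : \sum_(l < N.+2) l%:R * bwt N.+1 a l * f l =
  N.+1%:R * a * \sum_(l < N.+1) bwt N a l * f l.+1.
Proof.
rewrite big_ord_recl/= !mul0r add0r mulr_sumr; apply: eq_bigr => l _.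
have E1 : ('C(N.+1, l.+1) * l.+1 = N.+1 * 'C(N, l))%N by rewrite mulnC -mul_bin_diag.
have {}E1 : 'C(N.+1, l.+1)%:R * l.+1%:R = N.+1%:R * 'C(N, l)%:R :> R.
  by rewrite -!natrM E1.
rewrite /bwt /bump/= add1n subSS -(mulr_natr (_ * _) 'C(N.+1, l.+1)) -(mulr_natr (_ * _) 'C(N, l)).
transitivity (a ^+ l.+1 * (1 - a) ^+ (N - l) * ('C(N.+1, l.+1)%:R * l.+1%:R) * f l.+1).
  by move: ('C(_, _)%:R) (l.+1%:R) (_ ^+ l.+1) (_ ^+ (N - l)) => w x y z; ring.
by rewrite E1 exprS; move: ('C(_, _)%:R) (_ ^+ l) (_ ^+ (N - l)) => x y z; ring.
Qed.

Lemma bwt_variance N a : 0 <= a <= 1 ->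
  \sum_(l < N.+2) bwt N.+1 a l * (l%:R / N.+1%:R - a) ^+ 2 <= N.+1%:R^-1.
Proof.
move=> /andP[a0 a1]; set M : R := N.+1%:R; have M0 : 0 < M by rewrite ltr0n.
have S1 k : \sum_(l < k.+1) l%:R * bwt k a l = k%:R * a.
  case: k => [|k]; first by rewrite big_ord1 !mul0r.
  have := sum_bwtM k a (fun=> 1); under eq_bigr do rewrite mulr1.
  by move=> ->; under eq_bigr do rewrite mulr1; rewrite sum_bwt mulr1.
have S2 : \sum_(l < N.+2) l%:R * bwt N.+1 a l * l%:R = M * a * (N%:R * a + 1).
  rewrite (sum_bwtM N a (fun l => l%:R)); congr (_ * _).
  under eq_bigr do rewrite -[_.+1%:R]natr1 mulrDr mulr1 mulrC.
  by rewrite big_split/= sum_bwt S1.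
have -> : \sum_(l < N.+2) bwt N.+1 a l * (l%:R / M - a) ^+ 2 =
   M^-2 * (\sum_(l < N.+2) l%:R * bwt N.+1 a l * l%:R)
   - 2 * a / M * (\sum_(l < N.+2) l%:R * bwt N.+1 a l) + a ^+ 2 * \sum_(l < N.+2) bwt N.+1 a l.
  rewrite !mulr_sumr -sumrB -big_split/=; apply: eq_bigr => l _.
  by move: (bwt _ _ _) (l%:R) => x y; field; rewrite gt_eqF.
rewrite S2 S1 sum_bwt mulr1.
have -> : N%:R = M - 1 :> R by rewrite /M -natr1 addrK.
have -> : M^-2 * (M * a * ((M - 1) * a + 1)) - 2 * a / M * (N.+1%:R * a) + a ^+ 2 =
   M^-1 * (a * (1 - a)) by rewrite -/M; field; rewrite gt_eqF.
rewrite ler_piMr ?invr_ge0 ?(ltW M0)// mulr_ile1 ?subr_ge0//.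
by rewrite lerBlDr lerDl.
Qed.

Definition bernstein_node N (l : nat) : R := - r + 2 * r / N%:R * l%:R.

(** The mean value theorem for m-th differences of samples at step h. *)
Lemma fdiff_mvt (g : nat -> R -> R) (s h : R) m l : 0 <= h ->
  (forall j (x : R), is_derive x (1 : R) (g j) (g j.+1 x)) ->
  exists2 xi, s + h * l%:R <= xi <= s + h * (l + m)%:R &
    iter m fdiff (fun l => g 0%N (s + h * l%:R)) l = h ^+ m * g m xi.
Proof.
move=> h0; elim: m g => [|m IH] g dg.
  by exists (s + h * l%:R); rewrite ?addn0 ?lexx// expr0 mul1r.
(* The induction is applied to the increment of g, so that one mean value theorem finishes each
   step. *)
pose G j x := g j (x + h) - g j x.
have dG j (x : R) : is_derive x (1 : R) (G j) (G j.+1 x).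
  apply: is_deriveB.
  have := @is_derive1_comp _ (g j) (fun z => z + h) x (g j.+1 (x + h)) 1 (dg j (x + h)).
  rewrite mulr1; apply; rewrite -[X in is_derive _ _ _ X]addr0.
  exact: is_deriveD.
have [xi /andP[x1 x2] E] := IH G dG.
have [|c /andP[c1 c2] Ec] := @mvt_itv _ (g m) (g m.+1) xi (xi + h) _ (fun x _ => dg m x).
  by rewrite lerDl.
exists c.
  rewrite (le_trans x1 c1) (le_trans c2)//= addnS -natr1 mulrDr mulr1 addrA.
  by rewrite lerD2r.
rewrite iterSr (_ : fdiff _ = fun l => G 0%N (s + h * l%:R)).
  by rewrite E /G Ec addrAC subrr add0r exprSr mulrA mulrAC.
by apply/funext => k; rewrite /fdiff /G -natr1 mulrDr mulr1 addrA.
Qed.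

Lemma ffact_lower N m : (m <= N)%N -> (0 < N)%N ->
  (1 - m%:R ^+ 2 / N%:R : R) <= ((N ^_ m)%:R / N%:R ^+ m : R) <= 1.
Proof.
move=> + N0; have N0' : 0 < N%:R :> R by rewrite ltr0n.
elim: m => [|m IH] mN; first by rewrite ffactn0 expr0 expr0n/= mul0r subr0 divr1 lexx.
have /andP[h1 h2] := IH (ltnW mN).
have -> : (N ^_ m.+1)%:R / N%:R ^+ m.+1 = (N ^_ m)%:R / N%:R ^+ m * (1 - m%:R / N%:R) :> R.
  rewrite ffactnSr natrM natrB ?(ltnW mN)// exprSr.
  by field; rewrite ?expf_neq0 ?gt_eqF.
set k := (N ^_ m)%:R / _ in h1 h2 *.
have k0 : 0 <= k by rewrite divr_ge0 ?exprn_ge0.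
have q0 : 0 <= m%:R / N%:R :> R by rewrite divr_ge0.
have q1 : m%:R / N%:R <= 1 :> R by rewrite ler_pdivrMr// mul1r ler_nat ltnW.
apply/andP; split; last by rewrite mulr_ile1// ?subr_ge0// lerBlDr lerDl.
have : k - m%:R / N%:R <= k * (1 - m%:R / N%:R).
  by rewrite mulrBr mulr1 lerD2l lerN2 ler_piMl.
apply: le_trans; rewrite (le_trans _ (lerB h1 (lexx _)))//.
rewrite -natr1 -addrA lerD2l -opprD lerN2 -mulrDl ler_pM2r ?invr_gt0//.
rewrite sqrrD1 -addrA lerD2l mulr2n -addrA lerDl.
by rewrite addr_ge0.
Qed.

(** Bounds the mean absolute deviation by the variance without square roots; d is optimised
    later. *)
Lemma norm_le_amgm (q d : R) : 0 < d -> `|q| <= d + d^-1 * q ^+ 2.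
Proof.
move=> d0; rewrite -(ler_pM2l d0) mulrDr mulrA divff ?gt_eqF// mul1r.
rewrite -real_normK ?num_real//; move: `|q| (normr_ge0 q) => z z0.
by have := sqr_ge0 (z - d); have := mulr_ge0 (ltW d0) z0; nra.
Qed.

(** The error has three sources: m^2/M from the falling factorial replacing M^m, m/M from the
    position of the mean value point among m steps, and d + 1/((N+1) d) from the variance of the
    binomial weights. The bound on [g m.+1] serves as a Lipschitz constant. *)
Lemma bernstein_error (g : nat -> R -> R) (L : R) N m (d x : R) :
  (forall j (x : R), is_derive x (1 : R) (g j) (g j.+1 x)) ->
  (forall z, `|z| <= r -> `|g m z| <= L) -> (forall z, `|z| <= r -> `|g m.+1 z| <= L) ->
  `|x| <= r -> 0 < d ->
  `|tayl m x (bernstein (N.+1 + m) (fun l => g 0%N (bernstein_node (N.+1 + m) l))) *+ m`! - g m x| <=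
  L * (m%:R ^+ 2 / (N.+1 + m)%:R + 2 * r * (m%:R / (N.+1 + m)%:R + d + (N.+1%:R * d)^-1)).
Proof.
move=> dg gL gL' xr d0; set M := (N.+1 + m)%N; set h := 2 * r / M%:R.
have M0 : 0 < M%:R :> R by rewrite ltr0n.
have N0 : 0 < N.+1%:R :> R by rewrite ltr0n.
have r0 := r_gt0; have r20 : 0 < 2 * r by rewrite mulr_gt0.
have h0 : 0 <= h by rewrite divr_ge0 ?ltW.
have L0 : 0 <= L by rewrite (le_trans _ (gL x xr)).
set a := (x + r) / (2 * r).
have a01 : 0 <= a <= 1.
  move: xr; rewrite ler_norml => /andP[x1 x2].
  rewrite divr_ge0 ?(ltW r20)//=; last by rewrite -lerBlDr sub0r.
  by rewrite ler_pdivrMr// mul1r mulr_natl mulr2n lerD2r.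
pose xi l := sval (cid2 (fdiff_mvt (- r) m l h0 dg)).
have xiP l : - r + h * l%:R <= xi l <= - r + h * (l + m)%:R /\
    iter m fdiff (fun l => g 0%N (bernstein_node M l)) l = h ^+ m * g m (xi l).
  by rewrite /xi; case: cid2.
have xir l : (l <= N.+1)%N -> `|xi l| <= r.
  move=> lN; have [/andP[x1 x2] _] := xiP l.
  rewrite ler_norml; apply/andP; split.
    by rewrite (le_trans _ x1)// lerDl mulr_ge0.
  rewrite (le_trans x2)// addrC lerBlDr (@le_trans _ _ (h * M%:R))//.
    by rewrite ler_wpM2l// ler_nat leq_add2r.
  by rewrite /h divfK ?gt_eqF// mulr_natl mulr2n.
rewrite tayl_bernstein horner_bernstein -/a.
set k := (M ^_ m)%:R / M%:R ^+ m : R.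
have -> : (2 * r)^-1 ^+ m * (M ^_ m)%:R *
    (\sum_(l < N.+2) iter m fdiff (fun l0 : nat => g 0%N (bernstein_node M l0)) l * bwt N.+1 a l) =
    k * \sum_(l < N.+2) bwt N.+1 a l * g m (xi l).
  rewrite !mulr_sumr; apply: eq_bigr => l _; have [_ ->] := xiP l.
  rewrite /k /h expr_div_n exprVn; move: (bwt _ _ _) => b.
  by field; rewrite !expf_neq0 ?gt_eqF.
have /andP[k1 k2] : 1 - m%:R ^+ 2 / M%:R <= k <= 1 by apply: ffact_lower; rewrite ?leq_addl.
have kd : `|k - 1| <= m%:R ^+ 2 / M%:R by rewrite distrC ger0_norm ?subr_ge0// lerBlDr -lerBlDl.
set S := \sum_(l < N.+2) _.
have -> : k * S - g m x = (k - 1) * S + \sum_(l < N.+2) bwt N.+1 a l * (g m (xi l) - g m x).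
  have -> : \sum_(l < N.+2) bwt N.+1 a l * (g m (xi l) - g m x) = S - g m x.
    under eq_bigr do rewrite mulrBr.
    by rewrite sumrB -mulr_suml sum_bwt mul1r.
  by ring.
have b0 l : 0 <= bwt N.+1 a l := bwt_ge0 N.+1 l a01.
have SL : `|S| <= L.
  rewrite (le_trans (ler_norm_sum _ _ _))// -[leRHS]mul1r -(sum_bwt N.+1 a) mulr_suml.
  apply: ler_sum => l _; rewrite normrM (ger0_norm (b0 _)) ler_wpM2l// gL//.
  by rewrite xir// -ltnS ltn_ord.
rewrite mulrDr (le_trans (ler_normD _ _))// lerD//.
  by rewrite normrM mulrC ler_pM.
apply: (@le_trans _ _ (\sum_(l < N.+2) L * (2 * r * (m%:R / M%:R * bwt N.+1 a l + d * bwt N.+1 a l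
    + d^-1 * (bwt N.+1 a l * (l%:R / N.+1%:R - a) ^+ 2))))); last first.
  rewrite -!mulr_sumr !big_split/= -!mulr_sumr sum_bwt !mulr1.
  rewrite !ler_wpM2l ?(ltW r20)// lerD2l invfM mulrC ler_wpM2r ?invr_ge0 ?(ltW d0)//.
  exact: bwt_variance.
rewrite (le_trans (ler_norm_sum _ _ _))//; apply: ler_sum => l _.
have lN : (l <= N.+1)%N by rewrite -ltnS ltn_ord.
rewrite normrM (ger0_norm (b0 _)).
have lip : `|g m (xi l) - g m x| <= L * `|xi l - x|.
  have W u v : u <= v -> `|u| <= r -> `|v| <= r -> `|g m v - g m u| <= L * `|v - u|.
    move=> uv ur vr; have [c /andP[c1 c2] ->] := mvt_itv uv (fun x _ => dg m x).
    rewrite normrM ler_wpM2r// gL'//; move: ur vr; rewrite !ler_norml.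
    by move=> /andP[u1 u2] /andP[v1 v2]; rewrite (le_trans u1)//= (le_trans c2).
  have [le|le] := leP x (xi l); first by apply: W => //; exact: xir.
  by rewrite distrC [in leRHS]distrC; apply: W => //; [exact: ltW|exact: xir].
(* The mean of the weights is read on the grid l/(N+1), while [xi l] lives on the finer grid of mesh
   2r/M; [w] and [xi l] share a window of m steps. *)
have dist : `|xi l - x| <= 2 * r * (m%:R / M%:R + `|l%:R / N.+1%:R - a|).
  have [/andP[x1 x2] _] := xiP l.
  pose w := - r + 2 * r * (l%:R / N.+1%:R).
  have -> : xi l - x = (xi l - w) + 2 * r * (l%:R / N.+1%:R - a).
    by rewrite /w /a; field; rewrite !gt_eqF.
  rewrite (le_trans (ler_normD _ _))// [leRHS]mulrDr; apply: lerD; last first.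
    by rewrite normrM (gtr0_norm r20).
  have -> : 2 * r * (m%:R / M%:R) = h * m%:R by rewrite /h; field; rewrite gt_eqF.
  have w1 : - r + h * l%:R <= w.
    rewrite /w lerD2l /h -mulrA ler_pM2l// mulrC ler_wpM2l// lef_pV2 ?posrE//.
    by rewrite ler_nat leq_addr.
  have w2 : w <= - r + h * (l + m)%:R.
    have q : l%:R / N.+1%:R <= (l + m)%:R / M%:R :> R.
      by rewrite ler_pdivrMr// mulrAC ler_pdivlMr// -!natrM ler_nat /M mulnDr mulnDl
         leq_add2l mulnC leq_mul2l lN orbT.
    by rewrite /w /h lerD2l -[leRHS]mulrA [_^-1 * _]mulrC ler_pM2l.
  move: x1 x2 w1 w2; rewrite natrD mulrDr => x1 x2 w1 w2.
  by rewrite ler_norml; apply/andP; split; clear -x1 x2 w1 w2; lra.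
have amgm := norm_le_amgm (l%:R / N.+1%:R - a) d0.
apply: (@le_trans _ _ (bwt N.+1 a l * (L * (2 * r * (m%:R / M%:R + (d + d^-1 * (l%:R / N.+1%:R - a) ^+ 2)))))).
  rewrite ler_wpM2l// (le_trans lip)// ler_wpM2l// (le_trans dist)//.
  by rewrite ler_wpM2l ?(ltW r20)// lerD2l.
by rewrite le_eqVlt; apply/orP; left; apply/eqP; ring.
Qed.

Lemma bernstein_approx K (e : R) : 0 < e -> exists N, forall (g : nat -> R -> R) (L : R) m,
  (forall j (x : R), is_derive x (1 : R) (g j) (g j.+1 x)) -> (m <= K)%N ->
  (forall z, `|z| <= r -> `|g m z| <= L) -> (forall z, `|z| <= r -> `|g m.+1 z| <= L) ->
  forall x, `|x| <= r ->
  `|tayl m x (bernstein N (fun l => g 0%N (bernstein_node N l))) *+ m`! - g m x| <= L * e.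
Proof.
move=> e0; have r0 := r_gt0.
set c := K%:R ^+ 2 + 2 * r * (K%:R + 2).
have c0 : 0 <= c by rewrite addr_ge0 ?exprn_ge0// !mulr_ge0 ?addr_ge0 ?(ltW r0).
(* With d = 1/q and degree q^2 + K every error term is at most a constant over q; [c] collects these
   constants. *)
pose q := (Num.bound (c / e)).+1; pose N := (q * q + K)%N.
have q0 : 0 < q%:R :> R by rewrite ltr0n.
have q1 : 1 <= q%:R :> R by rewrite ler1n.
exists N => g L m dg mK gL gL' x xr.
have L0 : 0 <= L by rewrite (le_trans _ (gL x xr)).
have NE : N = ((N - m).-1.+1 + m)%N by rewrite /N /q; lia.
have := @bernstein_error g L (N - m).-1 m q%:R^-1 x dg gL gL' xr.
rewrite -NE invr_gt0 => /(_ q0) /le_trans; apply; apply: ler_wpM2l => //.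
have Nm : (q * q)%:R <= (N - m).-1.+1%:R :> R by rewrite ler_nat /N /q; lia.
have qN : (q * q)%:R <= N%:R :> R by rewrite ler_nat /N leq_addr.
have qN' : q%:R <= N%:R :> R by rewrite (le_trans _ qN)// ler_nat leq_pmulr.
have N0 : 0 < N%:R :> R := lt_le_trans q0 qN'.
have N0' : 0 < (N - m).-1.+1%:R :> R by rewrite ltr0n.
have mK' : m%:R <= K%:R :> R by rewrite ler_nat.
have h1 : m%:R ^+ 2 / N%:R <= K%:R ^+ 2 / q%:R :> R.
  by rewrite ler_pM ?invr_ge0 ?(ltW N0) ?exprn_ge0 ?lef_pV2 ?posrE// lerXn2r ?nnegrE.
have h2 : m%:R / N%:R <= K%:R / q%:R :> R.
  by rewrite ler_pM ?invr_ge0 ?(ltW N0) ?lef_pV2 ?posrE.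
have h3 : ((N - m).-1.+1%:R * q%:R^-1)^-1 <= q%:R^-1 :> R.
  rewrite lef_pV2 ?posrE ?divr_gt0// ler_pdivlMr// -natrM.
  by [].
have qe : c / q%:R <= e.
  rewrite ler_pdivrMr// mulrC -ler_pdivrMr// ltW// (lt_le_trans (archi_boundP _))//.
    by rewrite divr_ge0 ?(ltW e0).
  by rewrite ler_nat.
apply: le_trans qe; rewrite /c [leRHS]mulrDl; apply: lerD => //; rewrite -[leRHS]mulrA ler_wpM2l ?mulr_ge0 ?(ltW r0)//.
by rewrite [leRHS]mulrDl [2 * _]mulr_natl mulr2n addrA !lerD.
Qed.

End Bernstein.

(** * Approximation of smooth functions by tensors *)

Section SmoothFunctions.
Variables (R : realType) (p n : nat).
Notation V := 'M[R]_(p, n).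
Notation I := ('I_p * 'I_n)%type.
Implicit Types (f : V -> R) (s : seq I).

Lemma box_compact (r : R) : compact [set z : V | forall i j, `|z i j| <= r].
Proof.
pose K := [set v : 'rV[R]_(p * n) | forall k, `[- r, r]%classic (v ord0 k)].
have cK : compact K.
  apply: (@rV_compact _ _ (fun=> `[- r, r]%classic)) => k.
  exact: segment_compact.
have cv : continuous (vec_mx : 'rV[R]_(p * n) -> V).
  move=> v; apply/(@cvgrPdist_le R V 'rV[R]_(p * n) (nbhs v) _) => e e0; near=> w.
  have vw : `|v - w| <= e.
    near: w; apply/nbhs_ballP; exists e => //= w.
    by rewrite -ball_normE /ball_/= => /ltW.
  rewrite -linearB/= [leLHS]/Num.Def.normr /= mx_normrE; apply/bigmax_leP.
  split=> [|ij _]; first exact: ltW.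
  rewrite mxE; apply: le_trans vw; exact: mx_coord_le.
have -> : [set z : V | forall i j, `|z i j| <= r] = vec_mx @` K.
  apply/seteqP; split => [z zr|_ [v Kv <-] i j /=]; last first.
    by rewrite mxE; have := Kv (mxvec_index i j); rewrite /= in_itv/= -ler_norml.
  exists (mxvec z); last by rewrite /= mxvecK.
  move=> k /=; rewrite in_itv/= -ler_norml.
  by case/mxvec_indexP: k => i j; rewrite mxvecE.
by apply: continuous_compact => //; exact: continuous_subspaceT.
Unshelve. all: by end_near.
Qed.

Lemma continuous_box_bounded f (r : R) : continuous f ->
  exists2 L : R, 0 <= L & forall z : V, (forall i j, `|z i j| <= r) -> `|f z| <= L.
Proof.
move=> cf; have cfK := continuous_compact (continuous_subspaceT cf) (box_compact (r := r)).
have [B [_ HB]] := compact_bounded cfK.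
exists (`|B| + 1) => [|z zr]; first by rewrite addr_ge0.
apply: (HB (`|B| + 1)); first by rewrite (le_lt_trans (ler_norm B))// ltrDl.
by exists z.
Qed.

Definition smooth f := smooth_on setT f.

Lemma pds_cat s1 s2 f : pds (s1 ++ s2) f = pds s1 (pds s2 f).
Proof. exact: foldr_cat. Qed.

Lemma smooth_pds s f : smooth f -> smooth (pds s f).
Proof. by move=> fs s' x _; have := fs (s' ++ s) x Logic.I; rewrite pds_cat. Qed.

Lemma smooth_continuous f : smooth f -> continuous f.
Proof. by move=> fs x; have [] := fs [::] x Logic.I. Qed.

Lemma smooth_is_derive f x u : smooth f -> is_derive x (dir R u) f (pd u f x).
Proof. by move=> fs; have [+ _] := fs [::] x Logic.I => /(_ u) h; split. Qed.

Lemma smooth_line f z u (h : R) : smooth f ->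
  is_derive h (1 : R) (fun h => f (h *: dir R u + z)) (pd u f (h *: dir R u + z)).
Proof.
move=> fs; exact: ((line_is_derive_at f z (dir R u) h _).1 (smooth_is_derive _ _ fs)).
Qed.

(** The left side is symmetric in a and b; reading it in both orders is Schwarz's theorem
    [pd_comm]. *)
Lemma second_difference f a b (x : V) (h : R) : smooth f ->
  exists s1 s2 : R, [/\ `|s1| <= `|h|, `|s2| <= `|h| &
  f (h *: dir R a + h *: dir R b + x) - f (h *: dir R a + x) - f (h *: dir R b + x) + f x =
  h * h * pd b (pd a f) (s2 *: dir R b + (s1 *: dir R a + x))].
Proof.
move=> fs.
pose g (s : R) := f (s *: dir R a + (h *: dir R b + x)) - f (s *: dir R a + x).
pose g' (s : R) := pd a f (s *: dir R a + (h *: dir R b + x)) - pd a f (s *: dir R a + x).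
have dg (s : R) : is_derive s (1 : R) g (g' s) by apply: is_deriveB; exact: smooth_line.
have [s1] := mvt_dist (a := 0) (h := h) (fun (s : R) _ => dg s).
rewrite subr0 add0r => s1h E1.
pose k (s : R) := pd a f (s *: dir R b + (s1 *: dir R a + x)).
have fs' : smooth (pd a f) := smooth_pds [:: a] fs.
have [s2] := mvt_dist (a := 0) (h := h)
  (fun (s : R) _ => smooth_line (s1 *: dir R a + x) b s fs').
rewrite subr0 add0r => s2h E2.
exists s1, s2; split => //.
rewrite -mulrA [h * pd _ _ _]mulrC -E2 scale0r add0r.
transitivity (h * g' s1); last by rewrite /g' [s1 *: _ + (h *: _ + _)]addrCA.
rewrite mulrC -E1 /g scale0r !add0r addrA; ring.
Qed.

Lemma dist_le_half (A B Y e : R) : `|A - Y| <= e / 2 -> `|B - Y| <= e / 2 -> `|A - B| <= e.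
Proof.
move=> h1 h2; have -> : A - B = (A - Y) - (B - Y) by ring.
by apply: (le_trans (ler_normB _ _)); rewrite [e]splitr lerD.
Qed.

Lemma pd_comm f a b : smooth f -> pd a (pd b f) = pd b (pd a f).
Proof.
move=> fs; apply/funext => x; apply/eqP; rewrite -subr_eq0 -normr_eq0 eq_le normr_ge0 andbT.
apply/ler_addgt0Pl => e e0; rewrite addr0.
have e2 : 0 < e / 2 by rewrite divr_gt0.
have W c d : exists2 r, 0 < r & forall y, `|y - x| <= r ->
    `|pd c (pd d f) x - pd c (pd d f) y| <= e / 2.
  have := smooth_continuous (smooth_pds [:: c; d] fs) (x := x).
  move=> /cvgrPdist_le/(_ _ e2)/nbhs_ballP[r r0 Hr].
  exists (r / 2) => [|y yx]; first by rewrite divr_gt0.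
  apply: Hr; rewrite -ball_normE /ball_/= distrC (le_lt_trans yx)//.
  by rewrite ltr_pdivrMr// ltr_pMr// ltr1n.
have [r1 r10 H1] := W a b; have [r2 r20 H2] := W b a.
(* Halved, because the intermediate points are two steps of length at most h away from x. *)
pose h := Num.min r1 r2 / 2.
have h0 : 0 < h by rewrite divr_gt0// lt_min r10.
have hE : h + h = Num.min r1 r2 by rewrite /h; field.
move: (h) h0 hE => {}h h0 hE.
have near_x c d (s1 s2 : R) : `|s1| <= `|h| -> `|s2| <= `|h| ->
    `|s2 *: dir R c + (s1 *: dir R d + x) - x| <= Num.min r1 r2.
  move=> s1h s2h; rewrite addrA addrK (le_trans (ler_normD _ _))// -hE !normrZ.
  rewrite -[in leRHS](gtr0_norm h0).
  by rewrite lerD// (le_trans (ler_piMr _ (mx_norm_dir _ _))).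
have [s1 [s2 [s1h s2h E1]]] := second_difference b a x h fs.
have [t1 [t2 [t1h t2h E2]]] := second_difference a b x h fs.
have E : pd a (pd b f) (s2 *: dir R a + (s1 *: dir R b + x)) =
         pd b (pd a f) (t2 *: dir R b + (t1 *: dir R a + x)).
  have hh : h * h != 0 by rewrite mulf_neq0 ?gt_eqF.
  apply: (mulfI hh); apply: (etrans (esym E1)); apply: (etrans _ E2).
  rewrite [h *: dir R b + h *: dir R a]addrC.
  by congr (_ + _); rewrite addrAC.
have /H1 G1 : `|s2 *: dir R a + (s1 *: dir R b + x) - x| <= r1.
  by apply: (le_trans (near_x a b s1 s2 s1h s2h)); rewrite ge_min lexx.
have /H2 G2 : `|t2 *: dir R b + (t1 *: dir R a + x) - x| <= r2.
  by apply: (le_trans (near_x b a t1 t2 t1h t2h)); rewrite ge_min lexx orbT.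
rewrite -E in G2; exact: (dist_le_half G1 G2).
Qed.

Lemma pds_swap s1 a s2 f : smooth f -> pds (s1 ++ a :: s2) f = pds (a :: s1 ++ s2) f.
Proof.
move=> fs; elim: s1 => [//|b s1 IH] /=.
by rewrite IH /= pd_comm//; exact: smooth_pds.
Qed.

Lemma pds_perm s1 s2 f : smooth f -> perm_eq s1 s2 -> pds s1 f = pds s2 f.
Proof.
move=> fs; elim: s1 s2 => [|a s1 IH] s2 sp.
  by move: sp; rewrite perm_sym => /perm_nilP ->.
have : a \in s2 by rewrite -(perm_mem sp) mem_head.
move=> as2; case: (path.splitPr as2) sp => s21 s22 sp.
rewrite pds_swap//= (IH (s21 ++ s22))//.
by rewrite -(perm_cons a) (perm_trans sp)// -cat1s perm_catCA.
Qed.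

Lemma pds_box_bounded f (r : R) K : smooth f ->
  exists2 L : R, 0 <= L & forall s (z : V), (size s <= K)%N -> (forall i j, `|z i j| <= r) ->
  `|pds s f z| <= L.
Proof.
elim: K f => [|K IH] f fs; have [L L0 HL] := continuous_box_bounded r (smooth_continuous fs).
  by exists L => // -[|//] z _; exact: HL.
have /choice[B HB] : forall u : I, exists B : R, 0 <= B /\ forall s (z : V), (size s <= K)%N ->
    (forall i j, `|z i j| <= r) -> `|pds s (pd u f) z| <= B.
  by move=> u; have [B B0 HB] := IH _ (smooth_pds [:: u] fs); exists B.
exists (L + \sum_u B u).
  by rewrite addr_ge0// sumr_ge0// => u _; have [] := HB u.
move=> s z; case/lastP: s => [_ zr|s u].
  by rewrite (le_trans (HL z zr))// lerDl sumr_ge0// => u _; have [] := HB u.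
rewrite size_rcons ltnS -cats1 pds_cat => sK zr.
have [_ /(_ s z sK zr) h] := HB u.
apply: (le_trans h); rewrite (bigD1 u)//= addrCA lerDl addr_ge0// sumr_ge0// => v _.
by have [] := HB v.
Qed.

End SmoothFunctions.

Section TensorApproximation.
Variables (R : realType) (p n : nat).
Notation V := 'M[R]_(p, n).
Notation I := ('I_p * 'I_n)%type.
Notation tensor := (seq (R * (I -> {poly R}))).
Implicit Types (f : V -> R) (s : seq I) (beta : I -> nat) (u : I -> R).

(** Overwrites one coordinate, in a form in which a function of the new value c is literally a
    restriction to a line, as in [smooth_line]. *)
Definition updm (z : V) (i : I) (c : R) : V :=
  c *: dir R i + (z - z i.1 i.2 *: dir R i).

Lemma updmE z i c a b : updm z i c a b = if (a, b) == i then c else z a b.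
Proof.
rewrite /updm !mxE; case: i => j k /=; rewrite xpair_eqE.
by case: eqP => [->|_]; case: eqP => [->|_] /=; rewrite ?mulr1 ?mulr0 ?subr0 ?add0r// subrr addr0.
Qed.

Lemma updm_line_neq z i c k (t : R) : k != i ->
  updm (t *: dir R k + z) i c = t *: dir R k + updm z i c.
Proof.
move=> ki; apply/matrixP => a b; rewrite updmE [RHS]mxE updmE !mxE.
case: eqP => // abi; case: k ki => k1 k2 /=; rewrite -abi xpair_eqE ![_ == k1]eq_sym ![_ == k2]eq_sym.
by move=> /negPf ->; rewrite mulr0 add0r.
Qed.

Lemma updm_line_eq z i c (t : R) : updm (t *: dir R i + z) i c = updm z i c.
Proof.
apply/matrixP => a b; rewrite !updmE !mxE; case: eqP => // /eqP abi.
case: i abi => i1 i2 /=; rewrite xpair_eqE => /negPf ->.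
by rewrite mulr0 add0r.
Qed.

Lemma updm_continuous i c : continuous (fun z : V => updm z i c).
Proof.
move=> z; apply: (@continuousD _ _ _ (fun=> c *: dir R i) (fun z : V => z - z i.1 i.2 *: dir R i)).
  exact: cst_continuous.
apply: (@continuousB _ _ _ (fun z : V => z) (fun z : V => z i.1 i.2 *: dir R i)).
  exact: cvg_id.
apply: (@continuous_comp _ _ _ (fun z : V => z i.1 i.2) (fun t : R => t *: dir R i)).
  exact: coord_continuous.
exact: scalel_continuous.
Qed.

Lemma is_derive_updm f i c k z : smooth f ->
  is_derive z (dir R k) (fun z => f (updm z i c)) (if k == i then 0 else pd k f (updm z i c)).
Proof.
move=> fs; apply/line_is_derive; case: eqP => [->|/eqP ki].
  under eq_fun do rewrite updm_line_eq; exact: is_derive_cst.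
under eq_fun do rewrite updm_line_neq//.
exact: ((line_is_derive f (updm z i c) (dir R k) _).1 (smooth_is_derive _ _ fs)).
Qed.

Lemma pds_updm f i c s : smooth f ->
  pds s (fun z => f (updm z i c)) = (fun z => if i \in s then 0 else pds s f (updm z i c)).
Proof.
move=> fs; elim: s => [//|k s IH] /=; rewrite IH; apply/funext => z.
rewrite /pd inE; case: (i \in s); last first.
  have [_ ->] := is_derive_updm i c k z (smooth_pds s fs).
  by rewrite eq_sym orbF; case: eqP.
by rewrite orbT derive_cst.
Qed.

Lemma smooth_updm f i c : smooth f -> smooth (fun z => f (updm z i c)).
Proof.
move=> fs s z _; rewrite pds_updm//; case: (i \in s).
  by split => [k|]; [exact: derivable_cst | exact: cst_continuous].
split => [k|]; first by have [] := is_derive_updm i c k z (smooth_pds s fs).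
apply: (@continuous_comp _ _ _ (fun z : V => updm z i c) (pds s f)).
  exact: updm_continuous.
exact/smooth_continuous/smooth_pds.
Qed.

Definition mxf u : V := \matrix_(a, b) u (a, b).

(** The word spelled by a multi-index, in the order of [pdm]: the ultradifferentiable classes use
    multi-indices, while the elimination adds one letter per derivative. *)
Definition dlist beta : seq I := flatten [seq nseq (beta i) i | i <- index_enum I].

Lemma count_dlist beta i : count_mem i (dlist beta) = beta i.
Proof.
rewrite /dlist count_flatten -map_comp sumnE big_map (bigD1_seq i)//=.
- rewrite count_nseq /= eqxx mul1n big1 ?addn0// => j /negPf ji.
  by rewrite count_nseq /= ji mul0n.
- exact: mem_index_enum.
- exact: index_enum_uniq.
Qed.

Lemma size_dlist beta : size (dlist beta) = (\sum_i beta i)%N.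
Proof.
rewrite /dlist size_flatten /shape -map_comp sumnE big_map.
by apply: eq_bigr => i _ /=; rewrite size_nseq.
Qed.

Lemma pds_nseq m i f : pds (nseq m i) f = iter m (pd i) f.
Proof. by elim: m => //= m ->. Qed.

Lemma pdm_dlist (a : mindex p n) f : pdm a f = pds (dlist a) f.
Proof.
rewrite /pdm /dlist; elim: (index_enum I) => //= i s IH.
by rewrite pds_cat pds_nseq IH.
Qed.

(** Lets the derivatives along i be taken last, so that the others only define the function of one
    variable to be approximated. *)
Lemma pds_dlist_upd f beta i : smooth f ->
  pds (dlist beta) f = iter (beta i) (pd i) (pds (dlist (upd beta i 0%N)) f).
Proof.
move=> fs; rewrite -pds_nseq -pds_cat; apply: pds_perm => //.
apply/allP => j _ /=; rewrite count_cat count_nseq !count_dlist /upd.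
by apply/eqP; rewrite [pred1 j i]/= [i == j]eq_sym; case: eqP => [->|_]; rewrite ?mul1n ?mul0n ?addn0.
Qed.

Lemma tayl_bounded (q : {poly R}) (r : R) K : 0 <= r ->
  exists2 B : R, 0 <= B & forall m x, (m <= K)%N -> `|x| <= r -> `|tayl m x q| <= B.
Proof.
move=> r0; pose b (m : nat) := \sum_(j < size q^`N(m)) `|q^`N(m)`_j| * r ^+ j.
have b0 m : 0 <= b m by rewrite sumr_ge0// => j _; rewrite mulr_ge0 ?exprn_ge0.
exists (\sum_(m < K.+1) b m) => [|m x mK xr]; first by rewrite sumr_ge0.
rewrite (bigD1 (Ordinal (mK : (m < K.+1)%N)))//= (@le_trans _ _ (b m))//; last first.
  by rewrite lerDl sumr_ge0.
rewrite /tayl horner_coef (le_trans (ler_norm_sum _ _ _))//; apply: ler_sum => j _.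
by rewrite normrM normrX ler_wpM2l// lerXn2r ?nnegrE.
Qed.

(** One variable at a time: the Bernstein coefficients in variable i are values of f with that
    coordinate fixed at a node, smooth functions of the other variables that the induction
    approximates. Outside J only the value at 0 is approximated. *)
Lemma tensor_approx_on (J : seq I) f (r : R) K (e : R) : uniq J -> smooth f -> 0 < r -> 0 < e ->
  exists T : tensor, forall beta u,
  (forall i, i \notin J -> beta i = 0%N /\ u i = 0) ->
  (forall i, `|u i| <= r) -> (\sum_i beta i <= K)%N ->
  `|tev T beta u - pds (dlist beta) f (mxf u) / (\prod_i (beta i)`!)%:R| <= e.
Proof.
move=> + + r0; elim: J f e => [|i J IH] f e; last first.
  move=> /= /andP[iJ uJ] fs e0.
  have [L L0 HL] := pds_box_bounded r K.+1 fs.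
  have L1 : 0 < L + 1 by rewrite ltr_wpDl.
  have e1 : 0 < e / 2 / (L + 1) by rewrite !divr_gt0.
  have [N HN] := bernstein_approx r0 K e1.
  have /choice[B HB] : forall l : nat, exists B : R, 0 <= B /\ forall m x, (m <= K)%N ->
      `|x| <= r -> `|tayl m x (bernstein_basis r N l)| <= B.
    by move=> l; have [B B0 HB] := tayl_bounded (bernstein_basis r N l) K (ltW r0); exists B.
  (* The basis polynomials are fixed before their coefficients are approximated, with a precision
     that accounts for their size [S]. *)
  pose S := \sum_(l < N.+1) B l.
  have S0 : 0 <= S by rewrite sumr_ge0// => l _; have [] := HB l.
  have e2 : 0 < e / 2 / (S + 1) by rewrite !divr_gt0// ltr_wpDl.
  have /choice[T HT] := fun l : nat =>
    IH (fun z => f (updm z i (bernstein_node r N l))) _ uJ (smooth_updm i (bernstein_node r N l) fs) e2.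
  (* The inductive tensor is accurate at i only at the point 0 without derivatives, so its factor
     there becomes a scalar and leaves room for the basis polynomial. *)
  exists (flatten [seq [seq (c.1 * (c.2 i).[0], upd c.2 i (bernstein_basis r N l)) | c <- T l] | l <- iota 0 N.+1]).
  move=> beta u bu ur bK.
  pose beta' := upd beta i 0%N; pose u' := upd u i 0.
  pose t l := tayl (beta i) (u i) (bernstein_basis r N l).
  have -> : tev (flatten [seq [seq (c.1 * (c.2 i).[0], upd c.2 i (bernstein_basis r N l))
      | c <- T l] | l <- iota 0 N.+1]) beta u =
      \sum_(l < N.+1) tev (T l) beta' u' * t l.
    rewrite /tev big_flatten big_map -[iota 0 N.+1]/(index_iota 0 N.+1) big_mkord.
    apply: eq_bigr => l _; rewrite big_map mulr_suml; apply: eq_bigr => c _ /=.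
    rewrite (prod_upd (fun i => tayl (beta i) (u i))) -/(t l) [in RHS](bigD1 i)//=.
    rewrite /beta' /u' /upd eqxx tayl0 -!mulrA; congr (_ * (_ * _)).
    rewrite mulrC; congr (_ * _); apply: eq_bigr => k /negPf ki.
    by rewrite ki.
  pose F := pds (dlist beta') f; have sF : smooth F by exact: smooth_pds.
  pose m := beta i; pose g j x := pds (nseq j i) F (updm (mxf u) i x).
  have dg j (x : R) : is_derive x (1 : R) (g j) (g j.+1 x).
    exact: smooth_line (smooth_pds (nseq j i) sF).
  have bE : (m + \sum_i beta' i = \sum_i beta i)%N.
    rewrite [in RHS](bigD1 i)//= (bigD1 i)//= /beta' /upd eqxx add0n.
    by congr (_ + _)%N; apply: eq_bigr => k /negPf ->.
  have bndg j z : (j <= m.+1)%N -> `|z| <= r -> `|g j z| <= L.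
    move=> jm zr; rewrite /g /F -pds_cat; apply: HL.
      by rewrite size_cat size_nseq size_dlist (leq_trans (leq_add jm (leqnn _)))// addSn bE.
    by move=> a b; rewrite updmE; case: eqP => // _; rewrite mxE.
  have mK : (m <= K)%N by rewrite (leq_trans _ bK)// -bE leq_addr.
  have {}HN := HN g L m dg mK (fun z => bndg m z (leqnSn m)) (fun z => bndg m.+1 z (leqnn _)) (u i) (ur i).
  have idl : i \in dlist beta' = false.
    apply/negbTE; rewrite -has_pred1 has_count -leqNgt count_dlist.
    by rewrite /beta' /upd eqxx.
  have updu c : updm (mxf u') i c = updm (mxf u) i c.
    by apply/matrixP => a b; rewrite !updmE !mxE /u' /upd; case: eqP.
  have {}HT l : `|tev (T l) beta' u' - g 0%N (bernstein_node r N l) / (\prod_i (beta' i)`!)%:R| <= e / 2 / (S + 1).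
    have := HT l beta' u'; rewrite pds_updm// idl updu; apply.
    - by move=> k kJ; rewrite /beta' /u' /upd; case: eqP => // /eqP ki; apply: bu; rewrite inE negb_or ki.
    - by move=> k; rewrite /u' /upd; case: eqP => // _; rewrite normr0 ltW.
    - by rewrite (leq_trans _ bK)// -bE leq_addl.
  set P : R := (\prod_i (beta' i)`!)%:R in HT.
  have P1 : 1 <= P by rewrite ler1n prodn_gt0// => k; rewrite fact_gt0.
  have P0 : 0 < P := lt_le_trans ltr01 P1.
  have m0 : 0 < m`!%:R :> R by rewrite ltr0n fact_gt0.
  have PE : (\prod_i (beta i)`!)%:R = m`!%:R * P.
    rewrite (bigD1 i)//= natrM /P [in RHS](bigD1 i)//= /beta' /upd eqxx fact0 mul1n.
    by congr (_ * _%:R); apply: eq_bigr => k /negPf ->.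
  have gE : pds (dlist beta) f (mxf u) = g m (u i).
    rewrite (pds_dlist_upd beta i fs) -pds_nseq /g; congr (pds _ _ _).
    by apply/matrixP => a b; rewrite updmE !mxE; case: eqP => [->|].
  rewrite gE PE.
  have tb : \sum_(l < N.+1) g 0%N (bernstein_node r N l) * t l =
      tayl m (u i) (bernstein r N (fun l => g 0%N (bernstein_node r N l))).
    by rewrite /bernstein linear_sum/=; apply: eq_bigr => l _; rewrite linearZ.
  (* First the error of the coefficients, then that of the one-variable Bernstein approximation. *)
  have -> : \sum_(l < N.+1) tev (T l) beta' u' * t l - g m (u i) / (m`!%:R * P) =
      \sum_(l < N.+1) (tev (T l) beta' u' - g 0%N (bernstein_node r N l) / P) * t l +
      (tayl m (u i) (bernstein r N (fun l => g 0%N (bernstein_node r N l))) *+ m`! - g m (u i)) / (m`!%:R * P).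
    rewrite -tb; under [in RHS]eq_bigr do rewrite mulrBl mulrAC.
    rewrite sumrB -mulr_suml; set S1 := \sum_(l < _) _; set S2 := \sum_(l < _) _.
    by rewrite -[_ *+ m`!]mulr_natr; field; rewrite !gt_eqF.
  rewrite [e]splitr (le_trans (ler_normD _ _))// lerD//.
    apply: (@le_trans _ _ (e / 2 / (S + 1) * S)); last first.
      rewrite mulrAC ler_pdivrMr ?ltr_wpDl//.
      by rewrite ler_wpM2l ?divr_ge0 ?ltW// ltrDl.
    rewrite mulr_sumr (le_trans (ler_norm_sum _ _ _))//; apply: ler_sum => l _.
    rewrite normrM ler_pM//; have [_ h] := HB l; exact: h.
  have Q1 : 1 <= m`!%:R * P by rewrite mulr_ege1// ler1n fact_gt0.
  have Q0 : 0 < m`!%:R * P := lt_le_trans ltr01 Q1.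
  rewrite normrM normfV (gtr0_norm Q0) ler_pdivrMr//.
  apply: (le_trans HN); apply: (@le_trans _ _ (e / 2)); last first.
    by rewrite ler_peMr// divr_ge0 ?ltW.
  by rewrite mulrC mulrAC ler_pdivrMr// ler_wpM2l ?divr_ge0 ?(ltW e0)// lerDl.
move=> _ fs e0; exists [:: (f 0, fun=> 1)] => beta u bu ur bK.
have b0 i : beta i = 0%N by have [] := bu i isT.
have -> : dlist beta = [::].
  by apply: size0nil; rewrite size_dlist big1// => i _; rewrite b0.
have -> : mxf u = 0 by apply/matrixP => a b; rewrite !mxE; have [_ ->] := bu (a, b) isT.
rewrite /tev big_seq1 !big1 => [|i _|i _]; [|by rewrite b0|by rewrite b0 tayl1].
by rewrite mulr1 divr1 subrr normr0 ltW.
Qed.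

Lemma tensor_approx f (r : R) K (e : R) : smooth f -> 0 < r -> 0 < e ->
  exists T : tensor, forall beta u, (forall i, `|u i| <= r) -> (\sum_i beta i <= K)%N ->
  `|tev T beta u - pds (dlist beta) f (mxf u) / (\prod_i (beta i)`!)%:R| <= e.
Proof.
move=> fs r0 e0; have [T HT] := tensor_approx_on K (index_enum_uniq I) fs r0 e0.
by exists T => beta u ur bK; apply: HT => // i; rewrite mem_index_enum.
Qed.

End TensorApproximation.

(** * Extension of invariant functions *)

Section CauchyLimits.
Variables (R : realType) (X : Type).

Lemma uniform_cauchy_lim (u : nat -> X -> R) (l : X -> R) (e : R) K x :
  u k x @[k --> \oo] --> l x ->
  (forall k k', (K <= k)%N -> (K <= k')%N -> `|u k x - u k' x| <= e) ->
  forall k, (K <= k)%N -> `|u k x - l x| <= e.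
Proof.
move=> ul ue k Kk; apply/ler_addgt0Pr => d d0.
move/cvgrPdist_le: ul => /(_ d d0) [N _ HN].
pose m := maxn K N.
have h1 := ue k m Kk (leq_maxl _ _); have h2 := HN m (leq_maxr _ _).
rewrite (_ : u k x - l x = (u k x - u m x) - (l x - u m x)); last by ring.
by rewrite (le_trans (ler_normB _ _))// lerD.
Qed.

Lemma cauchy_cvg_seq (u : nat -> R) :
  (forall e, 0 < e -> exists K, forall k k', (K <= k)%N -> (K <= k')%N -> `|u k - u k'| <= e) ->
  u k @[k --> \oo] --> lim (u k @[k --> \oo]).
Proof.
move=> uC; apply/cauchy_cvgP/cauchy_exP => e e0.
have e2 : 0 < e / 2 by rewrite divr_gt0.
have [K HK] := uC _ e2; exists (u K); exists K => // k /= Kk.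
rewrite -ball_normE /ball_/= (le_lt_trans (HK K k (leqnn _) Kk))//.
by rewrite ltr_pdivrMr// ltr_pMr// ltr1n.
Qed.

Lemma cvg_seq_sum (T : Type) (s : seq T) (f : T -> nat -> R) (l : T -> R) :
  (forall i, f i k @[k --> \oo] --> l i) ->
  \sum_(i <- s) f i k @[k --> \oo] --> \sum_(i <- s) l i.
Proof.
move=> fl; elim: s => [|i s IH].
  rewrite big_nil (_ : (fun k => \sum_(i <- [::]) f i k) = fun=> 0); first exact: cvg_cst.
  by apply/funext => k; rewrite big_nil.
rewrite big_cons (_ : (fun k => \sum_(j <- i :: s) f j k) = (fun k => f i k + \sum_(j <- s) f j k)).
  exact: cvgD.
by apply/funext => k; rewrite big_cons.
Qed.

End CauchyLimits.

Section Extension.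
Variables (R : realType) (p n : nat).
Notation V := 'M[R]_(p, n).
Notation I := ('I_p * 'I_n)%type.
Notation A := (range (@thetamap R p n)).
Notation tensor := (seq (R * (I -> {poly R}))).
Hypothesis n_gt0 : (0 < n)%N.
Hypothesis p_gt0 : (0 < p)%N.

(** Everything is asserted on the image only; elsewhere [lim] may be a default value. *)
Lemma theta_limit (P : nat -> seq I -> V -> R) :
  (forall k t y u, cder y u (P k t) (P k (u :: t) y)) ->
  (forall t (rad e : R), 0 < e -> exists K, forall k k' (x : V), (K <= k)%N -> (K <= k')%N ->
    (forall i j, `|x i j| <= rad) -> `|P k t (thetamap x) - P k' t (thetamap x)| <= e) ->
  exists L : seq I -> V -> R,
  [/\ forall t (x : V), P k t (thetamap x) @[k --> \oo] --> L t (thetamap x),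
      forall t, {within A, continuous (L t)},
      forall F : V -> R, (forall y, A y -> F y = L [::] y) -> smooth_on A° F &
      forall F : V -> R, (forall y, A y -> F y = L [::] y) ->
        forall s y, A° y -> pds s F y = L s y].
Proof.
move=> dP PC.
pose L t y : R := lim (P k t y @[k --> \oo]).
have PL t (x : V) : P k t (thetamap x) @[k --> \oo] --> L t (thetamap x).
  apply: cauchy_cvg_seq => e e0.
  have [K HK] := PC t (\big[Num.max/0]_i `|x i.1 i.2|) e e0; exists K => k k' Kk Kk'.
  apply: HK => // i j.
  exact: (@le_bigmax _ _ _ 0 (fun ij : I => `|x ij.1 ij.2|) (i, j)).
have cvP t (rad e : R) : 0 < e -> exists K, forall k (x : V), (K <= k)%N ->
  (forall i j, `|x i j| <= rad) -> `|P k t (thetamap x) - L t (thetamap x)| <= e.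
  move=> e0; have [K HK] := PC t rad e e0; exists K => k x Kk xr.
  apply: (@uniform_cauchy_lim R V (fun k => P k t) (L t) e K (thetamap x)) => //.
  by move=> k1 k2 K1 K2; exact: HK.
pose u0 : I := (Ordinal p_gt0, Ordinal n_gt0).
have cP k t : continuous (P k t) by move=> y; have [] := dP k t y u0.
exists L; split => // [t|F FL|F FL s y Ay].
- exact: (L_within_continuous cP cvP).
- exact: (smooth_on_lim dP cP cvP FL).
- exact: (pds_lim dP cP cvP FL s Ay).
Qed.

Lemma wfvars_all : exists2 bs : seq I, wfvars bs & forall i, i \in bs.
Proof.
have row (r : 'I_p) (bs : seq I) k : (k <= n)%N -> wfvars bs -> (forall a, (r, a) \notin bs) ->
    exists2 bs', wfvars bs' & forall i, (i \in bs') = (i \in bs) || (i.1 == r) && (i.2 < k)%N.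
  elim: k => [|k IH] kn wf nr.
    by exists bs => // i; rewrite ltn0 andbF orbF.
  have [bs' wf' E] := IH (ltnW kn) wf nr.
  exists ((r, Ordinal kn) :: bs').
    split=> //= [|a ak]; rewrite E /= eqxx ?ltnn ?ak ?orbT// orbF; exact: nr.
  move=> [a b]; rewrite inE E /= xpair_eqE -[b == _]val_eqE /= ltnS [(b <= k)%N]leq_eqVlt.
  by case: (_ \in bs); case: (a == r); rewrite ?orbT ?orbF.
have rows (rs : seq 'I_p) : uniq rs ->
    exists2 bs : seq I, wfvars bs & forall i, (i \in bs) = (i.1 \in rs).
  elim: rs => [|r rs IH] /= => [_|/andP[rrs urs]]; first by exists [::].
  have [bs wf E] := IH urs.
  have [|bs' wf' E'] := row r bs n (leqnn n) wf; first by move=> a; rewrite E.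
  by exists bs' => // i; rewrite E' E inE ltn_ord andbT orbC.
have [bs wf E] := rows (enum 'I_p) (enum_uniq _).
by exists bs => // i; rewrite E mem_enum.
Qed.

(** Makes the difference of two approximants a tensor, so that [elimT_le] yields the Cauchy
    property. *)
Definition opp_tensor (T : tensor) : tensor := [seq (- c.1, c.2) | c <- T].

Lemma elimT_cat (y : V) bs t (T T' : tensor) : elimT y bs t (T ++ T') = elimT y bs t T + elimT y bs t T'.
Proof. exact: big_cat. Qed.

Lemma elimT_opp (y : V) bs t T : elimT y bs t (opp_tensor T) = - elimT y bs t T.
Proof.
by rewrite /elimT big_map/= -sumrN; apply: eq_bigr => c _; rewrite mulNr.
Qed.

Lemma tev_cat_opp (T T' : tensor) beta u : tev (T ++ opp_tensor T') beta u = tev T beta u - tev T' beta u.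
Proof.
rewrite /tev big_cat/= big_map -sumrN; congr (_ + _).
by apply: eq_bigr => c _; rewrite mulNr.
Qed.

Lemma elimT_nil (x : V) bs T : wfvars bs -> (forall i, i \in bs) ->
  elimT (thetamap x) bs [::] T =
  \sum_(q <- assigns bs) tev T (fun=> 0%N) (fun i => x i.1 (q i)).
Proof.
move=> wf bsT; rewrite /elimT /tev exchange_big/=; apply: eq_bigr => c _.
rewrite (elimv_nil x n_gt0 wf) => [|i]; last by rewrite bsT.
rewrite mulr_sumr; apply: eq_bigr => q _; congr (_ * _).
by apply: eq_bigr => i _; rewrite tayl0.
Qed.

(** When all variables are listed, an assignment is injective on each row, hence a permutation of
    it. *)
Lemma sym_assign (f : V -> R) (x : V) bs q : sym_invariant f -> wfvars bs ->
  (forall i, i \in bs) -> q \in assigns bs -> f (mxf (fun i => x i.1 (q i))) = f x.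
Proof.
move=> fsym wf bsT qin.
have inj r : injective (fun a : 'I_n => q (r, a)).
  by move=> a a'; apply: (assigns_inj wf qin).
rewrite -(fsym [ffun r => perm (inj r)] x); congr (f _).
by apply/matrixP => a b; rewrite !mxE ffunE permE.
Qed.

(** [L] is the limit of the eliminated tensors, averaged over the assignments. The constants [c] and
    [d] are chosen before t, rad, C and rho, and only derivatives of f up to order [n * size t]
    enter the bound at t. *)
Theorem smooth_extension (f : V -> R) : smooth f -> sym_invariant f ->
  exists (L : seq I -> V -> R) (c : R) (d : nat),
  [/\ [/\ forall x : V, f x = L [::] (thetamap x),
      forall t, {within A, continuous (L t)},
      forall F : V -> R, (forall y, A y -> F y = L [::] y) -> smooth_on A° F &
      forall F : V -> R, (forall y, A y -> F y = L [::] y) ->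
        forall s y, A° y -> pds s F y = L s y],
      0 <= c &
      forall (rad C rho : R) t, 1 <= rad -> 0 <= C -> 1 <= rho ->
      (forall beta u, (forall i, `|u i| <= rad) -> (\sum_i beta i <= n * size t)%N ->
        `|pds (dlist beta) f (mxf u)| / (\prod_i (beta i)`!)%:R <= C * rho ^+ (\sum_i beta i)) ->
      forall x : V, (forall i j, `|x i j| <= rad) ->
      `|L t (thetamap x)| <= C * c * ((16 * rad) ^+ d * rho) ^+ (n * size t) * (size t)`!%:R].
Proof.
move=> fs fsym; have [bs wf bsT] := wfvars_all.
have V0 (k : nat) : 0 < k.+1%:R^-1 :> R by rewrite invr_gt0 ltr0Sn.
(* One sequence serves all orders and all boxes: the k-th tensor is accurate to 1/(k+1), up to order
   k, on the box of radius k+1. *)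
have /choice[T HT] := fun k : nat => tensor_approx k fs (ltr0Sn R k) (V0 k).
pose c := (2 * n)%:R ^+ size bs : R; pose d := size bs.
have c0 : 0 <= c by rewrite exprn_ge0.
pose N : R := (size (assigns bs))%:R.
have N0 : 0 < N.
  have [q qin _] := assigns_id bs; rewrite ltr0n -has_predT.
  by apply/hasP; exists q.
pose P k t y := N^-1 * elimT y bs t (T k).
have dP k t y u : cder y u (P k t) (P k (u :: t) y) by exact/cderZ/cder_elimT.
have N1 : N^-1 <= 1 by rewrite invf_le1// ler1n; rewrite ltr0n in N0.
have elim_le (t : seq I) (T' : tensor) (rad C rho : R) (x : V) : 1 <= rad -> 1 <= rho -> 0 <= C ->
    (forall i j, `|x i j| <= rad) -> tensor_le T' rad C rho (n * size t) ->
    `|N^-1 * elimT (thetamap x) bs t T'| <=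
      C * c * ((16 * rad) ^+ d * rho) ^+ (n * size t) * (size t)`!%:R.
  move=> rad1 rho1 C0 xr T'le; rewrite normrM (@gtr0_norm _ N^-1) ?invr_gt0//.
  rewrite (le_trans (ler_piMl _ N1))//.
  exact: (elimT_le n_gt0 wf rad1 rho1 C0 xr T'le (leqnn _)).
have TC (rad : R) m k k' K : rad <= K%:R -> (m <= K)%N -> (K <= k)%N -> (K <= k')%N ->
    tensor_le (T k ++ opp_tensor (T k')) rad (2 * K.+1%:R^-1) 1 m.
  move=> radK mK Kk Kk' beta u ur bm; rewrite tev_cat_opp expr1n mulr1.
  have h j : (K <= j)%N -> `|tev (T j) beta u - pds (dlist beta) f (mxf u) / (\prod_i (beta i)`!)%:R| <= K.+1%:R^-1.
    move=> Kj; rewrite (le_trans (HT j beta u _ _))//.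
    - by move=> i; rewrite (le_trans (ur i))// (le_trans radK)// ler_nat ltnW.
    - by rewrite (leq_trans bm)// (leq_trans mK).
    - by rewrite lef_pV2 ?posrE// ler_nat.
  have := h k Kk; have := h k' Kk'; set q := pds _ _ _ / _ => h1 h2.
  have -> : tev (T k) beta u - tev (T k') beta u = (tev (T k) beta u - q) - (tev (T k') beta u - q) by ring.
  by rewrite (le_trans (ler_normB _ _))// mulr_natl mulr2n lerD.
have PC t (rad e : R) : 0 < e -> exists K, forall k k' (x : V), (K <= k)%N -> (K <= k')%N ->
    (forall i j, `|x i j| <= rad) -> `|P k t (thetamap x) - P k' t (thetamap x)| <= e.
  move=> e0; pose rad1 := Num.max rad 1.
  have r1 : 1 <= rad1 by rewrite le_max lexx orbT.
  pose W : R := c * ((16 * rad1) ^+ d * 1) ^+ (n * size t) * (size t)`!%:R.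
  have W0 : 0 <= W by rewrite !mulr_ge0 ?exprn_ge0 ?mulr_ge0 ?(le_trans ler01 r1)// exprn_ge0// mulr_ge0 ?(le_trans ler01 r1).
  pose K := (Num.bound rad1 + n * size t + Num.bound (2 * W / e))%N.
  exists K => k k' x Kk Kk' xr.
  have xr1 i j : `|x i j| <= rad1 by rewrite (le_trans (xr i j))// le_max lexx.
  have bd (z : R) : 0 <= z -> z <= (Num.bound z)%:R by move=> z0; rewrite ltW// archi_boundP.
  have := elim_le t (T k ++ opp_tensor (T k')) rad1 (2 * K.+1%:R^-1) 1 x r1 (lexx _) _ xr1.
  rewrite elimT_cat elimT_opp mulrBr => /(_ _ _)/le_trans; apply.
  - by rewrite mulr_ge0// invr_ge0.
  - apply: (TC rad1 (n * size t)%N k k' K) => //; last by rewrite /K; lia.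
    by rewrite (le_trans (bd _ (le_trans ler01 r1)))// ler_nat /K; lia.
  rewrite -[leLHS]mulrA -[leLHS]mulrA [X in _ * X](_ : _ = W); last by rewrite /W mulrA.
  have : 2 * W / e <= K.+1%:R.
    have q0 : 0 <= 2 * W / e := divr_ge0 (mulr_ge0 (ler0n R 2) W0) (ltW e0).
    by rewrite (le_trans (bd _ q0))// ler_nat (leq_trans (leq_addl _ _) (leqnSn _)).
  by rewrite ler_pdivrMr// [2 / _ * _]mulrAC ler_pdivrMr// [e * _]mulrC.
have [L [PL LA Lsm Lpds]] := theta_limit dP PC.
exists L, c, d; split=> //.
  (* At each assignment the tensor approximates f at a permuted point, which is [f x] by invariance;
     so does the average. *)
  split=> // x; apply/esym; apply: (cvg_unique _ (PL [::] x)) => //.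
  apply/cvgrPdist_le => e e0.
  pose rad : R := \big[Num.max/0]_i `|x i.1 i.2|.
  have rad0 : 0 <= rad by exact: bigmax_ge_id.
  pose K := (Num.bound rad + Num.bound e^-1)%N.
  exists K => // k /= Kk.
  have fE : f x = N^-1 * \sum_(q <- assigns bs) f x.
    by rewrite big_const_seq count_predT iter_addr_0 -(mulr_natl (f x)) mulrA mulVf ?mul1r// gt_eqF.
  rewrite fE /P elimT_nil// -mulrBr -sumrB normrM gtr0_norm ?invr_gt0//.
  rewrite mulrC ler_pdivrMr// mulrC.
  apply: (le_trans (ler_norm_sum _ _ _)); apply: sumr_le_size => q qin.
  have := HT k (fun=> 0%N) (fun i => x i.1 (q i)).
  rewrite big1// big1// => /(_ _ isT); rewrite divr1.
  rewrite (_ : dlist _ = [::]); last by apply: size0nil; rewrite size_dlist big1.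
  rewrite [pds [::] _]/= (sym_assign x fsym wf bsT qin) distrC => h.
  apply: (le_trans (h _)) => [i|].
    apply: (@le_trans _ _ rad); first exact: (@le_bigmax _ _ _ 0 (fun ij : I => `|x ij.1 ij.2|) (i.1, q i)).
    rewrite ltW// (lt_le_trans (archi_boundP rad0))// ler_nat.
    by rewrite (leq_trans _ (leqnSn k))// (leq_trans _ Kk)// leq_addr.
  have ei0 : 0 <= e^-1 by rewrite invr_ge0 ltW.
  rewrite invf_ple ?posrE//; apply: (le_trans (ltW (archi_boundP ei0))); rewrite ler_nat.
  by rewrite (leq_trans _ (leqnSn k))// (leq_trans _ Kk)// leq_addl.
move=> rad C rho t rad1 C0 rho1 fb x xr.
pose Q : R := ((16 * rad) ^+ d * rho) ^+ (n * size t).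
have rad0 : 0 <= rad := le_trans ler01 rad1.
have rho0 : 0 <= rho := le_trans ler01 rho1.
have Q0 : 0 <= Q by rewrite exprn_ge0// mulr_ge0// exprn_ge0// mulr_ge0.
pose W : R := c * Q * (size t)`!%:R.
have W0 : 0 <= W by rewrite !mulr_ge0.
apply/ler_addgt0Pr => e e0.
have e2 : 0 < e / 2 by rewrite divr_gt0.
have /cvgrPdist_le/(_ _ e2)[K _ HK] := PL t x.
(* The approximant obeys the hypothesis with C + 1/(k+1) in place of C; k is so large that the
   excess costs at most e/2, and the passage to the limit another e/2. *)
pose k := (K + Num.bound rad + n * size t + Num.bound (W / (e / 2)))%N.
have [k1 k2 k3] : [/\ n * size t <= k, Num.bound rad <= k.+1 & Num.bound (W / (e / 2)) <= k.+1]%N.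
  by rewrite /k; clear; split; lia.
have {}HK : `|L t (thetamap x) - P k t (thetamap x)| <= e / 2.
  by apply: HK; rewrite /= /k -!addnA leq_addr.
have Tk : tensor_le (T k) rad (C + k.+1%:R^-1) rho (n * size t).
  move=> beta u ur bK.
  have := HT k beta u; set q := pds _ _ _ / _ => h.
  have {}h : `|tev (T k) beta u - q| <= k.+1%:R^-1.
    apply: h => [i|]; last exact: leq_trans bK k1.
    by rewrite (le_trans (ur i))// ltW// (lt_le_trans (archi_boundP rad0))// ler_nat.
  rewrite (_ : tev (T k) beta u = q + (tev (T k) beta u - q)); last by ring.
  rewrite (le_trans (ler_normD _ _))// mulrDl lerD//.
    by have := fb beta u ur bK; rewrite normrM normfV [`|_%:R|]ger0_norm.
  by rewrite (le_trans h)// ler_peMr ?invr_ge0// exprn_ege1.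
have kE : W * k.+1%:R^-1 <= e / 2.
  rewrite ler_pdivrMr// mulrC -ler_pdivrMr// ltW//.
  have w0 : 0 <= W / (e / 2) := divr_ge0 W0 (ltW e2).
  by rewrite (lt_le_trans (archi_boundP w0))// ler_nat.
have k0 : 0 <= C + k.+1%:R^-1 by rewrite addr_ge0.
have Pk : `|P k t (thetamap x)| <= C * W + k.+1%:R^-1 * W.
  rewrite -mulrDl /W !mulrA; exact: elim_le t (T k) rad _ rho x rad1 rho1 k0 xr Tk.
rewrite -/Q -[C * c * Q]mulrA -[C * _ * _]mulrA -/W.
rewrite (_ : L t (thetamap x) = (L t (thetamap x) - P k t (thetamap x)) + P k t (thetamap x)); last by ring.
rewrite (le_trans (ler_normD _ _))// addrC [e]splitr addrA lerD//.
by rewrite (le_trans Pk)// lerD2l mulrC.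
Qed.

End Extension.

(** * Sufficiency of the growth condition *)

Section UltradifferentiableExtension.
Variables (R : realType) (p n : nat).
Notation V := 'M[R]_(p, n).
Notation I := ('I_p * 'I_n)%type.
Notation A := (range (@thetamap R p n)).
Hypothesis n_gt0 : (0 < n)%N.
Hypothesis p_gt0 : (0 < p)%N.

(** Reconciles the factorial of the total order in the definition of the classes with the product of
    factorials in the Taylor coefficients, at a geometric cost. *)
Lemma fact_sum_le (T : Type) (s : seq T) (b : T -> nat) :
  ((\sum_(i <- s) b i)`! <= 2 ^ (size s * \sum_(i <- s) b i) * \prod_(i <- s) (b i)`!)%N.
Proof.
elim: s => [|i s IH]; first by rewrite !big_nil.
rewrite !big_cons /=; set S := (\sum_(j <- s) b j)%N in IH *.
have binS : ('C(b i + S, b i) <= 2 ^ (b i + S))%N.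
  rewrite -[2%N]/(1 + 1)%N expnDn (bigD1 (Ordinal (leq_addr S (b i) : (b i < (b i + S).+1)%N)))//=.
  by rewrite !exp1n !muln1 leq_addr.
rewrite -(bin_fact (leq_addr S (b i))) [(b i + S - b i)%N]addKn.
rewrite mulSn expnD -!mulnA leq_mul// mulnCA leq_mul//.
rewrite (leq_trans IH)// leq_mul// leq_exp2l// leq_mul// ?leq_addl// leq_addr.
Qed.

Lemma nondecr_seq_le (M : nat -> R) : nondecr_seq M -> {homo M : k l / (k <= l)%N >-> k <= l}.
Proof. by move=> hM; apply: homo_leq => //; exact: le_trans. Qed.

Lemma CN_closed_extension (M N : nat -> R) (B : R) (f : V -> R) :
  (forall k, 0 < M k) -> nondecr_seq M -> (forall k, 0 < N k) -> 0 < B ->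
  (forall k, M (k * n)%N <= B ^+ k * N k) ->
  sym_invariant f -> CM M setT f ->
  exists F, CN_closed N A F /\ (forall x, f x = F (thetamap x)).
Proof.
move=> M0 Mnd N0 B0 MN fsym [fs fM].
have [L [c [d [[fL LA Lsm Lpds] c0 Lbd]]]] := smooth_extension n_gt0 p_gt0 fs fsym.
exists (L [::]); split => //; split; first exact: Lsm.
exists (fun a => L (dlist a)); split => [a y Ay|]; first by rewrite pdm_dlist Lpds.
split => // K cK KA.
have [b [_ Hb]] := compact_bounded cK.
pose rad := 1 + n%:R * (`|b| + 1).
have rad1 : 1 <= rad by rewrite lerDl mulr_ge0// addr_ge0.
have [C [rho [C0 [rho0 HC]]]] := fM _ (box_compact (r := rad)) (fun _ _ => Logic.I).
(* At least 1, as [smooth_extension] requires; the power of 2 is the cost of [fact_sum_le]. *)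
pose rho1 := Num.max 1 rho * 2 ^+ size (index_enum I).
have rho1_ge1 : 1 <= rho1 by rewrite mulr_ege1 ?le_max ?lexx// exprn_ege1// ler1n.
pose q := (16 * rad) ^+ d * rho1.
have q0 : 0 < q.
  rewrite mulr_gt0 ?(lt_le_trans ltr01 rho1_ge1)// exprn_gt0// mulr_gt0//.
  exact: lt_le_trans ltr01 rad1.
exists (C * (c + 1)), (B * q ^+ n).
split; first by rewrite mulr_gt0// ltr_wpDl.
split; first by rewrite mulr_gt0// exprn_gt0.
move=> a y Ky; have [x _ yE] := KA y Ky.
have xr i j : `|x i j| <= rad.
  apply: root_le; first by rewrite addr_ge0.
  move=> i' j'; rewrite yE (le_trans (mx_coord_le _ _ _))//.
  by apply: Hb => //; rewrite (le_lt_trans (ler_norm b))// ltrDl.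
set k := mabs a; have kE : size (dlist a) = k by rewrite size_dlist.
have Ck : 0 <= C * M (n * k)%N by rewrite mulr_ge0 ?ltW.
have fb beta u : (forall i, `|u i| <= rad) -> (\sum_i beta i <= n * size (dlist a))%N ->
    `|pds (dlist beta) f (mxf u)| / (\prod_i (beta i)`!)%:R <=
      C * M (n * k)%N * rho1 ^+ (\sum_i beta i).
  rewrite kE => ur bk; set m := (\sum_i _)%N in bk *.
  have P0 : 0 < (\prod_i (beta i)`!)%:R :> R.
    by rewrite ltr0n prodn_gt0// => i; rewrite fact_gt0.
  rewrite ler_pdivrMr//.
  have mE : mabs [ffun i => beta i] = m by apply: eq_bigr => i _; rewrite ffunE.
  have bE : dlist [ffun i => beta i] = dlist beta.
    by congr flatten; apply: eq_map => i; rewrite ffunE.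
  have := HC [ffun i => beta i] (mxf u); rewrite pdm_dlist bE mE => h.
  apply: (le_trans (h _)) => [i j|]; first by rewrite mxE; exact: ur.
  have mle : m`!%:R <= (2 ^+ size (index_enum I)) ^+ m * (\prod_i (beta i)`!)%:R :> R.
    by rewrite -exprM -natrX -natrM ler_nat; exact: fact_sum_le.
  have rhom : rho ^+ m <= (Num.max 1 rho) ^+ m.
    by rewrite lerXn2r ?nnegrE ?(ltW rho0)// ?le_max ?ler01 ?lexx ?orbT.
  (* Monotonicity replaces all orders up to n k by the single value [M (n * k)]. *)
  have Mm := nondecr_seq_le Mnd bk.
  rewrite /rho1 exprMn.
  set P : R := (\prod_i _)%:R in P0 mle *; set E := (2 ^+ _) ^+ m in mle *.
  set Z := Num.max 1 rho ^+ m in rhom *.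
  rewrite (_ : C * M (n * k)%N * (Z * E) * P = C * Z * (E * P) * M (n * k)%N); last by ring.
  have z1 : 0 <= rho ^+ m by rewrite exprn_ge0// ltW.
  apply: ler_pM => //; [|exact: ltW|]; first by rewrite !mulr_ge0// ltW.
  by apply: ler_pM => //; [rewrite mulr_ge0// ltW | rewrite ler_wpM2l// ltW].
have := Lbd rad _ rho1 (dlist a) rad1 Ck rho1_ge1 fb x xr.
rewrite yE kE -/q => /le_trans; apply.
have -> : C * M (n * k)%N * c * q ^+ (n * k) * k`!%:R =
  C * c * (q ^+ n) ^+ k * k`!%:R * M (k * n)%N by rewrite exprM [(n * k)%N]mulnC; ring.
rewrite [(B * _) ^+ k]exprMn.
have -> : C * (c + 1) * (B ^+ k * (q ^+ n) ^+ k) * k`!%:R * N k =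
  C * (c + 1) * (q ^+ n) ^+ k * k`!%:R * (B ^+ k * N k) by ring.
have qk : 0 <= (q ^+ n) ^+ k by rewrite !exprn_ge0// ltW.
apply: ler_pM => //; [|exact: ltW|].
  by rewrite !mulr_ge0// ltW.
rewrite ler_wpM2r// ler_wpM2r// ler_wpM2l ?lerDl ?ler01//; exact: ltW.
Qed.

End UltradifferentiableExtension.

(** * Necessity of the growth condition *)

Section CharacteristicFunction.
Variables (R : realType) (W mu : nat -> R).
Hypothesis W_gt0 : forall k, 0 < W k.
Hypothesis mu_gt0 : forall k, 0 < mu k.
Hypothesis WS : forall k, W k.+1 = W k * mu k.
Hypothesis mu_nd : {homo mu : k l / (k <= l)%N >-> k <= l}.

(** Convexity of log W: the line of slope log mu_k through its point at k lies below it. *)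
Let W_mu j k : W k * mu k ^+ j <= W j * mu k ^+ k.
Proof.
have up d : W k * mu k ^+ d <= W (k + d)%N.
  elim: d => [|d IH]; first by rewrite addn0 mulr1.
  rewrite addnS WS exprSr mulrA ler_pM ?mulr_ge0 ?exprn_ge0 ?(ltW (W_gt0 _)) ?(ltW (mu_gt0 _))//.
  by apply: mu_nd; exact: leq_addr.
have down d i : W (i + d)%N <= W i * mu (i + d)%N ^+ d.
  elim: d => [|d IH]; first by rewrite addn0 mulr1.
  rewrite addnS WS exprSr mulrA.
  have h : mu (i + d)%N <= mu (i + d).+1 by apply: mu_nd.
  rewrite ler_pM ?(ltW (W_gt0 _)) ?(ltW (mu_gt0 _))//.
  rewrite (le_trans IH)// ler_wpM2l ?(ltW (W_gt0 _))//.
  by rewrite lerXn2r ?nnegrE ?(ltW (mu_gt0 _)).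
have [kj|jk] := leqP k j.
  rewrite -(subnKC kj) exprD mulrA [W k * _]mulrC -[leLHS]mulrA mulrC.
  by rewrite ler_wpM2r// exprn_ge0// ltW.
have := down (k - j)%N j; rewrite subnKC ?(ltnW jk)// => h.
have -> : mu k ^+ k = mu k ^+ j * mu k ^+ (k - j) by rewrite -exprD subnKC// ltnW.
rewrite [W k * _]mulrC [W j * _]mulrCA ler_wpM2l//.
by rewrite exprn_ge0// ltW.
Qed.

(** The amplitude of the j-th derivative of the k-th term; doubling the frequency mu_k gains the
    factor 2^(j-k), which makes the series converge. *)
Let a k j : R := W k * (2 * mu k) ^+ j / (2 * mu k) ^+ k.

Let a_ge0 k j : 0 <= a k j.
Proof. by rewrite divr_ge0 ?mulr_ge0 ?exprn_ge0 ?mulr_ge0 ?(ltW (W_gt0 _)) ?(ltW (mu_gt0 _)). Qed.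

Let a_le k j : a k j <= 2 ^+ j * W j / 2 ^+ k.
Proof.
rewrite /a !exprMn ler_pdivrMr ?mulr_gt0 ?exprn_gt0//.
have -> : 2 ^+ j * W j / 2 ^+ k * (2 ^+ k * mu k ^+ k) = 2 ^+ j * (W j * mu k ^+ k).
  by field; rewrite expf_neq0.
by rewrite mulrCA ler_wpM2l// exprn_ge0.
Qed.

Let a_id j : a j j = W j.
Proof. by rewrite /a mulfK// expf_neq0// mulf_neq0// gt_eqF. Qed.

Let aS k j : a k j.+1 = a k j * (2 * mu k).
Proof. by rewrite /a exprSr mulrA mulrAC. Qed.

(* The [j]-th derivative of [cos + sin]. *)
Let cs j (x : R) : R :=
  (-1) ^+ j./2 * (if odd j then cos x - sin x else cos x + sin x).

Let cs_derive j (x : R) : is_derive x (1 : R) (cs j) (cs j.+1 x).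
Proof.
rewrite /cs /=; case: (boolP (odd j)) => oj /=.
  have -> : (-1) ^+ uphalf j * (cos x + sin x) = (-1) ^+ j./2 *: (- sin x - cos x).
    by rewrite uphalf_half oj exprS /GRing.scale /=; ring.
  by apply: is_deriveZ; apply: is_deriveB.
have -> : (-1) ^+ uphalf j * (cos x - sin x) = (-1) ^+ j./2 *: (- sin x + cos x).
  by rewrite uphalf_half (negPf oj) addrC.
by apply: is_deriveZ; apply: is_deriveD.
Qed.

Let cs_le j (x : R) : `|cs j x| <= 2.
Proof.
rewrite normrM normrX normrN1 expr1n mul1r.
have c1 : `|cos x| <= 1 by rewrite ler_norml cos_geN1 cos_le1.
have s1 : `|sin x| <= 1 by rewrite ler_norml sin_geN1 sin_le1.
by case: odd; [rewrite (le_trans (ler_normB _ _))|rewrite (le_trans (ler_normD _ _))]; rewrite // -natr1 lerD.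
Qed.

(** A sign that depends on j alone and never vanishes; the cosine by itself would lose the
    derivatives of odd order at 0. *)
Let cs0 j : cs j 0 = (-1) ^+ j./2.
Proof. by rewrite /cs cos0 sin0 subr0 addr0; case: odd; rewrite mulr1. Qed.

Let S j N (x : R) : R := \sum_(k < N) a k j * cs j (2 * mu k * x).

Let S_derive j N (x : R) : is_derive x (1 : R) (S j N) (S j.+1 N x).
Proof.
rewrite /S.
have -> : (fun x => \sum_(k < N) a k j * cs j (2 * mu k * x)) =
    \sum_(k < N) (fun x => a k j * cs j (2 * mu k * x)).
  by apply/funext => z; rewrite fct_sumE.
apply: is_derive_sum => k.
rewrite aS -mulrA; apply: is_deriveZ; move: (2 * mu k) => m.
rewrite [m * _]mulrC; apply: (@is_derive1_comp _ (cs j) (fun x : R => m * x)); first exact: cs_derive.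
by rewrite -[X in is_derive _ _ _ X]mulr1; apply: is_deriveZ.
Qed.

(** The constant 4 is the bound 2 on [cs] times the sum of the geometric tail. *)
Let S_diff j N N' (x : R) : (N <= N')%N ->
  `|S j N' x - S j N x| <= 4 * (2 ^+ j * W j) / 2 ^+ N.
Proof.
move=> NN; set C := 2 ^+ j * W j.
have C0 : 0 <= C by rewrite mulr_ge0 ?exprn_ge0// ltW.
rewrite -(subnKC NN); move: (N' - N)%N => d.
suff h : `|S j (N + d) x - S j N x| <= 4 * C / 2 ^+ N - 4 * C / 2 ^+ (N + d).
  apply: (le_trans h); rewrite gerBl divr_ge0 ?exprn_ge0// mulr_ge0//.
elim: d => [|d IH]; first by rewrite addn0 !subrr normr0.
rewrite addnS /S big_ord_recr/= -/(S j (N + d) x) addrAC.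
rewrite (le_trans (ler_normD _ _))// (le_trans (lerD IH (lexx _)))//.
have h1 : `|a (N + d) j * cs j (2 * mu (N + d) * x)| <= C / 2 ^+ (N + d) * 2.
  by rewrite normrM ler_pM// ger0_norm.
rewrite (le_trans (lerD (lexx _) h1))// [2 ^+ (N + d).+1]exprSr invfM.
rewrite le_eqVlt; apply/orP; left; apply/eqP; field.
by rewrite !expf_neq0.
Qed.

Lemma characteristic_function_aux : exists phi : nat -> R -> R,
  [/\ forall j (x : R), is_derive x (1 : R) (phi j) (phi j.+1 x),
      forall j x, `|phi j x| <= 4 * 2 ^+ j * W j &
      forall j, W j <= `|phi j 0|].
Proof.
have SC j (e : R) : 0 < e -> exists K, forall k k' x, (K <= k)%N -> (K <= k')%N ->
    `|S j k x - S j k' x| <= e.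
  move=> e0; pose C : R := 4 * (2 ^+ j * W j).
  have C0 : 0 <= C by rewrite !mulr_ge0 ?exprn_ge0// ltW.
  have e2 : 0 < e / 2 by rewrite divr_gt0.
  have q0 : 0 <= C / (e / 2) := divr_ge0 C0 (ltW e2).
  pose K := Num.bound (C / (e / 2)); exists K => k k' x Kk Kk'.
  have CK : C / 2 ^+ K <= e / 2.
    rewrite ler_pdivrMr ?exprn_gt0// mulrC -ler_pdivrMr//.
    by rewrite (le_trans (ltW (archi_boundP q0)))// -natrX ler_nat ltnW// ltn_expl.
  apply: (@dist_le_half _ _ _ (S j K x)); apply: le_trans CK; exact: S_diff.
pose phi j x : R := lim (S j k x @[k --> \oo]).
have phiP j x : S j k x @[k --> \oo] --> phi j x.
  by apply: cauchy_cvg_seq => e e0; have [K HK] := SC j e e0; exists K => k k'; exact: HK.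
have cv j (e : R) : 0 < e -> exists K, forall k x, (K <= k)%N -> `|S j k x - phi j x| <= e.
  move=> e0; have [K HK] := SC j e e0; exists K => k x.
  by apply: (@uniform_cauchy_lim R R (S j) (phi j) e K x (phiP j x)) => k1 k2 h1 h2; exact: HK.
have bd j k x : `|S j k x| <= 4 * (2 ^+ j * W j).
  by have := S_diff j x (leq0n k); rewrite {2}/S big_ord0 subr0 divr1.
have phi_bd j x : `|phi j x| <= 4 * (2 ^+ j * W j).
  apply/ler_addgt0Pr => e e0; have [K HK] := cv j e e0.
  have := HK K x (leqnn _); rewrite distrC => h.
  rewrite -[phi j x](subrK (S j K x)) (le_trans (ler_normD _ _))// addrC lerD//.
exists phi; split=> [j x|j x|j]; last 1 first.
(* All terms have the same sign at 0, so the term of index j, equal to W j in absolute value, is a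
   lower bound. *)
- have h k : (j < k)%N -> W j <= `|S j k 0|.
    move=> jk; rewrite /S; under eq_bigr do rewrite mulr0 cs0.
    rewrite -mulr_suml normrM normrX normrN1 expr1n mulr1 ger0_norm ?sumr_ge0//.
    rewrite (bigD1 (Ordinal jk))//= a_id lerDl sumr_ge0//.
  apply/ler_addgt0Pr => e e0; have [K HK] := cv j e e0.
  have := HK (K + j.+1)%N 0 (leq_addr _ _) => h1.
  have := h (K + j.+1)%N; rewrite leq_addl => /(_ isT) h2.
  rewrite (le_trans h2)// -[S j _ 0](subrK (phi j 0)) (le_trans (ler_normD _ _))// addrC lerD//.
- apply: (@lim_is_derive _ (fun k => S j k) (fun k => S j.+1 k) (phi j) (phi j.+1) x 1 ltr01) => [k h _|e e0|e e0|].
  + exact: S_derive.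
  + by have [K HK] := cv j e e0; exists K => k h Kk _; exact: HK.
  + by have [K HK] := cv j.+1 e e0; exists K => k h Kk _; exact: HK.
  (* Continuity of the limit: the partial sums are uniformly Lipschitz, by the bound on their next
     derivative. *)
  pose B : R := 4 * (2 ^+ j.+2 * W j.+2).
  have lip k y : `|S j.+1 k x - S j.+1 k y| <= B * `|x - y|.
    have [c _] := mvt_dist (a := y) (h := x - y) (fun z _ => S_derive j.+1 k z).
    by rewrite [y + _]addrC subrK => ->; rewrite normrM ler_wpM2r.
  have {}lip y : `|phi j.+1 x - phi j.+1 y| <= B * `|x - y|.
    apply/ler_addgt0Pr => e e0; have e2 : 0 < e / 2 by rewrite divr_gt0.
    have [K HK] := cv j.+1 _ e2.
    have h1 := HK K x (leqnn _); have h2 := HK K y (leqnn _); have h3 := lip K y.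
    have -> : phi j.+1 x - phi j.+1 y = (S j.+1 K x - S j.+1 K y) +
      ((S j.+1 K y - phi j.+1 y) - (S j.+1 K x - phi j.+1 x)) by ring.
    rewrite (le_trans (ler_normD _ _))// lerD// (le_trans (ler_normB _ _))//.
    by rewrite [e in leRHS]splitr lerD.
  have B0 : 0 < B by rewrite /B mulr_gt0// mulr_gt0// exprn_gt0.
  apply/cvgrPdist_le => e e0; near=> y.
  apply: (le_trans (lip y)); rewrite mulrC -ler_pdivlMr//.
  near: y; apply/nbhs_ballP; exists (e / B); [exact: divr_gt0|move=> w].
  by rewrite /ball_/= => /ltW.
- by rewrite -mulrA; exact: phi_bd.
Unshelve. all: by end_near.
Qed.

End CharacteristicFunction.

(* Bang's function [sum_k W_k (2 mu_k)^-k (cos + sin)(2 mu_k x)], where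
   [W_k = k! M_k] and [mu_k = W_(k+1) / W_k]: at 0 the terms of each of its
   derivatives all have the same sign. *)
Lemma characteristic_function (R : realType) (M : nat -> R) : logconvex M ->
  exists phi : nat -> R -> R,
  [/\ forall j (x : R), is_derive x (1 : R) (phi j) (phi j.+1 x),
      forall j x, `|phi j x| <= 4 * 2 ^+ j * (j`!%:R * M j) &
      forall j, j`!%:R * M j <= `|phi j 0|].
Proof.
move=> [M0 Mlc].
have W0 k : 0 < k`!%:R * M k by rewrite mulr_gt0 ?ltr0n ?fact_gt0.
apply: (@characteristic_function_aux R (fun k => k`!%:R * M k)
  (fun k => (k.+1)`!%:R * M k.+1 / (k`!%:R * M k))) => // [k|k|].
- exact: divr_gt0.
- by rewrite [RHS]mulrC divfK// gt_eqF.
apply: homo_leq => // [x y z|k]; first exact: le_trans.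
rewrite ler_pdivrMr// mulrAC ler_pdivlMr//.
have h := Mlc k.+1 isT.
rewrite !factS !natrM; set F : R := k`!%:R.
have F0 : 0 < F by rewrite ltr0n fact_gt0.
have -> : k.+1%:R * F * M k.+1 * (k.+1%:R * F * M k.+1) =
   (F ^+ 2 * k.+1%:R) * (k.+1%:R * M k.+1 ^+ 2) by ring.
have -> : k.+2%:R * (k.+1%:R * F) * M k.+2 * (F * M k) =
   (F ^+ 2 * k.+1%:R) * (k.+2%:R * (M k * M k.+2)) by ring.
rewrite ler_wpM2l ?mulr_ge0 ?exprn_ge0 ?(ltW F0)//.
by apply: ler_pM => //; [exact: exprn_ge0 (ltW (M0 _))|rewrite ler_nat].
Qed.

(** * Interior points of the image of theta *)

Section ThetaRange.
Variables (R : realType) (p n : nat).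
Notation V := 'M[R]_(p, n).
Notation I := ('I_p * 'I_n)%type.
Notation A := (range (@thetamap R p n)).
Hypothesis n_gt0 : (0 < n)%N.

Definition vieta (y : V) (r : 'I_p) : {poly R} :=
  'X^n - \sum_(j < n) ((-1) ^+ j * y r j) *: 'X^(n - j.+1).

Lemma vieta_thetamap x r : vieta (thetamap x) r = \prod_i ('X - (x r i)%:P).
Proof.
by rewrite prod_esym; congr (_ - _); apply: eq_bigr => j _; rewrite mxE.
Qed.

Lemma vieta_inj (y y' : V) r : vieta y r = vieta y' r -> forall j, y r j = y' r j.
Proof.
move=> /addrI/oppr_inj E j.
have h (z : V) : (\sum_(j < n) ((-1) ^+ j * z r j) *: 'X^(n - j.+1) : {poly R})`_(n - j.+1) =
    (-1) ^+ j * z r j.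
  rewrite coef_sum (bigD1 j)//= coefZ coefXn eqxx mulr1 big1 ?addr0// => i ij.
  rewrite coefZ coefXn; case: eqP => [e|]; last by rewrite mulr0.
  case/eqP: ij; apply: val_inj; move: e => /=; have := ltn_ord i; have := ltn_ord j; lia.
have := congr1 (fun q : {poly R} => q`_(n - j.+1)) E; rewrite !h.
by move=> /(congr1 ( *%R ((-1) ^+ j))); rewrite !mulrA -expr2 sqrr_sign !mul1r.
Qed.

Lemma size_vieta_tail (y : V) r :
  (size (\sum_(j < n) ((-1) ^+ j * y r j) *: 'X^(n - j.+1) : {poly R})%R <= n)%N.
Proof.
rewrite (leq_trans (size_sum _ _ _))//; apply/bigmax_leqP => j _.
by rewrite (leq_trans (size_scale_leq _ _))// size_polyXn; have := ltn_ord j; lia.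
Qed.

Lemma size_vieta y r : size (vieta y r) = n.+1.
Proof.
by rewrite /vieta size_polyDl size_polyXn// size_polyN ltnS size_vieta_tail.
Qed.

Lemma lead_coef_vieta y r : lead_coef (vieta y r) = 1.
Proof.
rewrite /vieta lead_coefDl ?lead_coefXn//.
by rewrite size_polyN size_polyXn ltnS size_vieta_tail.
Qed.

(** A point is in the image when its row polynomials have only real roots; n sign changes ensure
    this, and they are an open condition on y. *)
Lemma sign_change_range (s : nat -> R) (y : V) : {homo s : i j / (i <= j)%N >-> i <= j} ->
  (forall r (i : 'I_n), (vieta y r).[s i] * (vieta y r).[s i.+1] < 0) -> A y.
Proof.
move=> snd sy.
have /choice[z Hz] : forall u : I, exists z : R, s u.2 < z < s u.2.+1 /\ root (vieta y u.1) z.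
  move=> [r i] /=; have [|z zi rz] := poly_ivtoo _ (sy r i); first exact: snd.
  by exists z; rewrite in_itv/= in zi.
exists (\matrix_(r, i) z (r, i)) => //; apply/matrixP => r j; apply: vieta_inj.
rewrite vieta_thetamap; under eq_bigr do rewrite mxE.
have zinj : injective (fun i => z (r, i)).
  move=> i i' E; apply: val_inj; apply/eqP; rewrite eqn_leq.
  have [[/andP[h1 h2] _] [/andP[h3 h4] _]] := (Hz (r, i), Hz (r, i')).
  rewrite /= -E in h1 h2 h3 h4.
  apply/andP; split; rewrite leqNgt; apply/negP => lt.
    by have := lt_trans h1 (lt_le_trans h4 (snd _ _ lt)); rewrite ltxx.
  by have := lt_trans h3 (lt_le_trans h2 (snd _ _ lt)); rewrite ltxx.
have := @all_roots_prod_XsubC _ (vieta y r) [seq z (r, i) | i <- enum 'I_n].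
rewrite size_map size_enum_ord size_vieta lead_coef_vieta scale1r big_map big_enum => -> //.
  by apply/allP => _ /mapP[i _ ->]; have [] := Hz (r, i).
by rewrite uniq_rootsE map_inj_uniq// enum_uniq.
Qed.

Lemma continuous_vieta r (a : R) : continuous (fun y : V => (vieta y r).[a]).
Proof.
move=> y; pose u : I := (r, Ordinal n_gt0).
have -> : (fun y : V => (vieta y r).[a]) =
    (fun y => a ^+ n + - (\sum_(j < n) ((-1) ^+ j * a ^+ (n - j.+1)) * y r j)).
  apply/funext => z; rewrite /vieta hornerD hornerN hornerXn horner_sum; congr (_ - _).
  by apply: eq_bigr => j _; rewrite hornerZ hornerXn mulrAC.
apply: (cderD (cder_cst y u (a ^+ n)) (cderN (cder_sum _ (fun j _ => cderZ _ (cder_coord y u r j))))).1.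
Qed.

(** The roots e, 2e, .., ne are simple, and the half-integer multiples of e separate them. *)
Lemma thetamap_interior (e : R) : 0 < e ->
  A° (thetamap (\matrix_(r, i) (e * i.+1%:R) : V)).
Proof.
move=> e0; set x : V := \matrix_(r, i) _.
pose s (i : nat) := e * (i%:R + 2^-1).
have snd : {homo s : i j / (i <= j)%N >-> i <= j}.
  by move=> i j ij; rewrite ler_wpM2l ?(ltW e0)// lerD2r ler_nat.
(* The factor of root j at two consecutive separating points is negative for i = j only. *)
have sE (i j : nat) : (s i - e * j.+1%:R) * (s i.+1 - e * j.+1%:R) =
    e ^+ 2 * ((i%:R - j%:R) ^+ 2 - 4^-1) by rewrite /s -!natr1; field.
have e2 : 0 < e ^+ 2 by rewrite exprn_gt0.
have sx r (i : 'I_n) : (vieta (thetamap x) r).[s i] * (vieta (thetamap x) r).[s i.+1] < 0.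
  rewrite vieta_thetamap !horner_prod -big_split/= (bigD1 i)//= !hornerXsubC !mxE sE.
  rewrite subrr expr0n/= sub0r pmulr_llt0; first by rewrite pmulr_rlt0//; lra.
  apply: prodr_gt0 => j ji; rewrite !hornerXsubC !mxE sE pmulr_rgt0// subr_gt0.
  apply: (@lt_le_trans _ _ 1); first by lra.
  have [ij|ij|/val_inj E] := ltngtP i j; last by rewrite E eqxx in ji.
    by rewrite -sqrrN opprB exprn_ege1// lerBrDr addrC natr1 ler_nat.
  by rewrite exprn_ege1// lerBrDr addrC natr1 ler_nat.
suff h : \forall y \near thetamap x, forall u : I, (vieta y u.1).[s u.2] * (vieta y u.1).[s u.2.+1] < 0.
  by apply: filterS h => y hy; apply: (sign_change_range snd) => r i; exact: (hy (r, i)).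
apply: (@filter_forall V I
  (fun u y => (vieta y u.1).[s u.2] * (vieta y u.1).[s u.2.+1] < 0) (nbhs (thetamap x)) _) => u.
have := sx u.1 u.2; apply: cvgr_lt.
by apply: cvgM; exact: continuous_vieta.
Qed.

Lemma thetamap0 : thetamap (0 : V) = 0.
Proof.
apply/matrixP => r j; rewrite !mxE /Defs.esym big1// => S /eqP cS.
have [i iS] : exists i, i \in S by apply/set0Pn; rewrite -card_gt0 cS.
by rewrite (bigD1 i)//= mxE mul0r.
Qed.

Lemma esymZ (e : R) (z : 'I_n -> R) k : Defs.esym (fun l => e * z l) k = e ^+ k * Defs.esym z k.
Proof.
rewrite /Defs.esym mulr_sumr; apply: eq_bigr => S /eqP Sk.
by rewrite big_split/= prodr_const Sk.
Qed.

Lemma thetamapZ_le (e : R) (x : V) : 0 <= e <= 1 -> `|thetamap (e *: x)| <= e * `|thetamap x|.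
Proof.
move=> /andP[e0 e1]; rewrite [leLHS]/Num.Def.normr /= mx_normrE; apply/bigmax_leP.
split=> [|[r j] _ /=]; first by rewrite mulr_ge0.
rewrite mxE; have -> : (fun l => (e *: x) r l) = (fun l => e * x r l) by apply/funext => l; rewrite mxE.
rewrite esymZ normrM normrX (ger0_norm e0) ler_pM ?exprn_ge0//.
  by rewrite exprS ler_piMr// exprn_ile1.
by have := mx_coord_le (thetamap x) r j; rewrite mxE.
Qed.

(** The interior points of [thetamap_interior] tend to 0 with e, since every component of [thetamap]
    is homogeneous of positive degree. *)
Lemma within_continuous_eq0 (g1 g2 : V -> R) :
  {within A, continuous g1} -> {within A, continuous g2} ->
  (forall y, A° y -> g1 y = g2 y) -> g1 0 = g2 0.
Proof.
move=> c1 c2 g12; apply/eqP; rewrite -subr_eq0 -normr_eq0 eq_le normr_ge0 andbT.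
apply/ler_addgt0Pl => d d0; rewrite addr0.
have d2 : 0 < d / 2 by rewrite divr_gt0.
have A0 : A 0 by exists 0 => //; exact: thetamap0.
have W (g : V -> R) : {within A, continuous g} ->
    exists2 r, 0 < r & forall y, A y -> `|y| < r -> `|g 0 - g y| <= d / 2.
  move=> /subspace_continuousP/(_ 0 A0)/cvgrPdist_le/(_ _ d2).
  rewrite near_withinE => /nbhs_ballP[r r0 Hr]; exists r => // y Ay yr.
  by apply: Hr => //; rewrite -ball_normE /ball_/= sub0r normrN.
have [r1 r10 H1] := W _ c1; have [r2 r20 H2] := W _ c2.
pose x : V := \matrix_(r, i) i.+1%:R; pose t := Num.min r1 r2.
have t0 : 0 < t by rewrite lt_min r10.
have q0 : 0 < `|thetamap x| + 1 by rewrite ltr_wpDl.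
pose e := Num.min 1 (t / (`|thetamap x| + 1)).
have e0 : 0 < e by rewrite lt_min ltr01 divr_gt0.
have Ay := thetamap_interior e0; set y := thetamap _ in Ay.
have yt : `|y| < t.
  have -> : y = thetamap (e *: x) by congr thetamap; apply/matrixP => i j; rewrite !mxE.
  rewrite (le_lt_trans (thetamapZ_le x _)) ?(ltW e0) ?ge_min ?lexx//.
  apply: (@lt_le_trans _ _ (e * (`|thetamap x| + 1))); first by rewrite ltr_pM2l// ltrDl.
  by rewrite -ler_pdivlMr// ge_min lexx orbT.
apply: (@dist_le_half _ _ _ (g1 y)).
  by apply: H1; [exact: interior_subset Ay|rewrite (lt_le_trans yt)// ge_min lexx].
by rewrite g12//; apply: H2; [exact: interior_subset Ay|rewrite (lt_le_trans yt)// ge_min lexx orbT].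
Qed.

End ThetaRange.

(** * Extension of a sum of one-variable functions *)

Section ModelFunction.
Variables (R : realType) (p n : nat).
Notation V := 'M[R]_(p, n).
Notation I := ('I_p * 'I_n)%type.
Notation A := (range (@thetamap R p n)).
Hypothesis n_gt0 : (0 < n)%N.
Hypothesis p_gt0 : (0 < p)%N.
Variables (phi : nat -> R -> R) (b : nat -> R).
Hypothesis phi_derive : forall j (x : R), is_derive x (1 : R) (phi j) (phi j.+1 x).
Hypothesis phi_le : forall j x, `|phi j x| <= b j.

Let r0 : 'I_p := Ordinal p_gt0.
Let u0 : I := (r0, Ordinal n_gt0).

Definition rowsum (x : V) : R := \sum_i phi 0 (x r0 i).

(** Mixed derivatives along two different coordinates vanish on a sum of one-variable functions. *)
Definition rowsum_pds (s : seq I) (x : V) : R :=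
  \sum_i (if all (pred1 (r0, i)) s then phi (size s) (x r0 i) else 0).

Lemma cder_phi j i (x : V) u : cder x u (fun z => phi j (z r0 i))
  (if u == (r0, i) then phi j.+1 (x r0 i) else 0).
Proof.
split.
  apply: (@continuous_comp _ _ _ (fun z : V => z r0 i) (phi j)); first exact: coord_continuous.
  apply: differentiable_continuous; apply/derivable1_diffP.
  by have [] := phi_derive j (x r0 i).
apply/line_is_derive.
have E : (fun h : R => phi j ((h *: dir R u + x) r0 i)) =
    (fun h : R => phi j ((u == (r0, i))%:R * h + x r0 i)).
  apply/funext => h; rewrite !mxE mulrC; congr (phi _ (_%:R * _ + _)).
  by case: u => a c; rewrite xpair_eqE /= eq_sym [i == _]eq_sym.
rewrite E; case: eqP => _; last first.
  by under eq_fun do rewrite mul0r add0r; exact: is_derive_cst.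
under eq_fun do rewrite mul1r.
have := (@line_is_derive R R (phi j) (x r0 i) (1 : R) _).1 (phi_derive j (x r0 i)).
by congr (is_derive _ _ _ _); apply/funext => h; rewrite [h *: _]mulr1.
Qed.

Lemma cder_rowsum_pds s (x : V) u : cder x u (rowsum_pds s) (rowsum_pds (u :: s) x).
Proof.
apply: cder_sum => i _ /=; case: (all _ s); last by rewrite andbF; exact: cder_cst.
by rewrite andbT; exact: cder_phi.
Qed.

Lemma pds_rowsum s : pds s rowsum = rowsum_pds s.
Proof.
elim: s => [//|u s IH] /=; rewrite IH; apply/funext => x; rewrite /pd.
by have [_ [_ ->]] := cder_rowsum_pds s x u.
Qed.

Lemma smooth_rowsum : smooth rowsum.
Proof.
move=> s x _; rewrite pds_rowsum; split => [u|].
  by have [_ []] := cder_rowsum_pds s x u.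
by have [] := cder_rowsum_pds s x u0.
Qed.

Lemma rowsum_pds_le s (x : V) : `|rowsum_pds s x| <= n%:R * b (size s).
Proof.
rewrite (le_trans (ler_norm_sum _ _ _))// mulr_natl -[X in _ *+ X]card_ord -sumr_const.
apply: ler_sum => i _; case: ifP => _ //.
by rewrite normr0 (le_trans _ (phi_le (size s) 0)).
Qed.

Lemma sym_invariant_rowsum : sym_invariant rowsum.
Proof.
move=> s x; rewrite /rowsum [RHS](reindex_inj (@perm_inj _ (s r0)))/=.
by apply: eq_bigr => i _; rewrite mxE.
Qed.

Lemma bernstein_seq : exists Q : nat -> {poly R}, forall k m x, (m <= k)%N -> `|x| <= k.+1%:R ->
  `|tayl m x (Q k) *+ m`! - phi m x| <= k.+1%:R^-1.
Proof.
suff /choice[Q HQ] : forall k : nat, exists q : {poly R}, forall m x, (m <= k)%N -> `|x| <= k.+1%:R ->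
    `|tayl m x q *+ m`! - phi m x| <= k.+1%:R^-1 by exists Q.
move=> k; pose L := \sum_(j < k.+2) b j.
have b0 j : 0 <= b j := le_trans (normr_ge0 _) (phi_le j 0).
have bL j : (j < k.+2)%N -> b j <= L.
  by move=> jk; rewrite /L (bigD1 (Ordinal jk))//= lerDl sumr_ge0.
have L0 : 0 < L + 1 by rewrite ltr_wpDl// sumr_ge0.
have e0 : 0 < k.+1%:R^-1 / (L + 1) by rewrite divr_gt0// invr_gt0.
have [N HN] := bernstein_approx (ltr0Sn R k) k e0.
exists (bernstein k.+1%:R N (fun l => phi 0 (bernstein_node k.+1%:R N l))) => m x mk xk.
have := HN phi (L + 1) m phi_derive mk _ _ x xk; rewrite mulrC divfK ?gt_eqF//; apply.
  by move=> z _; rewrite (le_trans (phi_le _ _))// (le_trans (bL m _)) ?lerDl// ltnS ltnW.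
by move=> z _; rewrite (le_trans (phi_le _ _))// (le_trans (bL m.+1 _)) ?lerDl// !ltnS.
Qed.

Lemma ginv_zero k m : ginv (fun _ : 'I_n => 0 : R) k m = (m == 0%N)%:R.
Proof.
have w0 : wpoly (fun _ : 'I_n => 0 : R) = 0.
  by rewrite /wpoly big1// => j _; rewrite mulr0 scale0r.
rewrite /ginv /ginvp big_ord_recl/= big1 => [|i _]; last by rewrite w0 expr0n mul0rn.
by rewrite bin0 mulr1n addr0 expr0 coef1.
Qed.

(** At y = 0 the series (1 - w)^-(k+1) is 1, so only the monomial of degree equal to the weight
    survives; k+1 copies of the last index have weight (k+1) n. *)
Lemma rowL_zero k (v : 'I_n) (q : {poly R}) : v.+1 = n ->
  rowL (fun _ : 'I_n => 0 : R) (nseq k.+1 v) q =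
  (-1) ^+ (\sum_(u <- nseq k.+1 v) u)%N * k`!%:R * (k.+1 * n)%:R * q`_(k.+1 * n).
Proof.
move=> vn; rewrite /rowL /=.
have wE : wt (v :: nseq k v) = (k.+1 * n)%N.
  by rewrite -[_ :: _]/(nseq k.+1 v) /wt big_nseq iter_addn_0 vn mulnC.
pose c : R := (-1) ^+ (\sum_(u <- v :: nseq k v) u)%N * k`!%:R * (k.+1 * n)%:R.
transitivity (\sum_(m < size q | m == (k.+1 * n)%N :> nat) c * q`_m).
  rewrite [RHS]big_mkcond/=; apply: eq_bigr => m _; rewrite wE size_nseq ginv_zero -/c.
  case: (eqVneq (m : nat) (k.+1 * n)%N) => [->|mK].
    by rewrite leqnn subnn /= mulr1 mulrC.
  case: leqP => [Km|_]; last by rewrite !mulr0.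
  by rewrite subn_eq0 leqNgt ltn_neqAle eq_sym mK Km !mulr0.
have [h|h] := ltnP (k.+1 * n) (size q); first by rewrite (big_pred1 (Ordinal h)).
rewrite [q`_(_ * _)]nth_default// mulr0 big1// => m /eqP mK.
by have := ltn_ord m; rewrite mK ltnNge h.
Qed.

Let umax_proof : (n.-1 < n)%N. Proof. by rewrite prednK. Qed.
Definition umax : I := (r0, Ordinal umax_proof).

(** With a single power sum no elimination occurs and the approximants are row functionals of one
    polynomial, so the derivatives at 0 are exact; the bounds of [smooth_extension] would give no
    lower estimate. *)
Lemma rowsum_extension : exists L : seq I -> V -> R,
  [/\ forall x : V, rowsum x = L [::] (thetamap x),
      forall t, {within A, continuous (L t)},
      forall F : V -> R, (forall y, A y -> F y = L [::] y) ->
        forall s y, A° y -> pds s F y = L s y &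
      forall k, `|L (nseq k.+1 umax) 0| =
        k`!%:R * (k.+1 * n)%:R / (k.+1 * n)`!%:R * `|phi (k.+1 * n)%N 0|].
Proof.
have [Q HQ] := bernstein_seq.
pose P k t (y : V) := blockL y r0 t (Q k).
have dP k t y u : cder y u (P k t) (P k (u :: t) y) by exact: cder_blockL.
have PC t (rad e : R) : 0 < e -> exists K, forall k k' (x : V), (K <= k)%N -> (K <= k')%N ->
    (forall i j, `|x i j| <= rad) -> `|P k t (thetamap x) - P k' t (thetamap x)| <= e.
  move=> e0; pose rad1 := Num.max rad 1.
  have r1 : 1 <= rad1 by rewrite le_max lexx orbT.
  have rad0 : 0 <= rad1 := le_trans ler01 r1.
  pose W : R := n%:R * (size t)`!%:R * 2 * (8 * rad1 * 1) ^+ (n * size t).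
  have W0 : 0 <= W by rewrite !mulr_ge0 ?exprn_ge0 ?mulr_ge0.
  have q0 : 0 <= W / e := divr_ge0 W0 (ltW e0).
  pose K := (Num.bound rad1 + n * size t + Num.bound (W / e))%N.
  have [k1 k2 k3] : [/\ n * size t <= K, Num.bound rad1 <= K & Num.bound (W / e) <= K.+1]%N.
    by rewrite /K; clear; split; lia.
  exists K => k k' x Kk Kk' xr.
  have xr1 i j : `|x i j| <= rad1 by rewrite (le_trans (xr i j))// le_max lexx.
  have A0 : 0 <= 2 * K.+1%:R^-1 :> R by rewrite mulr_ge0.
  have := @blockL_bound R p n n_gt0 x r0 rad1 1 (2 * K.+1%:R^-1) t (Q k - Q k') r1 (lexx _) A0 xr1.
  rewrite linearB/= => h; apply: (le_trans (h _)) => [z l zr lK|].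
    rewrite expr1n mulr1 linearB/=.
    have qb j : (K <= j)%N -> `|tayl l z (Q j) *+ l`! - phi l z| <= K.+1%:R^-1.
      move=> Kj; rewrite (le_trans (HQ j l z _ _))//.
      - by rewrite (leq_trans lK)// (leq_trans k1).
      - rewrite (le_trans zr)// ltW// (lt_le_trans (archi_boundP rad0))// ler_nat.
        by rewrite (leq_trans k2)// (leq_trans Kj).
      - by rewrite lef_pV2 ?posrE// ler_nat.
    have h1 := qb k Kk; have h2 := qb k' Kk'.
    set X := tayl _ _ _ in h1 *; set Y := tayl _ _ _ in h2 *.
    apply: (@le_trans _ _ (`|(X - Y) *+ l`!|)).
      by rewrite normrMn -mulr_natr ler_peMr// ler1n fact_gt0.
    rewrite mulrnBl (_ : X *+ l`! - Y *+ l`! = (X *+ l`! - phi l z) - (Y *+ l`! - phi l z)); last by ring.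
    by rewrite (le_trans (ler_normB _ _))// mulr_natl mulr2n lerD.
  have -> : n%:R * (size t)`!%:R * (2 / K.+1%:R) * (8 * rad1 * 1) ^+ (n * size t) = W / K.+1%:R.
    by rewrite /W; ring.
  rewrite ler_pdivrMr// mulrC -ler_pdivrMr//.
  by rewrite (le_trans (ltW (archi_boundP q0)))// ler_nat.
have [L [PL LA Lsm Lpds]] := theta_limit n_gt0 p_gt0 dP PC.
have tQ m (z : R) : tayl m z (Q k) *+ m`! @[k --> \oo] --> phi m z.
  apply/cvgrPdist_le => e e0.
  have q0 : 0 <= e^-1 by rewrite invr_ge0 ltW.
  exists (m + Num.bound `|z| + Num.bound e^-1)%N => // k /= Kk.
  have [k1 k2 k3] : [/\ m <= k, Num.bound `|z| <= k.+1 & Num.bound e^-1 <= k.+1]%N.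
    by clear -Kk; split; lia.
  rewrite distrC (le_trans (HQ k m z k1 _))//.
    by rewrite ltW// (lt_le_trans (archi_boundP (normr_ge0 z)))// ler_nat.
  rewrite invf_ple ?posrE//.
  by rewrite (le_trans (ltW (archi_boundP q0)))// ler_nat.
exists L; split=> // [x|k].
  apply: (cvg_unique _ _ (PL [::] x)) => //.
  have E k : P k [::] (thetamap x) = \sum_i tayl 0 (x r0 i) (Q k) *+ 0`!.
    rewrite /P /blockL /= (rowL_nil (size_rowroots x r0) n_gt0 (prod_rowroots x r0)).
    by rewrite big_map big_enum; apply: eq_bigr => i _; rewrite tayl0.
  rewrite (_ : (fun k => P k [::] (thetamap x)) = (fun k => \sum_i tayl 0 (x r0 i) (Q k) *+ 0`!)); last by apply/funext.
  by apply: cvg_seq_sum => i; exact: tQ.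
set K := (k.+1 * n)%N.
(* By [rowL_zero] the approximants at 0 are [c] times K! times the coefficient of X^K in [Q j], and
   the latter product tends to [phi K 0]. *)
pose c : R := (-1) ^+ (\sum_(u <- nseq k.+1 umax.2) (u : nat))%N * k`!%:R * K%:R / K`!%:R.
have Kf : K`!%:R != 0 :> R by rewrite pnatr_eq0 -lt0n fact_gt0.
have PLc : P j (nseq k.+1 umax) 0 @[j --> \oo] --> c * phi K 0.
  rewrite (_ : (fun j => P j _ _) = (fun j => c * (tayl K 0 (Q j) *+ K`!))); last first.
    apply/funext => j; rewrite /P /blockL all_nseq eqxx orbT map_nseq.
    have -> : rowfun (0 : V) r0 = fun=> 0 by apply/funext => i; rewrite /rowfun mxE.
    rewrite rowL_zero ?prednK// /tayl horner_coef0 coef_nderivn addn0 binn mulr1n.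
    by rewrite -/K /c -[X in _ * X = _]mulr1 -mulr_natr; field.
  by apply: cvgM; [exact: cvg_cst|exact: tQ].
have := PL (nseq k.+1 umax) 0; rewrite thetamap0 => PL0.
have -> : L (nseq k.+1 umax) 0 = c * phi K 0 by exact: (cvg_unique _ PL0 PLc).
by rewrite normrM /c normrM normrM normrM normr_sign mul1r normfV !normr_nat.
Qed.

End ModelFunction.

(** * Necessity of the growth condition *)

Section Necessity.
Variables (R : realType) (p n : nat).
Notation V := 'M[R]_(p, n).
Notation I := ('I_p * 'I_n)%type.
Notation A := (range (@thetamap R p n)).
Hypothesis n_gt0 : (0 < n)%N.
Hypothesis p_gt0 : (0 < p)%N.

Lemma dlist_single (u : I) k : dlist [ffun i => if i == u then k else 0%N] = nseq k u.
Proof.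
set a : I -> nat := fun_of_fin _.
have /all_pred1P -> : all (pred1 u) (dlist a).
  apply/allP => i; rewrite -has_pred1 has_count count_dlist /a ffunE /=.
  by case: (i == u).
by rewrite size_dlist (bigD1 u)//= big1 => [|i /negPf iu]; rewrite /a ffunE ?eqxx ?addn0// iu.
Qed.

Lemma CN_closed_necessity (M N : nat -> R) : logconvex M -> (forall k, 0 < N k) ->
  (forall f : V -> R, sym_invariant f -> CM M setT f ->
    exists F, CN_closed N A F /\ (forall x, f x = F (thetamap x))) ->
  exists2 B : R, 0 < B & forall k, (0 < k)%N -> M (k * n)%N <= B ^+ k * N k.
Proof.
move=> Mlc N0 ext; have [M0 _] := Mlc.
have [phi [dphi phi_le phi0]] := characteristic_function Mlc.
have [F [[_ [G [GF [Gc Gb]]]] fF]] : exists F, CN_closed N A F /\ (forall x, rowsum p_gt0 phi x = F (thetamap x)).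
  apply: ext; first exact: sym_invariant_rowsum.
  split=> [|K _ _]; first exact: (smooth_rowsum n_gt0 p_gt0 dphi).
  (* The constants are those of [characteristic_function], summed over the n coordinates of the
     row. *)
  exists (n%:R * 4), 2; rewrite mulr_gt0// ?ltr0n//; split => //; split => // a x _.
  rewrite pdm_dlist (pds_rowsum p_gt0 dphi).
  rewrite (le_trans (rowsum_pds_le p_gt0 phi_le _ x))// size_dlist -/(mabs a).
  by rewrite !mulrA.
have [L [fL LA Lpds L0]] := rowsum_extension n_gt0 p_gt0 dphi phi_le.
have FL y : A y -> F y = L [::] y by move=> [x _ <-]; rewrite -fF fL.
have A0 : A 0 by exists 0 => //; exact: thetamap0.
(* F is determined on the image by f, so its continuous extensions agree with [L] on the interior
   and therefore at 0. *)
have GL (a : mindex p n) : G a 0 = L (dlist a) 0.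
  apply: (within_continuous_eq0 n_gt0 (Gc a) (LA (dlist a))) => y Ay.
  by rewrite GF// pdm_dlist (Lpds F FL).
have s0 : [set 0] `<=` A by move=> y ->.
have c0 : compact [set (0 : V)] by exact: compact_set1.
have [C [rho [C0 [rho0 HC]]]] := Gb _ c0 s0.
(* The constant C is absorbed as C <= max(1, C)^k, valid since k is positive. *)
pose B := Num.max 1 C * rho.
have B1 : 0 < Num.max 1 C by rewrite lt_max ltr01.
exists B; first by rewrite mulr_gt0.
case=> [//|k] _; pose u := umax n_gt0 p_gt0.
have := HC [ffun i => if i == u then k.+1 else 0%N] 0 erefl.
rewrite GL dlist_single L0.
have -> : mabs [ffun i => if i == u then k.+1 else 0%N] = k.+1.
  by rewrite -[LHS]size_dlist dlist_single size_nseq.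
set K := (k.+1 * n)%N => h.
have Kf : 0 < K`!%:R :> R by rewrite ltr0n fact_gt0.
have k0 : 0 < (k.+1)`!%:R :> R by rewrite ltr0n fact_gt0.
(* The factorials of K cancel, leaving k! (k+1) n M_K. *)
have h1 : (k.+1)`!%:R * M K <= k`!%:R * K%:R / K`!%:R * `|phi K 0|.
  apply: (@le_trans _ _ (k`!%:R * K%:R / K`!%:R * (K`!%:R * M K))); last first.
    by rewrite ler_wpM2l// divr_ge0// mulr_ge0.
  rewrite mulrA divfK ?gt_eqF// ler_pM2r// -natrM ler_nat factS mulnC leq_mul//.
  by rewrite /K -[leqLHS]muln1 leq_mul.
have {h1}h := le_trans h1 h.
have : M K <= C * rho ^+ k.+1 * N k.+1.
  rewrite -(ler_pM2l k0) (le_trans h)// le_eqVlt; apply/orP; left; apply/eqP; ring.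
move=> /le_trans; apply; rewrite ler_pM2r// /B exprMn ler_pM2r ?exprn_gt0//.
have Cm : C <= Num.max 1 C by rewrite le_max lexx orbT.
by rewrite (le_trans Cm)// exprS ler_peMr ?(ltW B1)// exprn_ege1// le_max lexx.
Qed.

End Necessity.

Lemma powR_invn_le (R : realType) (a B : R) k : (0 < k)%N -> 0 <= a -> 0 <= B ->
  (a `^ k%:R^-1 <= B) = (a <= B ^+ k).
Proof.
move=> k0 a0 B0; have kn : k%:R != 0 :> R by rewrite pnatr_eq0 -lt0n.
have aE : a = (a `^ k%:R^-1) ^+ k.
  by rewrite -powR_mulrn ?powR_ge0// -powRrM mulVf// powRr1.
by rewrite [in RHS]aE ler_pXn2r ?nnegrE ?powR_ge0.
Qed.

Theorem theorem3p3 (R : realType) (n p : nat) (M N : nat -> R) :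
  (0 < n)%N -> (0 < p)%N ->
  logconvex M -> logconvex N -> nondecr_seq M -> nondecr_seq N ->
  M 0%N = 1 -> N 0%N = 1 ->
  ((forall f : 'M[R]_(p, n) -> R,
      sym_invariant f -> CM M setT f ->
      exists F : 'M[R]_(p, n) -> R,
        CN_closed N (range (@thetamap R p n)) F /\ (forall x, f x = F (thetamap x)))
   <->
   (exists B : R, forall k : nat, (0 < k)%N ->
      (M (k * n)%N / N k) `^ (k%:R^-1) <= B)).
Proof.
move=> n0 p0 Mlc [N0 _] Mnd _ M01 N01; have [M0 _] := Mlc.
have q0 k : 0 <= M (k * n)%N / N k by rewrite divr_ge0// ltW.
split=> [ext|[B HB] f fsym fM].
  have [B B0 HB] := CN_closed_necessity n0 p0 Mlc N0 ext.
  by exists B => k k0; rewrite powR_invn_le ?(ltW B0)// ler_pdivrMr// HB.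
(* Ensures positivity. The bound in (ii) concerns k > 0; the case k = 0 is the normalisation of M
   and N. *)
pose B' := Num.max 1 B.
have B0 : 0 < B' by rewrite lt_max ltr01.
apply: (CN_closed_extension n0 p0 M0 Mnd N0 B0 _ fsym fM) => -[|k].
  by rewrite mul0n M01 N01 expr0 mulr1.
rewrite -ler_pdivrMr// -powR_invn_le ?(ltW B0)//.
by rewrite (le_trans (HB _ _))// le_max lexx orbT.
Qed.
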